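(* Let $\rho,\gamma\ge1$. (i) A feasible solution $(x,z)$ to the linear program $\bigl(\mathrm{LP2}_{\mathcal T}^{(\rho,\gamma)}\bigr)$ for ML (respectively, to the corresponding LP relaxation $\bigl(\mathrm{LP'}_{\mathcal T}^{(\rho,\gamma)}\bigr)$ for MGL) can be rounded to obtain a solution to the ML (respectively, MGL) instance of expected cost at most $O(\rho\gamma)\cdot\sum_{j,t}t\,x_{j,t}$. (ii) A feasible solution $(x,z)$ to the linear program $\bigl(\mathrm{LP2}_{\mathcal P}^{(\rho,\gamma)}\bigr)$ for ML can be rounded to obtain a solution to the ML instance of cost at most $(3.59\cdot2)\,\rho\gamma\sum_{j,t}t\,x_{j,t}$.
   Context: Minimum latency problem (ML): given the complete graph on $\mathcal D\cup\{r\}$ with metric edge weights $\{d_e\}$ (integer values), find a path starting at $r$ visiting all nodes of $\mathcal D$ that minimizes the sum over $j\in\mathcal D$ of the length of the path from $r$ to $j$. Minimum group latency problem (MGL): given a metric $d$ on $\mathcal F\cup\{r\}$ and groups $G_1,\dots,G_m\subseteq\mathcal F$, find a path starting at $r$ minimizing the sum over $j$ of the length of the path from $r$ to the first visited node of $G_j$. ''Rounding'' means a polynomial-time (in (i), randomized) procedure. Times $t$ range over $\{1,\dots,T\}$, where $T$ is an integer upper bound on the largest latency in an optimal solution. For $s\ge0$ let $\mathcal P_s$ (resp. $\mathcal T_s$) be the collection of all simple paths starting at $r$ (resp. trees containing $r$) of total length at most $s$. $\bigl(\mathrm{LP2}_{\mathcal P}^{(a,b)}\bigr)$, for ML: variables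 $x_{j,t}\ge0$ ($j\in\mathcal D$; $x_{j,t}=0$ if $d_{jr}>t$) and $z_{P,t}\ge0$ for $P\in\mathcal P_{bt}$; minimize $\sum_{j,t}t\,x_{j,t}$ subject to $\sum_tx_{j,t}\ge1$ for all $j$; $\sum_{P\in\mathcal P_{bt}}z_{P,t}\le a$ for all $t$; $\sum_{P\in\mathcal P_{bt}:\,j\in P}z_{P,t}\ge\sum_{t'\le t}x_{j,t'}$ for all $j,t$. $\bigl(\mathrm{LP2}_{\mathcal T}^{(a,b)}\bigr)$ is the same with trees $Q\in\mathcal T_{bt}$ (variables $z_{Q,t}$) replacing paths $P\in\mathcal P_{bt}$. $\bigl(\mathrm{LP'}_{\mathcal T}^{(a,b)}\bigr)$, for MGL, has one variable $x_{j,t}\ge 0$ per group $j$ and time $t$ and $z_{Q,t}\ge 0$ for $Q\in\mathcal T_{bt}$; minimize $\sum_{j,t}t\,x_{j,t}$ subject to $\sum_tx_{j,t}\ge1$ for all $j$; $\sum_{Q\in\mathcal T_{bt}}z_{Q,t}\le a$ for all $t$; $\sum_{Q\in\mathcal T_{bt}:\,G_j\cap Q\ne\emptyset}z_{Q,t}\ge\sum_{t'\le t}x_{j,t'}$ for all $j,t$. *)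

(* Defs.v *)
From HB Require Import structures.
From mathcomp Require Import all_boot all_order all_algebra.
From mathcomp Require Import reals.

Set Implicit Arguments.
Unset Strict Implicit.
Unset Printing Implicit Defensive.

Import Order.TTheory GRing.Theory Num.Theory.
Local Open Scope ring_scope.

(* The n non-root nodes (clients of ML, facilities of MGL) are indexed by 'I_n;
   the root r is ord0. *)
Definition vertex (n : nat) : finType := 'I_n.+1.
Definition root {n : nat} : vertex n := ord0.
Definition node {n : nat} (j : 'I_n) : vertex n := lift ord0 j.

Definition distance (n : nat) : Type := vertex n -> vertex n -> rat.

(* Distinct nodes may be at distance 0 (co-located nodes). *)
Definition is_metric n (d : distance n) : Prop :=
  [/\ forall u, d u u = 0,
      forall u v, 0 <= d u v,
      forall u v, d u v = d v u &
      forall u v w, d u w <= d u v + d v w].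

Definition integer_valued n (d : distance n) : Prop :=
  forall u v, d u v \is a Num.int.

(* A path starting at r is given by the sequence p of the nodes that follow r. *)

Fixpoint walk_len n (d : distance n) (u : vertex n) (p : seq (vertex n)) : rat :=
  if p is v :: p' then d u v + walk_len d v p' else 0.

Definition path_len n (d : distance n) (p : seq (vertex n)) : rat :=
  walk_len d root p.

Definition simple_path n (p : seq (vertex n)) : bool := uniq (root :: p).

(* Length of the path from r to the first visited node of S, when p meets S. *)
Definition latency n (d : distance n) (p : seq (vertex n)) (S : {set vertex n})
  : rat := path_len d (take (find (mem S) p).+1 p).

Definition ml_solution n (p : seq (vertex n)) : Prop :=
  simple_path p /\ forall j : 'I_n, node j \in p.

Definition ml_latency n (d : distance n) (p : seq (vertex n)) (j : 'I_n) : rat :=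
  latency d p [set node j].

Definition ml_cost n (d : distance n) (p : seq (vertex n)) : rat :=
  \sum_(j < n) ml_latency d p j.

Definition groups (n m : nat) : Type := 'I_m -> {set 'I_n}.

Definition group_nodes n m (G : groups n m) (j : 'I_m) : {set vertex n} :=
  [set node f | f in G j].

Definition mgl_solution n m (G : groups n m) (p : seq (vertex n)) : Prop :=
  simple_path p /\ forall j : 'I_m, has (mem (group_nodes G j)) p.

Definition mgl_latency n m (d : distance n) (G : groups n m)
  (p : seq (vertex n)) (j : 'I_m) : rat := latency d p (group_nodes G j).

Definition mgl_cost n m (d : distance n) (G : groups n m) (p : seq (vertex n))
  : rat := \sum_(j < m) mgl_latency d G p j.

Definition optimal n (sol : seq (vertex n) -> Prop)
  (cost : seq (vertex n) -> rat) (p : seq (vertex n)) : Prop :=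
  sol p /\ forall p', sol p' -> cost p <= cost p'.

Definition ml_horizon n (d : distance n) (T : nat) : Prop :=
  exists2 p, optimal (@ml_solution n) (ml_cost d) p
           & forall j, ml_latency d p j <= T%:R.

Definition mgl_horizon n m (d : distance n) (G : groups n m) (T : nat) : Prop :=
  exists2 p, optimal (mgl_solution G) (mgl_cost d G) p
           & forall j, mgl_latency d G p j <= T%:R.

(* A simple path starting at r has at most n further nodes. *)
Definition route (n : nat) : finType := n.-bseq (vertex n).

(* A tree containing r is given by its edge set. The edge {u, v} is the pair
   (u, v) with u < v; no edges at all is the tree reduced to r. *)
Definition edges (n : nat) : finType := {set vertex n * vertex n}.

Definition adj n (Q : edges n) : rel (vertex n) :=
  fun u v => ((u, v) \in Q) || ((v, u) \in Q).

Definition tree_nodes n (Q : edges n) : {set vertex n} :=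
  [set v | (v == root) || [exists u, adj Q u v]].

Definition rooted_tree n (Q : edges n) : bool :=
  [&& [forall e in Q, e.1 < e.2]%N,
      [forall v in tree_nodes Q, connect (adj Q) root v] &
      [forall c : n.+1.-bseq (vertex n), (2 < size c)%N ==> ~~ ucycleb (adj Q) c]].

Definition tree_len n (d : distance n) (Q : edges n) : rat :=
  \sum_(e in Q) d e.1 e.2.

Definition paths_le (R : realType) n (d : distance n) (s : R) : pred (route n) :=
  fun P => simple_path P && (ratr (path_len d P) <= s).

Definition trees_le (R : realType) n (d : distance n) (s : R) : pred (edges n) :=
  fun Q => rooted_tree Q && (ratr (tree_len d Q) <= s).

(* The common form of the three linear programs, over subgraphs Q : U, with
   [avail t Q] for "z_{Q,t} is a variable" and [covers Q j] for "Q visits j".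
   Values of x and z outside 1 <= t <= T are irrelevant. *)
Definition lp_feasible (R : realType) (m T : nat) (U : finType) (a : R)
  (avail : nat -> pred U) (covers : U -> 'I_m -> bool)
  (x : 'I_m -> nat -> rat) (z : U -> nat -> rat) : Prop :=
  [/\ forall j t, (1 <= t <= T)%N -> 0 <= x j t,
      forall Q t, (1 <= t <= T)%N ->
        if avail t Q then 0 <= z Q t else z Q t == 0,
      forall j, 1 <= \sum_(1 <= t < T.+1) x j t,
      forall t, (1 <= t <= T)%N -> ratr (\sum_(Q | avail t Q) z Q t) <= a &
      forall j t, (1 <= t <= T)%N ->
        \sum_(1 <= t' < t.+1) x j t' <= \sum_(Q | avail t Q && covers Q j) z Q t].

Definition lp_cost (m T : nat) (x : 'I_m -> nat -> rat) : rat :=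
  \sum_(j < m) \sum_(1 <= t < T.+1) t%:R * x j t.

Definition reachable_only n (d : distance n) (T : nat) (x : 'I_n -> nat -> rat)
  : Prop :=
  forall j t, (1 <= t <= T)%N -> t%:R < d (node j) root -> x j t = 0.

Definition lp2_path_feasible (R : realType) n (d : distance n) (T : nat)
  (a b : R) (x : 'I_n -> nat -> rat) (z : route n -> nat -> rat) : Prop :=
  reachable_only d T x /\
  lp_feasible T a (fun t => paths_le d (b * t%:R))
    (fun P j => node j \in val P) x z.

Definition lp2_tree_feasible (R : realType) n (d : distance n) (T : nat)
  (a b : R) (x : 'I_n -> nat -> rat) (z : edges n -> nat -> rat) : Prop :=
  reachable_only d T x /\
  lp_feasible T a (fun t => trees_le d (b * t%:R))
    (fun Q j => node j \in tree_nodes Q) x z.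

Definition lp'_tree_feasible (R : realType) n m (d : distance n)
  (G : groups n m) (T : nat) (a b : R)
  (x : 'I_m -> nat -> rat) (z : edges n -> nat -> rat) : Prop :=
  lp_feasible T a (fun t => trees_le d (b * t%:R))
    (fun Q j => group_nodes G j :&: tree_nodes Q != set0) x z.

(* Model of computation: a first-order functional language with recursive
   functions over binary trees whose leaves are natural numbers. Arithmetic is
   charged the bit length of its operands, everything else one unit. Values are
   only built by unit-cost steps and shared by reference, so an evaluation of
   cost c is simulated by a Turing machine in time polynomial in c and the
   size of the input, and conversely polynomial-time Turing machines run in
   polynomial cost. *)

Inductive data := Atom of nat | Node of data & data.

Definition bitlen (k : nat) : nat := (trunc_log 2 k).+1.

Fixpoint data_size (v : data) : nat :=
  match v with
  | Atom k => bitlen k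
  | Node a b => (data_size a + data_size b).+1
  end.

Inductive arith := Add | Sub | Mul | Div | Mod | Leq.

Definition arith_sem (o : arith) (a b : nat) : nat :=
  match o with
  | Add => a + b
  | Sub => a - b
  | Mul => a * b
  | Div => a %/ b
  | Mod => a %% b
  | Leq => a <= b
  end%N.

Inductive term :=
  | Var of nat
  | Cst of nat
  | Op of arith & term & term
  | Cons of term & term
  | Fst of term
  | Snd of term
  | IsNode of term
  | If of term & term & term
  | Let of term & term
  | Call of nat & term.

(* Function number f has body nth (Cst 0) p f, evaluated in the environment
   holding its only argument; the entry point is function 0. Variables are de
   Bruijn indices. *)
Definition program := seq term.

Definition body (p : program) (f : nat) : term := nth (Cst 0) p f.

(* [evals p e t v c]: in environment e, t evaluates to v at cost c. *)
Inductive evals (p : program) : seq data -> term -> data -> nat -> Prop :=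
  | EvVar e i : evals p e (Var i) (nth (Atom 0) e i) 1
  | EvCst e k : evals p e (Cst k) (Atom k) 1
  | EvOp e o t1 t2 a b c1 c2 :
      evals p e t1 (Atom a) c1 -> evals p e t2 (Atom b) c2 ->
      evals p e (Op o t1 t2) (Atom (arith_sem o a b))
        (c1 + c2 + bitlen a + bitlen b)
  | EvCons e t1 t2 v1 v2 c1 c2 :
      evals p e t1 v1 c1 -> evals p e t2 v2 c2 ->
      evals p e (Cons t1 t2) (Node v1 v2) (c1 + c2).+1
  | EvFst e t v1 v2 c : evals p e t (Node v1 v2) c -> evals p e (Fst t) v1 c.+1
  | EvSnd e t v1 v2 c : evals p e t (Node v1 v2) c -> evals p e (Snd t) v2 c.+1
  | EvIsNode e t v c : evals p e t v c ->
      evals p e (IsNode t) (Atom (if v is Node _ _ then 1 else 0)) c.+1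
  | EvIf e t t1 t2 k v c1 c2 :
      evals p e t (Atom k) c1 -> evals p e (if k != 0 then t1 else t2) v c2 ->
      evals p e (If t t1 t2) v (c1 + c2).+1
  | EvLet e t1 t2 v1 v2 c1 c2 :
      evals p e t1 v1 c1 -> evals p (v1 :: e) t2 v2 c2 ->
      evals p e (Let t1 t2) v2 (c1 + c2).+1
  | EvCall e f t v w c1 c2 :
      evals p e t v c1 -> evals p [:: v] (body p f) w c2 ->
      evals p e (Call f t) w (c1 + c2).+1.

Definition computes (p : program) (input output : data) (time : nat) : Prop :=
  exists2 c, (c <= time)%N & evals p [:: input] (body p 0) output c.

Definition enc_seq (A : Type) (enc : A -> data) (s : seq A) : data :=
  foldr (fun a v => Node (enc a) v) (Atom 0) s.

(* Used on nonnegative rationals only. *)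
Definition enc_rat (q : rat) : data :=
  Node (Atom (absz (numq q))) (Atom (absz (denq q))).

Definition enc_bits (w : seq bool) : data :=
  enc_seq (fun b : bool => Atom b) w.

Definition enc_path n (p : seq (vertex n)) : data :=
  enc_seq (fun v : vertex n => Atom (nat_of_ord v)) p.

Definition enc_distance n (d : distance n) : data :=
  enc_seq (fun u => enc_seq (fun v => enc_rat (d u v)) (enum (vertex n)))
          (enum (vertex n)).

Definition enc_tree n (Q : edges n) : data :=
  enc_seq (fun e : vertex n * vertex n =>
             Node (Atom (nat_of_ord e.1)) (Atom (nat_of_ord e.2))) (enum Q).

Definition enc_groups n m (G : groups n m) : data :=
  enc_seq (fun j => enc_path (enum (group_nodes G j))) (enum 'I_m).

Definition enc_x (m T : nat) (x : 'I_m -> nat -> rat) : data :=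
  enc_seq (fun j => enc_seq (fun t => enc_rat (x j t)) (iota 1 T)) (enum 'I_m).

(* There are exponentially many variables z_{Q,t}: only the nonzero ones are
   listed, for each t. *)
Definition enc_z (T : nat) (U : finType) (enc : U -> data)
  (z : U -> nat -> rat) : data :=
  enc_seq (fun t => enc_seq (fun Q => Node (enc Q) (enc_rat (z Q t)))
                            [seq Q <- enum U | z Q t != 0]) (iota 1 T).

Definition enc_ml n (d : distance n) (T : nat) (x : 'I_n -> nat -> rat)
  (enc_zs : data) : data :=
  Node (enc_distance d) (Node (Atom T) (Node (enc_x T x) enc_zs)).

Definition enc_mgl n m (d : distance n) (G : groups n m) (T : nat)
  (x : 'I_m -> nat -> rat) (enc_zs : data) : data :=
  Node (enc_distance d)
    (Node (enc_groups G) (Node (Atom T) (Node (enc_x T x) enc_zs))).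

(* On [input], within time q(size), p outputs a solution of cost <= bound. *)
Definition rounds_det (R : realType) (p : program) (q : {poly nat})
  (input : data) n (sol : seq (vertex n) -> Prop)
  (cost : seq (vertex n) -> rat) (bound : R) : Prop :=
  exists out : seq (vertex n),
    [/\ computes p input (enc_path out) q.[data_size input],
        sol out & ratr (cost out) <= bound].

(* Same, p being moreover given q(size) independent fair coin flips: it outputs
   a solution whatever the flips, and the expected cost is <= bound. *)
Definition rounds_rand (R : realType) (p : program) (q : {poly nat})
  (input : data) n (sol : seq (vertex n) -> Prop)
  (cost : seq (vertex n) -> rat) (bound : R) : Prop :=
  let k := q.[data_size input] in
  exists out : k.-tuple bool -> seq (vertex n),
    [/\ forall w : k.-tuple bool,
          computes p (Node input (enc_bits w)) (enc_path (out w)) k,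
        forall w : k.-tuple bool, sol (out w) &
        ratr ((\sum_(w : k.-tuple bool) cost (out w)) / 2 ^+ k) <= bound].

(* Main.v *)
(* Part (ii) and the ML half of part (i): for each multiplier lam, a tree paying
   its cost plus lam for every missed node is grown from r by raising all duals
   uniformly; a node that has spent its potential is bypassed in the metric, and
   a node reached by a tight edge is merged into its neighbour. The same steps
   transform fractional walks, so the tree costs no more than any fractional
   family of walks covering the nodes. Walking around the trees for a geometric
   grid of multipliers gives tours, and a dynamic program concatenates them in
   the best way. It is compared with the following random concatenation: at the
   times o + 5 i of the scale (6/5)^k, with o one of 0, ..., 4, take a mixture of
   two consecutive tours of the grid that has, up to factors 33/32 and 9/8, the
   length and the number of missed nodes of the LP at that time. Averaging over o
   gives a factor below 7, and twice that for trees, which are first doubled.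
   MGL: among the tours around the trees of the LP, always take the one with the
   best ratio of length to newly hit groups; comparing it with the first time at
   which the LP covers half of the remaining groups gives a factor 8.
   The running times come from closure properties of the maps that programs
   compute in polynomial time. *)

(* At a fixed time the LP is a fractional family of walks of bounded length missing some expected
   number of nodes, and a tree for a multiplier [lam] is compared with it for the Lagrangian: cost
   plus [lam] times the missed nodes. No single multiplier controls both terms, hence a mixture of
   two trees. Mixtures and offset live in the analysis only: the dynamic program does at least as
   well as the average, so the output is deterministic. Trees lose no factor 2 because duals are
   paid on entering a node: a walk enters every node it visits, and a tree has exactly one edge into
   each of its nodes. A closed tour is charged with its whole length to every node not yet visited.
   On a geometric scale of ratio b with a random offset this costs b / ln b, least at b = e; the
   ratio (6/5)^5 is about 2.49, and its five offsets give (6/5)^6, about 2.99. Turning trees into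
   tours doubles this, and the two error factors bring it to about 6.93. The algorithms handle
   natural numbers only, so distances are scaled to integers. *)
Require Import Defs.
From HB Require Import structures.
From mathcomp Require Import all_boot all_order all_algebra.
From mathcomp Require Import reals.
From mathcomp Require Import zify lra ring.

Set Implicit Arguments.
Unset Strict Implicit.
Unset Printing Implicit Defensive.

Import Order.TTheory GRing.Theory Num.Theory.

(** * Maps computable in polynomial time *)

(* The points satisfying dom are the values of the free variables env of a term;
   costs are measured against msz, the size of the whole input. *)
Record ctx := Ctx {
  pt : Type; dom : pt -> Prop; env : pt -> seq data; nvars : nat;
  msz : pt -> nat;
  env_size : forall e, dom e -> size (env e) = nvars }.
Arguments dom {c} e.
Arguments env {c} e.
Arguments msz {c} e.

(** The family [(s + a) ^ a] grows with [a] and dominates every polynomial in [s], so a single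
    number witnesses a bound, and closure properties amount to enlarging it. *)
Definition pbnd (X : ctx) (f : pt X -> nat) : Prop :=
  exists a, forall e : pt X, dom e -> f e <= (msz e + a) ^ a.

Lemma pexp_mono s a b : a <= b -> (s + a) ^ a <= (s + b) ^ b.
Proof.
move=> ab; case: (posnP (s + b)) => [E|P].
  by have [-> ->] : a = b /\ b = 0 by lia.
apply: (@leq_trans ((s + b) ^ a)); last by rewrite leq_pexp2l.
by case: a ab => // a ab; rewrite leq_exp2r // leq_add2l.
Qed.

Section Bounds.
Variable X : ctx.
Implicit Types f g : pt X -> nat.

Lemma pbnd_le g f : (forall e : pt X, dom e -> f e <= g e) -> pbnd g -> pbnd f.
Proof. by move=> fg [a Ha]; exists a => e de; apply: leq_trans (fg e de) (Ha e de). Qed.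

Lemma pbndS f : pbnd f -> pbnd (fun e => (f e).+1).
Proof.
case=> a Ha; exists a.+2 => e de; have := Ha e de.
have := @pexp_mono (msz e) a a.+1 (leqnSn _).
have E : (msz e + a.+2) ^ a.+2 = (msz e + a.+2) * (msz e + a.+2) ^ a.+1 by rewrite expnS.
have : (msz e + a.+1) ^ a.+1 <= (msz e + a.+2) ^ a.+1 by rewrite leq_exp2r //; lia.
have : 0 < (msz e + a.+2) ^ a.+1 by rewrite expn_gt0; lia.
rewrite E; move: ((msz e + a.+2) ^ a.+1) => x; nia.
Qed.

Lemma pbndM f g : pbnd f -> pbnd g -> pbnd (fun e => f e * g e).
Proof.
case=> a Ha [b Hb]; exists (a + b) => e de.
apply: (leq_trans (leq_mul (Ha e de) (Hb e de))).
rewrite expnD; apply: leq_mul.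
  by case: a {Ha} => // a; rewrite leq_exp2r //; lia.
by case: b {Hb} => // b; rewrite leq_exp2r //; lia.
Qed.

(** Sums reduce to products, since [f + g] is at most the product of [f + 1] and [g + 1]. *)
Lemma pbndD f g : pbnd f -> pbnd g -> pbnd (fun e => f e + g e).
Proof.
move=> /pbndS bf /pbndS bg; apply: pbnd_le (pbndM bf bg) => e _; nia.
Qed.

Lemma pbnd_msz : pbnd (@msz X).
Proof. by exists 1 => e _; rewrite expn1; lia. Qed.

Lemma pbnd_const k : pbnd (fun _ : pt X => k).
Proof.
by exists k.+1 => e _; apply: leq_trans (leq_pexp2l (_ : 0 < _) (_ : 1 <= k.+1)); lia.
Qed.

Lemma pbnd_exp a : pbnd (fun e : pt X => (msz e + a) ^ a).
Proof. by exists a. Qed.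
End Bounds.

Section Extension.
Variables (X : ctx) (B : Type) (P : pt X -> B -> Prop) (enc : B -> data).

Lemma ext_env_size (eb : pt X * B) : dom eb.1 /\ P eb.1 eb.2 ->
  size (rcons (env eb.1) (enc eb.2)) = (nvars X).+1.
Proof. by case=> de _; rewrite size_rcons env_size. Qed.

(** The new variable is the last one: the de Bruijn indices of the older variables, hence the terms
    that use them, stay the same. *)
Definition ext : ctx :=
  {| pt := (pt X * B)%type; dom := fun eb => dom eb.1 /\ P eb.1 eb.2;
     env := fun eb => rcons (env eb.1) (enc eb.2);
     msz := fun eb => msz eb.1; env_size := ext_env_size |}.

Lemma pbnd_ext f : pbnd f -> @pbnd ext (fun eb => f eb.1).
Proof. by case=> a Ha; exists a => e [de _]; apply: Ha. Qed.
End Extension.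

(** Calls refer to absolute function numbers, so a block of functions has to know the offset [k] at
    which it is placed. *)
Definition has_at (p : program) (k : nat) (fs : seq term) : Prop :=
  forall i, i < size fs -> body p (k + i) = nth (Cst 0) fs i.

Lemma has_at_cat p k fs1 fs2 :
  has_at p k (fs1 ++ fs2) -> has_at p k fs1 /\ has_at p (k + size fs1) fs2.
Proof.
move=> H; split=> i li.
  by rewrite H ?size_cat ?nth_cat ?li //; lia.
by rewrite -addnA H ?size_cat ?nth_cat ?ltn_add2l // ltnNge leq_addr /= addKn.
Qed.

(* [term_in X enc f p t b]: t computes f at cost at most b. The additional
   variables rest make weakening automatic. *)
Definition term_in (X : ctx) A (enc : A -> data) (f : pt X -> A) p t b : Prop :=
  forall (e : pt X) rest, dom e ->
    exists2 c, c <= b e & evals p (env e ++ rest) t (enc (f e)) c.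

(* The value [f e] is computable in polynomial time from the variables [env e]:
   for some functions fs placed anywhere in a program. *)
Definition PT (X : ctx) A (enc : A -> data) (f : pt X -> A) : Prop :=
  pbnd (fun e => data_size (enc (f e))) /\
  forall k, exists fs t b, pbnd b /\ forall p, has_at p k fs -> term_in enc f p t b.

Lemma PT_size X A (enc : A -> data) (f : pt X -> A) :
  PT enc f -> pbnd (fun e => data_size (enc (f e))).
Proof. by case. Qed.

(** Only the encodings have to agree, not the types: a list cell is built as a pair, and a boolean
    is computed as a number. *)
Lemma PT_ext X A B (enc : A -> data) (enc' : B -> data) (f : pt X -> A) (g : pt X -> B) :
  (forall e : pt X, dom e -> enc' (g e) = enc (f e)) -> PT enc f -> PT enc' g.
Proof.
move=> E [sf Hf]; split; first by apply: pbnd_le sf => e de; rewrite E.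
move=> k; have [fs [t [b [bb H]]]] := Hf k; exists fs, t, b; split=> // p /H Hp e rest de.
by rewrite E //; apply: Hp.
Qed.

Lemma data_size_gt0 v : 0 < data_size v.
Proof. by case: v. Qed.

Section Rules.
Variable X : ctx.

Lemma PT1 A A' (encA : A -> data) (encA' : A' -> data) (f : pt X -> A) (f' : pt X -> A') mk :
  pbnd (fun e => data_size (encA' (f' e))) ->
  (forall p env (e : pt X) t c, dom e -> evals p env t (encA (f e)) c ->
     exists2 c', c' <= c + 1 + data_size (encA (f e)) & evals p env (mk t) (encA' (f' e)) c') ->
  PT encA f -> PT encA' f'.
Proof.
move=> sf' H [sf Hf]; split=> // k; have [fs [t [b [bb Ht]]]] := Hf k.
exists fs, (mk t), (fun e => b e + 1 + data_size (encA (f e))); split.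
  by do 2?apply: pbndD => //; apply: pbnd_const.
move=> p hp e rest de; have [c lc ev] := Ht p hp e rest de.
have [c' lc' ev'] := H _ _ _ _ _ de ev; exists c' => //.
by apply: leq_trans lc' _; rewrite !leq_add2r.
Qed.

(** Common shape of the binary constructs [mk]; the two sizes in the cost bound pay for the bit
    lengths charged to arithmetic. *)
Lemma PT2 A1 A2 A' (enc1 : A1 -> data) (enc2 : A2 -> data) (encA' : A' -> data)
  (f1 : pt X -> A1) (f2 : pt X -> A2) (f' : pt X -> A') mk :
  pbnd (fun e => data_size (encA' (f' e))) ->
  (forall p env (e : pt X) t1 t2 c1 c2, dom e ->
     evals p env t1 (enc1 (f1 e)) c1 -> evals p env t2 (enc2 (f2 e)) c2 ->
     exists2 c', c' <= c1 + c2 + 1 + data_size (enc1 (f1 e)) + data_size (enc2 (f2 e)) &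
       evals p env (mk t1 t2) (encA' (f' e)) c') ->
  PT enc1 f1 -> PT enc2 f2 -> PT encA' f'.
Proof.
move=> sf' H [sf Hf] [sg Hg]; split=> // k; have [fs [t [b [bb Ht]]]] := Hf k.
have [gs [u [d [bd Hu]]]] := Hg (k + size fs).
exists (fs ++ gs), (mk t u),
  (fun e => b e + d e + 1 + data_size (enc1 (f1 e)) + data_size (enc2 (f2 e))); split.
  by do ?apply: pbndD => //; apply: pbnd_const.
move=> p /has_at_cat[hp hq] e rest de; have [c lc ev] := Ht p hp e rest de.
have [c2 lc2 ev2] := Hu p hq e rest de.
have [c' lc' ev'] := H _ _ _ _ _ _ _ de ev ev2; exists c' => //.
by apply: leq_trans lc' _; rewrite !leq_add2r leq_add.
Qed.

Lemma PT_cst k : PT Atom (fun _ : pt X => k).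
Proof.
split; first exact: pbnd_const.
move=> i; exists [::], (Cst k), (fun _ => 1); split; first exact: pbnd_const.
by move=> p _ e rest de; exists 1 => //; apply: EvCst.
Qed.

Lemma bitlen_le2 a b : a <= b -> bitlen a <= bitlen b.
Proof. by move=> ab; rewrite /bitlen ltnS leq_trunc_log. Qed.

Lemma bitlenP a k : (bitlen a <= k.+1) = (a < 2 ^ k.+1).
Proof.
rewrite /bitlen ltnS; case: (posnP a) => [->|a0]; first by rewrite trunc_log0 expn_gt0.
apply/idP/idP => [h|h].
  by apply: leq_trans (trunc_log_ltn a (isT : 1 < 2)) _; rewrite leq_exp2l.
rewrite -ltnS -(ltn_exp2l _ _ (isT : 1 < 2)).
by apply: leq_ltn_trans (trunc_logP (isT : 1 < 2) a0) h.
Qed.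

Lemma bitlen_lt a : a < 2 ^ bitlen a.
Proof. by rewrite /bitlen; exact: trunc_log_ltn. Qed.

Lemma bitlen_leP a k : a < 2 ^ k -> bitlen a <= k.+1.
Proof. by case: k => [|k] h; rewrite bitlenP //; apply: leq_trans h _; rewrite leq_exp2l. Qed.

Lemma bitlen_leq a : bitlen a <= a.+1.
Proof. by apply: bitlen_leP; apply: ltn_expl. Qed.

Lemma bitlenD a b : bitlen (a + b) <= bitlen a + bitlen b.
Proof.
have [x Ex] : exists x, bitlen a = x.+1 by exists (trunc_log 2 a).
have [y Ey] : exists y, bitlen b = y.+1 by exists (trunc_log 2 b).
have := bitlen_lt a; have := bitlen_lt b; rewrite Ex Ey addSn bitlenP.
have -> : (x + y.+1).+1 = x.+1 + y.+1 by [].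
rewrite expnD; have := expn_gt0 2 x; have := expn_gt0 2 y; rewrite /= !expnS.
move: (2 ^ x) (2 ^ y) => s t; nia.
Qed.

Lemma bitlenM a b : bitlen (a * b) <= bitlen a + bitlen b.
Proof.
have [x Ex] : exists x, bitlen a = x.+1 by exists (trunc_log 2 a).
have := bitlen_lt a; have := bitlen_lt b; rewrite {2}Ex addSn bitlenP.
have -> : (x + bitlen b).+1 = bitlen a + bitlen b by rewrite Ex.
by rewrite expnD => hb ha; apply: ltn_mul.
Qed.

Lemma bitlen_arith o a b : bitlen (arith_sem o a b) <= bitlen a + bitlen b.
Proof.
case: o => /=; [exact: bitlenD| |exact: bitlenM| | |].
- by apply: leq_trans (leq_addr _ _); apply: bitlen_le2; lia.
- by apply: leq_trans (leq_addr _ _); apply: bitlen_le2; apply: leq_div.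
- by apply: leq_trans (leq_addr _ _); apply: bitlen_le2; apply: leq_mod.
have /leq_trans : bitlen (a <= b) <= 1 by case: (a <= b).
by apply; rewrite /bitlen; lia.
Qed.

Lemma PT_op o (f g : pt X -> nat) :
  PT Atom f -> PT Atom g -> PT Atom (fun e => arith_sem o (f e) (g e)).
Proof.
move=> pf pg; apply: (PT2 (mk := Op o) _ _ pf pg).
  apply: (pbnd_le (g := fun e => bitlen (f e) + bitlen (g e))) => [e _|].
    exact: bitlen_arith.
  by apply: pbndD; [exact: PT_size pf|exact: PT_size pg].
move=> p en e t1 t2 c1 c2 de ev1 ev2; eexists; last exact: EvOp ev1 ev2.
by rewrite /=; lia.
Qed.

Definition eP A B (ea : A -> data) (eb : B -> data) (ab : A * B) : data :=
  Node (ea ab.1) (eb ab.2).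

Lemma PT_pair A B (ea : A -> data) (eb : B -> data) (f : pt X -> A) (g : pt X -> B) :
  PT ea f -> PT eb g -> PT (eP ea eb) (fun e => (f e, g e)).
Proof.
move=> pf pg; apply: (PT2 (mk := Defs.Cons) _ _ pf pg).
  by rewrite /=; apply: pbndS; apply: pbndD; [exact: PT_size pf|exact: PT_size pg].
move=> p en e t1 t2 c1 c2 de ev1 ev2; eexists; last exact: EvCons ev1 ev2.
by rewrite /=; lia.
Qed.

Lemma PT_cons A (ea : A -> data) (f : pt X -> A) (g : pt X -> seq A) :
  PT ea f -> PT (enc_seq ea) g -> PT (enc_seq ea) (fun e => f e :: g e).
Proof. by move=> pf pg; apply: PT_ext (PT_pair pf pg). Qed.

Lemma PT_nil A (ea : A -> data) : PT (enc_seq ea) (fun _ : pt X => [::]).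
Proof. exact: PT_ext (PT_cst 0). Qed.

Lemma PT_fst A B (ea : A -> data) (eb : B -> data) (f : pt X -> A * B) :
  PT (eP ea eb) f -> PT ea (fun e => (f e).1).
Proof.
move=> pf; apply: (PT1 (mk := Fst) _ _ pf).
  by apply: pbnd_le (PT_size pf) => e _ /=; lia.
move=> p en e t c de ev; eexists; last exact: EvFst ev.
by rewrite /=; lia.
Qed.

Lemma PT_snd A B (ea : A -> data) (eb : B -> data) (f : pt X -> A * B) :
  PT (eP ea eb) f -> PT eb (fun e => (f e).2).
Proof.
move=> pf; apply: (PT1 (mk := Snd) _ _ pf).
  by apply: pbnd_le (PT_size pf) => e _ /=; lia.
move=> p en e t c de ev; eexists; last exact: EvSnd ev.
by rewrite /=; lia.
Qed.

Definition eB (b : bool) : data := Atom b.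

Lemma PT_nonnil A (ea : A -> data) (f : pt X -> seq A) :
  PT (enc_seq ea) f -> PT eB (fun e => ~~ nilp (f e)).
Proof.
move=> pf; apply: (PT1 (mk := IsNode) _ _ pf).
  by apply: pbnd_le (@pbnd_const X 1) => e _; case: (_ != _).
move=> p en e t c de ev; exists c.+1; first lia.
by have := EvIsNode ev; case: (f e).
Qed.

Lemma PT_if A (ea : A -> data) (b : pt X -> bool) (f g : pt X -> A) :
  PT eB b -> PT ea f -> PT ea g -> PT ea (fun e => if b e then f e else g e).
Proof.
move=> [sb Hb] [sf Hf] [sg Hg]; split.
  by apply: pbnd_le (pbndD sf sg) => e _; case: (b e); lia.
move=> k; have [fs0 [t0 [b0 [bb0 Ht0]]]] := Hb k.
have [fs1 [t1 [b1 [bb1 Ht1]]]] := Hf (k + size fs0).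
have [fs2 [t2 [b2 [bb2 Ht2]]]] := Hg (k + size fs0 + size fs1).
exists (fs0 ++ fs1 ++ fs2), (If t0 t1 t2), (fun e => (b0 e + (b1 e + b2 e)).+1); split.
  by apply: pbndS; apply: pbndD => //; apply: pbndD.
move=> p /has_at_cat[h0 /has_at_cat[h1 h2]] e rest de.
have [c0 lc0 ev0] := Ht0 p h0 e rest de.
have [c1 lc1 ev1] := Ht1 p h1 e rest de.
have [c2 lc2 ev2] := Ht2 p h2 e rest de.
exists (c0 + (if b e then c1 else c2)).+1; first by case: (b e); lia.
by apply: EvIf ev0 _; case: (b e).
Qed.

Lemma PT_weak B (P : pt X -> B -> Prop) (eb : B -> data) A (ea : A -> data) (f : pt X -> A) :
  PT ea f -> @PT (ext P eb) A ea (fun e => f e.1).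
Proof.
case=> sf Hf; split; first exact: (pbnd_ext P eb sf).
move=> k; have [fs [t [b [bb Ht]]]] := Hf k; exists fs, t, (fun e => b e.1); split.
  exact: (pbnd_ext P eb bb).
move=> p hp e rest [de _]; have [c lc ev] := Ht p hp e.1 (eb e.2 :: rest) de.
by exists c => //; rewrite /= cat_rcons.
Qed.

Lemma PT_var B (P : pt X -> B -> Prop) (eb : B -> data) :
  @pbnd (ext P eb) (fun e => data_size (eb e.2)) ->
  @PT (ext P eb) B eb (fun e => e.2).
Proof.
move=> sb; split=> // k; exists [::], (Var (nvars X)), (fun _ => 1); split.
  exact: pbnd_const.
move=> p _ e rest [de _]; exists 1 => //.
have -> : eb e.2 = nth (Atom 0) (env (e : pt (ext P eb)) ++ rest) (nvars X).
  by rewrite /= cat_rcons nth_cat env_size // ltnn subnn.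
exact: EvVar.
Qed.

End Rules.

(** * Loops as recursive functions *)

Definition packd (ws : seq data) : data := foldr Node (Atom 0) ws.

Fixpoint pack_term i n : term :=
  if n is n'.+1 then Defs.Cons (Var i) (pack_term i.+1 n') else Cst 0.

Lemma evals_pack p pre ws rest :
  evals p (pre ++ ws ++ rest) (pack_term (size pre) (size ws)) (packd ws) (2 * size ws).+1.
Proof.
elim: ws pre => [|w ws IH] pre; first exact: EvCst.
have -> : (2 * size (w :: ws)).+1 = (1 + (2 * size ws).+1).+1 by rewrite /=; lia.
apply: EvCons.
  have {2}-> : w = nth (Atom 0) (pre ++ (w :: ws) ++ rest) (size pre).
    by rewrite nth_cat ltnn subnn.
  exact: EvVar.
by have := IH (rcons pre w); rewrite size_rcons cat_rcons.
Qed.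

Lemma evals_proj p e t ws m c : m <= size ws ->
  evals p e t (packd ws) c -> evals p e (iter m Snd t) (packd (drop m ws)) (m + c).
Proof.
elim: m => [|m IH] lm ev; first by rewrite drop0.
have := IH (ltnW lm) ev; rewrite (drop_nth (Atom 0) lm) => ev'.
by apply: EvSnd ev'.
Qed.

(** The variables are bound from the last to the first, so that they end up in order at the front.
    The argument has index [(n - m).+1] once [n - m] of them, and the state, lie before it. *)
Fixpoint unpack n m (t : term) : term :=
  if m is m'.+1 then
    Let (Fst (iter m' Snd (Snd (Var (n - m).+1)))) (unpack n m' t)
  else t.

Lemma evals_unpack p ws st t w c m :
  let v := Node st (packd ws) in m <= size ws ->
  evals p (ws ++ [:: st; v]) t w c ->
  exists2 c', c' <= c + m * (m + 4) &
    evals p (drop m ws ++ [:: st; v]) (unpack (size ws) m t) w c'.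
Proof.
move=> v; elim: m => [|m IH] lm ev; first by exists c; rewrite ?drop0 //; lia.
have [c' lc' ev'] := IH (ltnW lm) ev.
rewrite (drop_nth (Atom 0) lm) in ev'.
have ev0 : evals p (drop m.+1 ws ++ [:: st; v]) (Snd (Var (size ws - m.+1).+1)) (packd ws) 2.
  apply: (@EvSnd _ _ _ st).
  have -> : Node st (packd ws) =
     nth (Atom 0) (drop m.+1 ws ++ [:: st; v]) (size ws - m.+1).+1.
    by rewrite nth_cat size_drop ltnNge leqnSn /= subSnn.
  exact: EvVar.
have := evals_proj (ltnW lm) ev0; rewrite (drop_nth (Atom 0) lm) => /EvFst ev1.
by eexists; last exact: EvLet ev1 ev'; nia.
Qed.

Section While.
Variables (X : ctx) (B : Type) (enc : B -> data) (P : pt X -> B -> Prop).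
Variables (init : pt X -> B) (tst : pt X -> B -> bool) (stp : pt X -> B -> B).
Variable K : pt X -> nat.

Let Y := ext P enc.
Let Z := ext (fun e b => P e b /\ tst e b) enc.

Hypothesis sz_st : @pbnd Y (fun e => data_size (enc e.2)).
Hypothesis K_bnd : pbnd K.
Hypothesis PT_init : PT enc init.
Hypothesis PT_tst : @PT Y B enc (fun e => e.2) -> @PT Y bool eB (fun e => tst e.1 e.2).
Hypothesis PT_stp : @PT Z B enc (fun e => e.2) -> @PT Z B enc (fun e => stp e.1 e.2).
Hypothesis P_init : forall e : pt X, dom e -> P e (init e).
Hypothesis P_stp : forall (e : pt X) b, dom e -> P e b -> tst e b -> P e (stp e b).
Hypothesis K_stop : forall e : pt X, dom e -> ~~ tst e (iter (K e) (stp e) (init e)).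
Hypothesis K_run : forall (e : pt X) i, dom e -> i < K e -> tst e (iter i (stp e) (init e)).

Lemma while_inv (e : pt X) i : dom e -> i <= K e -> P e (iter i (stp e) (init e)).
Proof.
move=> de; elim: i => [|i IH] li; first exact: P_init.
by rewrite iterS; apply: P_stp => //; [apply: IH; apply: ltnW|apply: K_run].
Qed.

(* The loop becomes a recursive function on a pair made of the state and of the
   packed variables of the context. *)
Lemma PT_while : PT enc (fun e => iter (K e) (stp e) (init e)).
Proof.
have [aS HS] := sz_st.
split.
  by exists aS => e de; apply: (HS (e, _)); split=> //; apply: while_inv.
have [_ Ht] : @PT Y bool eB (fun e => tst e.1 e.2) by apply/PT_tst/PT_var.
have [_ Hs] : @PT Z B enc (fun e => stp e.1 e.2).
  by apply/PT_stp/PT_var; exists aS => e [de [Pe _]]; apply: HS.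
have [_ Hi] := PT_init.
move=> k; have [fs0 [t0 [b0 [bb0 Ht0]]]] := Hi k.+1.
have [fs1 [t1 [b1 [[a1 Hb1] Ht1]]]] := Ht (k.+1 + size fs0).
have [fs2 [t2 [b2 [[a2 Hb2] Ht2]]]] := Hs (k.+1 + size fs0 + size fs1).
set n := nvars X.
(* After unpacking, the variables of the context occupy the first [n] places, the state is number
   [n] and the argument number [n.+1]; the recursive call passes the packed variables on
   unchanged. *)
pose f := Let (Fst (Var 0)) (unpack n n
  (If t1 (Call k (Defs.Cons t2 (Snd (Var n.+1)))) (Var n))).
pose B1 (e : pt X) := (msz e + a1) ^ a1; pose B2 (e : pt X) := (msz e + a2) ^ a2.
pose L (e : pt X) := B1 e + B2 e + (n * (n + 4) + 20).
exists (f :: (fs0 ++ fs1 ++ fs2)), (Call k (Defs.Cons t0 (pack_term 0 n))).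
exists (fun e => b0 e + 2 * n + 5 + (K e).+1 * L e); split.
  apply: pbndD; first by do 2?apply: pbndD => //; apply: pbnd_const.
  apply: pbndM; first exact: pbndS.
  apply: (@pbndD _ (fun e => B1 e + B2 e)); last exact: pbnd_const.
  by apply: pbndD; apply: pbnd_exp.
move=> p Hp e rest de.
have bk : body p k = f by have := Hp 0 isT; rewrite addn0.
have {Hp} [hp0 [hp1 hp2]] : has_at p k.+1 fs0 /\ has_at p (k.+1 + size fs0) fs1 /\
   has_at p (k.+1 + size fs0 + size fs1) fs2.
  have : has_at p k.+1 (fs0 ++ fs1 ++ fs2).
    by move=> i li; have := Hp i.+1 li; rewrite addnS addSn.
  by move=> /has_at_cat[? /has_at_cat].
have szn : size (env e) = n := env_size de.
have outer st w c : let v := Node (enc st) (packd (env e)) in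
    evals p (env e ++ [:: enc st; v])
      (If t1 (Call k (Defs.Cons t2 (Snd (Var n.+1)))) (Var n)) w c ->
    exists2 c', c' <= c + (n * (n + 4) + 3) & evals p [:: v] (body p k) w c'.
  move=> v ev; have := @evals_unpack p (env e) (enc st) _ w c n; rewrite szn.
  move=> /(_ _ (leqnn _) ev) [c' lc']; rewrite -{1}szn drop_size /= => ev'.
  exists ((1.+1 + c').+1); first lia.
  rewrite bk; apply: EvLet ev'; apply: EvFst.
  exact: (@EvVar _ [:: v] 0).
have vn st v : nth (Atom 0) (env e ++ [:: enc st; v]) n = enc st.
  by rewrite nth_cat szn ltnn subnn.
have vn1 st v : nth (Atom 0) (env e ++ [:: enc st; v]) n.+1 = v.
  by rewrite nth_cat szn ltnNge leqnSn /= subSnn.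
have stop st : P e st -> ~~ tst e st -> exists2 c, c <= L e &
    evals p [:: Node (enc st) (packd (env e))] (body p k) (enc st) c.
  move=> Pst Tst; set v := Node _ _.
  have [c lc] := Ht1 p hp1 (e, st) [:: v] (conj de Pst).
  rewrite /= cat_rcons (negbTE Tst) => ev.
  have ev2 : evals p (env e ++ [:: enc st; v]) (Var n) (enc st) 1.
    by rewrite -{2}(vn st v); apply: EvVar.
  have [|c' lc' ev'] := @outer st (enc st) (c + 1).+1; first exact: EvIf ev _.
  exists c' => //; have := Hb1 (e, st) (conj de Pst); rewrite /= -/(B1 e) /L; lia.
have go st w c : P e st -> tst e st ->
    evals p [:: Node (enc (stp e st)) (packd (env e))] (body p k) w c ->
    exists2 c', c' <= c + L e &
    evals p [:: Node (enc st) (packd (env e))] (body p k) w c'.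
  move=> Pst Tst ev; set v := Node _ _.
  have [c1 lc1] := Ht1 p hp1 (e, st) [:: v] (conj de Pst).
  rewrite /= cat_rcons Tst => ev1.
  have [c2 lc2] := Ht2 p hp2 (e, st) [:: v] (conj de (conj Pst Tst)).
  rewrite /= cat_rcons => ev2.
  have ev3 : evals p (env e ++ [:: enc st; v]) (Snd (Var n.+1)) (packd (env e)) 2.
    by apply: (@EvSnd _ _ _ (enc st)); rewrite -/v -{2}(vn1 st v); apply: EvVar.
  have ev4 := EvCall (EvCons ev2 ev3) ev.
  have [|c' lc' ev'] := @outer st w (c1 + ((c2 + 2).+1 + c).+1).+1; first exact: EvIf ev1 _.
  exists c' => //; have := Hb1 (e, st) (conj de Pst).
  have := Hb2 (e, st) (conj de (conj Pst Tst)); rewrite /= -/(B1 e) -/(B2 e) /L; lia.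
have loop j i : K e = i + j -> exists2 c, c <= j.+1 * L e &
   evals p [:: Node (enc (iter i (stp e) (init e))) (packd (env e))] (body p k)
     (enc (iter (K e) (stp e) (init e))) c.
  elim: j i => [|j IH] i Ki.
    have [||c lc ev] := stop (iter (K e) (stp e) (init e)).
    - exact: while_inv.
    - exact: K_stop.
    by exists c; [rewrite mul1n|move: ev; rewrite {1}Ki addn0].
  have [|c lc ev] := IH i.+1; first by rewrite Ki; lia.
  have li : i < K e by rewrite Ki; lia.
  have [c' lc' ev'] := go _ _ c (while_inv de (ltnW li)) (K_run de li) ev.
  by exists c' => //; rewrite mulSn; lia.
have [c0 lc0 ev0] := Ht0 p hp0 e rest de.
have := @evals_pack p [::] (env e) rest; rewrite /= szn => evp.
have [c1 lc1 ev1] := loop (K e) 0 erefl.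
eexists; last exact: EvCall (EvCons ev0 evp) ev1.
by rewrite /=; lia.
Qed.
End While.

(** * Arithmetic and folds over lists *)

Notation eN := Atom.
Notation eL := enc_seq.

Lemma size_enc_seq A (ea : A -> data) s :
  data_size (eL ea s) = (\sum_(a <- s) (data_size (ea a)).+1).+1.
Proof. by elim: s => [|a s IH] /=; rewrite ?big_nil ?big_cons //= IH; lia. Qed.

Lemma size_enc_cat A (ea : A -> data) s t :
  (data_size (eL ea (s ++ t))).+1 = data_size (eL ea s) + data_size (eL ea t).
Proof. by rewrite !size_enc_seq big_cat /=; lia. Qed.

Lemma size_enc_rev A (ea : A -> data) s : data_size (eL ea (rev s)) = data_size (eL ea s).
Proof.
rewrite !size_enc_seq; congr _.+1; elim: s => // a s IH.
by rewrite rev_cons -cats1 big_cat big_cons big_nil big_cons /= IH; lia.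
Qed.

Lemma leq_size_enc A (ea : A -> data) s : size s <= data_size (eL ea s).
Proof. by elim: s => //= a s IH; lia. Qed.

Lemma size_enc_le A (ea : A -> data) s b :
  (forall s1 a s2, s = s1 ++ a :: s2 -> data_size (ea a) <= b) ->
  data_size (eL ea s) <= size s * b.+1 + 1.
Proof.
elim: s => //= a s IH H; have /= := H [::] a s erefl.
have := IH (fun s1 x s2 E => H (a :: s1) x s2 (congr1 (cons a) E)); nia.
Qed.

Section Arith.
Variable X : ctx.
Implicit Types f g : pt X -> nat.
Implicit Types a b : pt X -> bool.

Lemma PT_add f g : PT eN f -> PT eN g -> PT eN (fun e => f e + g e).
Proof. exact: (PT_op Add). Qed.
Lemma PT_sub f g : PT eN f -> PT eN g -> PT eN (fun e => f e - g e).
Proof. exact: (PT_op Defs.Sub). Qed.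
Lemma PT_mul f g : PT eN f -> PT eN g -> PT eN (fun e => f e * g e).
Proof. exact: (PT_op Mul). Qed.
Lemma PT_div f g : PT eN f -> PT eN g -> PT eN (fun e => f e %/ g e).
Proof. exact: (PT_op Div). Qed.
Lemma PT_leq f g : PT eN f -> PT eN g -> PT eB (fun e => f e <= g e).
Proof. by move=> pf pg; apply: PT_ext (PT_op Leq pf pg). Qed.
Lemma PT_bool (x : bool) : PT eB (fun _ : pt X => x).
Proof. exact: PT_ext (PT_cst X x). Qed.
Lemma PT_and a b : PT eB a -> PT eB b -> PT eB (fun e => a e && b e).
Proof.
move=> pa pb; apply: PT_ext (PT_if pa pb (PT_bool false)) => e _.
by case: (a e).
Qed.
Lemma PT_or a b : PT eB a -> PT eB b -> PT eB (fun e => a e || b e).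
Proof.
move=> pa pb; apply: PT_ext (PT_if pa (PT_bool true) pb) => e _.
by case: (a e).
Qed.
Lemma PT_not a : PT eB a -> PT eB (fun e => ~~ a e).
Proof.
move=> pa; apply: PT_ext (PT_if pa (PT_bool false) (PT_bool true)) => e _.
by case: (a e).
Qed.
Lemma PT_eqn f g : PT eN f -> PT eN g -> PT eB (fun e => f e == g e).
Proof.
move=> pf pg; apply: PT_ext (PT_and (PT_leq pf pg) (PT_leq pg pf)) => e _.
by rewrite eqn_leq.
Qed.
Lemma PT_minn f g : PT eN f -> PT eN g -> PT eN (fun e => minn (f e) (g e)).
Proof.
move=> pf pg; apply: PT_ext (PT_if (PT_leq pf pg) pf pg) => e _.
by rewrite /minn; congr Atom; case: ltngtP => // ->.
Qed.

Lemma PT_head_in A (ea : A -> data) (a0 : A) (s : pt X -> seq A) :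
  (forall e : pt X, dom e -> ~~ nilp (s e)) ->
  PT (eL ea) s -> PT ea (fun e => head a0 (s e)).
Proof.
move=> ne ps; apply: (PT1 (mk := Fst) _ _ ps).
  apply: pbnd_le (PT_size ps) => e /ne; case: (s e) => //= x t _; lia.
move=> p en e t c /ne; case: (s e) => //= x u _ ev; eexists; last exact: EvFst ev.
by rewrite /=; lia.
Qed.

Lemma PT_behead_in A (ea : A -> data) (s : pt X -> seq A) :
  (forall e : pt X, dom e -> ~~ nilp (s e)) ->
  PT (eL ea) s -> PT (eL ea) (fun e => behead (s e)).
Proof.
move=> ne ps; apply: (PT1 (mk := Snd) _ _ ps).
  apply: pbnd_le (PT_size ps) => e /ne; case: (s e) => //= x t _; lia.
move=> p en e t c /ne; case: (s e) => //= x u _ ev; eexists; last exact: EvSnd ev.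
by rewrite /=; lia.
Qed.
End Arith.

(* Z refines X by additional variables: what is computable from a point of X
   remains so. *)
Definition weakens (X Z : ctx) (p : pt Z -> pt X) : Prop :=
  forall C (ec : C -> data) g, PT ec g -> PT ec (fun z => g (p z)).

Section Foldl.
Variables (X : ctx) (A B : Type) (ea : A -> data) (eb : B -> data) (a0 : A).
Variables (l : pt X -> seq A) (init : pt X -> B) (f : pt X -> B -> A -> B).
Variable bd : pt X -> nat.
Hypothesis bd_bnd : pbnd bd.
Hypothesis bdP : forall (e : pt X) s1 s2, dom e -> l e = s1 ++ s2 ->
  data_size (eb (foldl (f e) (init e) s1)) <= bd e.
Hypothesis PT_l : PT (eL ea) l.
Hypothesis PT_init : PT eb init.
Hypothesis PT_f : forall (Z : ctx) (p : pt Z -> pt X) (b : pt Z -> B) (a : pt Z -> A),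
  weakens p ->
  (forall z : pt Z, dom z -> dom (p z) /\ exists s1 s2,
     l (p z) = s1 ++ a z :: s2 /\ b z = foldl (f (p z)) (init (p z)) s1) ->
  PT eb b -> PT ea a -> PT eb (fun z => f (p z) (b z) (a z)).

(** Iterating a polynomial step can produce exponential sizes, hence the separate bound [bd] on all
    intermediate values. The loop state is the accumulator with the unread part of the list; its
    invariant tells the step which prefix has been consumed. *)
Lemma PT_foldl : PT eb (fun e => foldl (f e) (init e) (l e)).
Proof.
pose enc := eP eb (eL ea).
pose P (e : pt X) (bs : B * seq A) :=
  exists s1, l e = s1 ++ bs.2 /\ bs.1 = foldl (f e) (init e) s1.
pose tst (e : pt X) (bs : B * seq A) := ~~ nilp bs.2.
pose stp (e : pt X) (bs : B * seq A) := (f e bs.1 (head a0 bs.2), behead bs.2).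
have iterE e i : i <= size (l e) -> iter i (stp e) (init e, l e) =
    (foldl (f e) (init e) (take i (l e)), drop i (l e)).
  elim: i => [|i IH] li; first by rewrite take0 drop0.
  rewrite iterS IH 1?ltnW // /stp /=; congr pair.
    by rewrite (take_nth a0 li) -cats1 foldl_cat /= -nth0 nth_drop addn0.
  by rewrite -drop1 drop_drop.
suff H : PT enc (fun e => iter (size (l e)) (stp e) (init e, l e)).
  apply: PT_ext (PT_fst H) => e de.
  by rewrite iterE // take_size.
have szl : pbnd (fun e => data_size (eL ea (l e))) := PT_size PT_l.
apply: (@PT_while X _ enc P _ tst stp).
- apply: (@pbnd_le (ext P enc) (fun z => bd z.1 + (data_size (eL ea (l z.1))).+1)) => [[e [b s]]|].
    move=> [de [s1 /= [El ->]]]; have := bdP de El.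
    have := size_enc_cat ea s1 s; rewrite -El.
    have := data_size_gt0 (eL ea s1); rewrite /=; lia.
  exact: (pbnd_ext P enc (pbndD bd_bnd (pbndS szl))).
- by apply: (pbnd_le _ szl) => e _; exact: leq_size_enc.
- exact: PT_pair.
- by move=> pv; apply: PT_nonnil (PT_snd pv).
- move=> pv; have p1 := PT_fst pv; have p2 := PT_snd pv.
  have ne : forall z : pt (ext (fun e b => P e b /\ tst e b) enc), dom z -> ~~ nilp z.2.2.
    by move=> z [_ []].
  apply: PT_pair; last exact: PT_behead_in.
  apply: (PT_f (Z := ext (fun e b => P e b /\ tst e b) enc) (p := fst)
    (b := fun z => z.2.1) (a := fun z => head a0 z.2.2)) => //.
  + by move=> C ec g pg; apply: PT_weak.
  + move=> [e [b [|a s]]] [/= de [[s1 [El Eb]] //]] _; split=> //.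
    by exists s1, s.
  exact: PT_head_in.
- by move=> e _; exists [::].
- move=> e [b [|a s]] de [s1 /= [El ->]] // _; exists (rcons s1 a).
  by rewrite /= cat_rcons -cats1 foldl_cat.
- by move=> e de; rewrite iterE // /tst /= drop_size.
by move=> e i de li; rewrite iterE 1?ltnW // /tst /nilp /= size_drop subn_eq0 -ltnNge.
Qed.
End Foldl.

Definition occurs A (a : A) (s : seq A) := exists s1 s2, s = s1 ++ a :: s2.

Lemma occursP (A : eqType) (a : A) s : occurs a s <-> a \in s.
Proof.
split=> [[s1 [s2 ->]]|]; first by rewrite mem_cat mem_head orbT.
by move=> /splitPr[s1 s2]; exists s1, s2.
Qed.

Lemma foldl_cons A (s t : seq A) : foldl (fun b a => a :: b) t s = rev s ++ t.
Proof. by elim: s t => //= a s IH t; rewrite IH rev_cons cat_rcons. Qed.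

Section Lists.
Variable X : ctx.

Lemma PT_rev A (ea : A -> data) (a0 : A) (l : pt X -> seq A) :
  PT (eL ea) l -> PT (eL ea) (fun e => rev (l e)).
Proof.
move=> pl; apply: PT_ext (PT_foldl a0 (f := fun _ b a => a :: b)
  (init := fun _ => [::]) (eb := eL ea) (PT_size pl) _ pl (PT_nil X ea) _).
- by move=> e _; rewrite foldl_cons cats0.
- move=> e s1 s2 de ->; rewrite foldl_cons cats0.
  by rewrite size_enc_rev !size_enc_seq big_cat /=; lia.
by move=> Z p b a wk dz pb pa; apply: PT_cons.
Qed.

Lemma PT_cat A (ea : A -> data) (a0 : A) (l m : pt X -> seq A) :
  PT (eL ea) l -> PT (eL ea) m -> PT (eL ea) (fun e => l e ++ m e).
Proof.
move=> pl pm; apply: PT_ext (PT_foldl a0 (f := fun _ b a => a :: b)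
  (init := m) (eb := eL ea) (pbndD (PT_size pl) (PT_size pm)) _ (PT_rev a0 pl) pm _).
- by move=> e _; rewrite foldl_cons revK.
- move=> e s1 s2 de /= E; rewrite foldl_cons.
  have := size_enc_cat ea (rev s1) (m e).
  have := size_enc_cat ea (rev s2) (rev s1); rewrite -rev_cat -E revK.
  have := data_size_gt0 (eL ea (rev s2)); lia.
by move=> Z p b a wk dz pb pa; apply: PT_cons.
Qed.

Lemma PT_foldr A B (ea : A -> data) (eb : B -> data) (a0 : A)
   (l : pt X -> seq A) (init : pt X -> B) (f : pt X -> A -> B -> B) (bd : pt X -> nat) :
  pbnd bd ->
  (forall (e : pt X) s1 s2, dom e -> l e = s1 ++ s2 ->
     data_size (eb (foldr (f e) (init e) s2)) <= bd e) ->
  PT (eL ea) l -> PT eb init ->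
  (forall (Z : ctx) (p : pt Z -> pt X) (b : pt Z -> B) (a : pt Z -> A),
  weakens p ->
  (forall z : pt Z, dom z -> dom (p z) /\ exists s1 s2,
     l (p z) = s1 ++ a z :: s2 /\ b z = foldr (f (p z)) (init (p z)) s2) ->
  PT eb b -> PT ea a -> PT eb (fun z => f (p z) (a z) (b z))) ->
  PT eb (fun e => foldr (f e) (init e) (l e)).
Proof.
move=> bb bP pl pi pf.
apply: PT_ext (PT_foldl a0 (f := fun e b a => f e a b)
  (init := init) (eb := eb) bb _ (PT_rev a0 pl) pi _).
- by move=> e _; rewrite foldl_rev.
- move=> e s1 s2 de /= E; rewrite -[s1]revK foldl_rev; apply: bP (rev s2) _ _ _ => //.
  by rewrite -rev_cat -E revK.
move=> Z p b a wk dz pb pa; apply: pf => // z /dz[dp [s1 [s2 [E1 E2]]]]; split=> //.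
exists (rev s2), (rev s1); split.
  by rewrite -cat_rcons -rev_cons -rev_cat -E1 revK.
by rewrite E2 -[s1 in LHS]revK foldl_rev.
Qed.

Lemma PT_map A B (ea : A -> data) (eb : B -> data) (a0 : A)
   (l : pt X -> seq A) (f : pt X -> A -> B) :
  PT (eL ea) l ->
  (forall (Z : ctx) (p : pt Z -> pt X) (a : pt Z -> A),
    weakens p -> (forall z : pt Z, dom z -> dom (p z) /\ occurs (a z) (l (p z))) ->
    PT ea a -> PT eb (fun z => f (p z) (a z))) ->
  PT (eL eb) (fun e => map (f e) (l e)).
Proof.
move=> pl pf; pose Z := ext (fun e a => occurs a (l e)) ea.
have wkZ : @weakens X Z fst by move=> C ec g; apply: PT_weak.
have szl := PT_size pl.
(* Instantiating the hypothesis at the context extended by one element of the list bounds the sizes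
   of all images uniformly. *)
have [|sz _] := pf Z fst snd wkZ (fun z dz => dz).
  apply: PT_var; apply: pbnd_le (pbnd_ext _ _ szl) => -[e a] [_ /= [s1 [s2 ->]]].
  by rewrite size_enc_seq big_cat big_cons /=; lia.
case: sz => c Hc.
pose bd e := data_size (eL ea (l e)) * ((msz e + c) ^ c).+1 + 1.
apply: PT_ext (PT_foldr a0 (f := fun e a s => f e a :: s)
  (init := fun _ => [::]) (eb := eL eb) (bd := bd) _ _ pl (PT_nil X eb) _).
- by move=> e _; congr (eL eb _); elim: (l e) => //= a s ->.
- apply: pbndD; last exact: pbnd_const.
  by apply: pbndM => //; apply/pbndS/pbnd_exp.
- move=> e s1 s2 de E.
  have -> : foldr (fun a s => f e a :: s) [::] s2 = map (f e) s2 by elim: s2 {E} => //= a s ->.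
  apply: leq_trans (size_enc_le (b := (msz e + c) ^ c) _) _.
    move=> t1 b t2 Es; have : exists a t, occurs a s2 /\ b = f e a /\ t = t2.
      elim: s2 t1 Es {E} => [|a s2 IH] [|x t1] //= [].
        by move=> <- _; exists a, t2; split=> //; exists [::], s2.
      move=> _ /IH[y [t [[u1 [u2 ->]] [-> _]]]]; exists y, t2; split=> //.
      by exists (a :: u1), u2.
    case=> a [t [[u1 [u2 Eu]] [-> _]]]; apply: (Hc (e, a)); split=> //=.
    by exists (s1 ++ u1), u2; rewrite E Eu catA.
  rewrite /bd leq_add2r leq_mul2r size_map; apply/orP; right.
  apply: leq_trans (leq_size_enc ea _).
  by rewrite E size_cat leq_addl.
move=> W p b a wk dz pb pa; apply: PT_cons => //; apply: pf => // z /dz[dp [s1 [s2 [E _]]]].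
by split=> //; exists s1, s2.
Qed.
End Lists.

Lemma size_enc_occurs A (ea : A -> data) a s :
  occurs a s -> data_size (ea a) < data_size (eL ea s).
Proof. by case=> s1 [s2 ->]; rewrite !size_enc_seq big_cat big_cons /=; lia. Qed.

Lemma size_enc_suffix A (ea : A -> data) (s1 s2 : seq A) :
  data_size (eL ea s2) <= data_size (eL ea (s1 ++ s2)).
Proof.
have := size_enc_cat ea s1 s2; have := data_size_gt0 (eL ea s1); lia.
Qed.

Section ListSearch.
Variable X : ctx.

Lemma PT_filter A (ea : A -> data) (a0 : A) (l : pt X -> seq A) (q : pt X -> A -> bool) :
  PT (eL ea) l ->
  (forall (Z : ctx) (p : pt Z -> pt X) (a : pt Z -> A),
    weakens p -> (forall z : pt Z, dom z -> dom (p z) /\ occurs (a z) (l (p z))) ->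
    PT ea a -> PT eB (fun z => q (p z) (a z))) ->
  PT (eL ea) (fun e => filter (q e) (l e)).
Proof.
move=> pl pq.
apply: PT_ext (PT_foldr a0 (f := fun e a s => if q e a then a :: s else s)
  (init := fun _ => [::]) (eb := eL ea) (PT_size pl) _ pl (PT_nil X ea) _).
- by move=> e _; congr (eL ea _); elim: (l e) => //= a s ->.
- move=> e s1 s2 de ->; apply: leq_trans (size_enc_suffix ea s1 s2).
  by elim: s2 => //= a s IH; case: (q e a) => //=; lia.
move=> Z p b a wk dz pb pa; apply: PT_if => //; last exact: PT_cons.
by apply: pq => // z /dz[dp [s1 [s2 [E _]]]]; split=> //; exists s1, s2.
Qed.

Lemma PT_flatten A (ea : A -> data) (a0 : A) (l : pt X -> seq (seq A)) :
  PT (eL (eL ea)) l -> PT (eL ea) (fun e => flatten (l e)).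
Proof.
move=> pl; apply: (PT_foldr [::] (f := fun _ => cat) (PT_size pl) _ pl (PT_nil X ea)).
  move=> e s1 s2 de ->; apply: leq_trans (size_enc_suffix (eL ea) s1 s2).
  elim: s2 => //= s l' IH; have := size_enc_cat ea s (flatten l'); rewrite /flatten; lia.
by move=> Z p b a wk dz pb pa; apply: PT_cat.
Qed.

Lemma eB_size b : data_size (eB b) <= 1.
Proof. by case: b. Qed.

Lemma PT_has A (ea : A -> data) (a0 : A) (l : pt X -> seq A) (q : pt X -> A -> bool) :
  PT (eL ea) l ->
  (forall (Z : ctx) (p : pt Z -> pt X) (a : pt Z -> A),
    weakens p -> (forall z : pt Z, dom z -> dom (p z) /\ occurs (a z) (l (p z))) ->
    PT ea a -> PT eB (fun z => q (p z) (a z))) ->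
  PT eB (fun e => has (q e) (l e)).
Proof.
move=> pl pq.
apply: PT_ext (PT_foldr a0 (f := fun e a b => q e a || b)
  (init := fun _ => false) (eb := eB) (pbnd_const X 1) _ pl (PT_bool X false) _).
- by move=> e _; congr eB; elim: (l e) => //= a s ->.
- by move=> e s1 s2 _ _; apply: eB_size.
move=> Z p b a wk dz pb pa; apply: PT_or => //.
by apply: pq => // z /dz[dp [s1 [s2 [E _]]]]; split=> //; exists s1, s2.
Qed.

Lemma PT_mem (l : pt X -> seq nat) (x : pt X -> nat) :
  PT (eL eN) l -> PT eN x -> PT eB (fun e => x e \in l e).
Proof.
move=> pl px; apply: PT_ext (PT_has 0 (q := fun e a => a == x e) pl _) => [e _|].
  by rewrite has_pred1.
by move=> Z p a wk dz pa; apply: PT_eqn => //; exact: wk px.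
Qed.

Lemma bitlen_size_le k (l : nat) : k <= l -> data_size (eN k) <= l.+1.
Proof. by move=> h; apply: leq_trans (bitlen_leq k) _. Qed.

Lemma PT_length A (ea : A -> data) (a0 : A) (l : pt X -> seq A) :
  PT (eL ea) l -> PT eN (fun e => size (l e)).
Proof.
move=> pl; apply: PT_ext (PT_foldr a0 (f := fun _ _ k => k + 1) (init := fun _ => 0)
  (eb := eN) (pbndS (PT_size pl)) _ pl (PT_cst X 0) _).
- by move=> e _; congr Atom; elim: (l e) => //= a s ->; rewrite addn1.
- move=> e s1 s2 de ->; apply: bitlen_size_le.
  have -> : foldr (fun _ k => k + 1) 0 s2 = size s2 by elim: s2 => //= a s ->; rewrite addn1.
  by apply: leq_trans (leq_size_enc ea _) (size_enc_suffix ea s1 s2).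
by move=> Z p b a wk dz pb pa; apply: PT_add => //; apply: PT_cst.
Qed.

(** The fold runs along the list with a position counter rather than down from [i], whose value may
    be exponential in the input size. *)
Lemma PT_nth A (ea : A -> data) (l : pt X -> seq A) (a0 : A) (i : pt X -> nat) :
  PT (eL ea) l -> PT ea (fun _ : pt X => a0) -> PT eN i ->
  PT ea (fun e => nth a0 (l e) (i e)).
Proof.
move=> pl p0 pi.
have nthE (s : seq A) j k : foldl (fun (kr : nat * A) a => (kr.1 + 1, if kr.1 == j then a else kr.2))
    (k, a0) s = (k + size s, if k <= j then nth a0 s (j - k) else a0).
  elim/last_ind: s => [|s a IH]; first by rewrite addn0 nth_nil if_same.
  rewrite -cats1 foldl_cat IH /= size_cat nth_cat /= !addn1 addnS; congr pair.
  case: eqP => [<-|ne]; first by rewrite leq_addr addKn ltnn subnn.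
  case: leqP => // kj; case: ltnP => // h; rewrite [RHS]nth_default ?nth_default //.
  by rewrite /=; lia.
have nthE0 s j : foldl (fun (kr : nat * A) a => (kr.1 + 1, if kr.1 == j then a else kr.2))
    (0, a0) s = (size s, nth a0 s j).
  by rewrite nthE leq0n subn0 add0n.
pose f (e : pt X) (kr : nat * A) a := (kr.1 + 1, if kr.1 == i e then a else kr.2).
apply: PT_ext (PT_snd (PT_foldl a0 (f := f) (init := fun _ => (0, a0)) (eb := eP eN ea)
  (pbndD (pbndD (pbndS (PT_size pl)) (PT_size pl)) (pbndS (PT_size p0))) _ pl
  (PT_pair (PT_cst X 0) p0) _)).
- by move=> e _; rewrite /f nthE0.
- move=> e s1 s2 de E; rewrite /f nthE0 /=.
  have h1 : data_size (eN (size s1)) <= (data_size (eL ea (l e))).+1.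
    apply: bitlen_size_le; apply: leq_trans (leq_size_enc ea _).
    by rewrite E size_cat leq_addr.
  have h2 : data_size (ea (nth a0 s1 (i e))) <=
     data_size (eL ea (l e)) + data_size (ea a0).
    case: (ltnP (i e) (size s1)) => h; last by rewrite nth_default // leq_addl.
    apply: leq_trans (leq_addr _ _); apply/ltnW/size_enc_occurs.
    exists (take (i e) s1), (drop (i e).+1 s1 ++ s2).
    by rewrite -cat_cons -(drop_nth a0 h) catA cat_take_drop.
  by rewrite /= in h1 *; lia.
move=> Z p b a wk dz pb pa; apply: PT_pair.
  by apply: PT_add (PT_fst pb) (PT_cst _ _).
apply: PT_if => //; last exact: PT_snd pb.
by apply: PT_eqn (PT_fst pb) (wk _ _ _ pi).
Qed.

End ListSearch.

Section MoreLists.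
Variable X : ctx.

Lemma PT_iota A (ea : A -> data) (a0 : A) (l : pt X -> seq A) :
  PT (eL ea) l -> PT (eL eN) (fun e => iota 0 (size (l e))).
Proof.
move=> pl.
have E (s : seq A) : foldl (fun (kr : seq nat) (a : A) => size kr :: kr) [::] s =
    rev (iota 0 (size s)).
  elim/last_ind: s => // s a IH; rewrite -cats1 foldl_cat IH /= size_rev size_iota.
  by rewrite size_cat addn1 -addn1 iotaD rev_cat.
apply: PT_ext (PT_rev 0 (PT_foldl a0 (f := fun _ kr _ => size kr :: kr)
  (init := fun _ => [::]) (eb := eL eN)
  (pbndD (pbndM (PT_size pl) (pbndS (pbndS (PT_size pl)))) (pbnd_const X 1)) _ pl (PT_nil X eN) _)).
- by move=> e _; rewrite E revK.
- move=> e s1 s2 de El; rewrite E size_enc_rev.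
  have h : size s1 <= data_size (eL ea (l e)).
    by apply: leq_trans (leq_size_enc ea _); rewrite El size_cat leq_addr.
  apply: leq_trans (size_enc_le (b := (data_size (eL ea (l e))).+1) _) _.
    move=> t1 a t2 Es; have : a \in iota 0 (size s1) by rewrite Es mem_cat mem_head orbT.
    by rewrite mem_iota => la; apply: bitlen_size_le; lia.
  by rewrite size_iota leq_add2r leq_mul2r h orbT.
by move=> Z p b a wk dz pb pa; apply: PT_cons => //; exact: (PT_length 0 pb).
Qed.

Lemma PT_sumn (l : pt X -> seq nat) : PT (eL eN) l -> PT eN (fun e => sumn (l e)).
Proof.
move=> pl; apply: (PT_foldr 0 (f := fun _ => addn) (PT_size pl) _ pl (PT_cst X 0)).
  move=> e s1 s2 de ->; apply: leq_trans (size_enc_suffix eN s1 s2).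
  elim: s2 => //= a s IH; apply: leq_trans (bitlenD _ _) _; rewrite /= in IH; lia.
by move=> Z p b a wk dz pb pa; apply: PT_add.
Qed.

Lemma PT_head A (ea : A -> data) (a0 : A) (l : pt X -> seq A) :
  PT (eL ea) l -> PT ea (fun _ : pt X => a0) -> PT ea (fun e => head a0 (l e)).
Proof.
move=> pl p0; apply: PT_ext (PT_nth pl p0 (PT_cst X 0)) => e _.
by rewrite nth0.
Qed.

(** The number of rounds is the length of a list, that is, a unary number, and is therefore
    polynomial. *)
Lemma PT_iter B (eb : B -> data) A (ea : A -> data) (a0 : A) (l : pt X -> seq A)
   (init : pt X -> B) (f : pt X -> B -> B) (bd : pt X -> nat) :
  pbnd bd ->
  (forall (e : pt X) i, dom e -> i <= size (l e) ->
     data_size (eb (iter i (f e) (init e))) <= bd e) ->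
  PT (eL ea) l -> PT eb init ->
  (forall (Z : ctx) (p : pt Z -> pt X) (b : pt Z -> B),
    weakens p ->
    (forall z : pt Z, dom z -> dom (p z) /\ exists2 i, i < size (l (p z)) &
       b z = iter i (f (p z)) (init (p z))) ->
    PT eb b -> PT eb (fun z => f (p z) (b z))) ->
  PT eb (fun e => iter (size (l e)) (f e) (init e)).
Proof.
move=> bb bP pl pi pf.
have E e (s : seq A) : foldl (fun b (_ : A) => f e b) (init e) s = iter (size s) (f e) (init e).
  by elim/last_ind: s => // s a IH; rewrite -cats1 foldl_cat IH size_cat addn1.
apply: PT_ext (PT_foldl a0 (f := fun e b _ => f e b) (eb := eb) bb _ pl pi _).
- by move=> e _; rewrite E.
- by move=> e s1 s2 de El; rewrite E; apply: bP => //; rewrite El size_cat leq_addr.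
move=> Z p b a wk dz pb pa; apply: pf => // z /dz[dp [s1 [s2 [El Eb]]]]; split=> //.
by exists (size s1); rewrite ?El ?size_cat /= ?Eb ?E //; lia.
Qed.

End MoreLists.

Definition mget (cm : seq (seq nat)) u v := nth 0 (nth [::] cm u) v.

Section Matrices.
Variable X : ctx.

Lemma PT_mget cm u v : PT (eL (eL eN)) cm -> PT eN u -> PT eN v ->
  PT eN (fun e : pt X => mget (cm e) (u e) (v e)).
Proof.
move=> pc pu pv; apply: PT_nth => //; last exact: PT_cst.
by apply: PT_nth => //; apply: PT_nil.
Qed.

Definition tab (l : seq nat) (f : nat -> nat -> nat) : seq (seq nat) :=
  [seq [seq f u v | v <- l] | u <- l].

Lemma PT_tab (l : pt X -> seq nat) (f : pt X -> nat -> nat -> nat) :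
  PT (eL eN) l ->
  (forall (Z : ctx) (p : pt Z -> pt X) (u v : pt Z -> nat),
    weakens p -> (forall z : pt Z, dom z -> [/\ dom (p z), u z \in l (p z) & v z \in l (p z)]) ->
    PT eN u -> PT eN v -> PT eN (fun z => f (p z) (u z) (v z))) ->
  PT (eL (eL eN)) (fun e => tab (l e) (f e)).
Proof.
move=> pl pf; apply: (PT_map 0 pl) => Z p u wk dz pu.
apply: (PT_map 0 (wk _ _ _ pl)) => W q v wk2 dw pv.
apply: (pf W (fun w => p (q w)) (fun w => u (q w)) v) => //.
- by move=> C ec g /wk/wk2.
- by move=> w /dw[/dz[dp /occursP ?] /occursP ?].
exact: wk2 pu.
Qed.
End Matrices.

Lemma mget_tab n f u v : u < n -> v < n -> mget (tab (iota 0 n) f) u v = f u v.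
Proof.
move=> un vn; rewrite /mget /tab (nth_map 0) ?size_iota // (nth_map 0) ?size_iota //.
by rewrite !nth_iota.
Qed.

(** * Prize-collecting trees *)

Fixpoint wlen (c : nat -> nat -> nat) (u : nat) (s : seq nat) : nat :=
  if s is v :: s' then c u v + wlen c v s' else 0.

(* A partial tree is the list of its pairs (child, parent), latest first. *)
Definition tcost (c : nat -> nat -> nat) (T : seq (nat * nat)) : nat :=
  sumn [seq c e.2 e.1 | e <- T].

(* The remaining nodes, their unspent potentials and the current costs. *)
Definition state := (seq nat * (seq nat * seq (seq nat)))%type.
(* In (th, (v, u)) the duals grow by th, then v is removed: it has spent its
   potential if u = v, and otherwise the edge from u to v is tight. *)
Definition event := (nat * (nat * nat))%type.
Definition entry := (seq (seq nat) * (nat * nat))%type.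

(** The root 0 carries no dual: it can absorb a node but is never removed. *)
Definition events (st : state) : seq event :=
  [seq (nth 0 st.2.1 v, (v, v)) | v <- st.1] ++
  flatten [seq [seq (mget st.2.2 u v, (v, u)) | u <- [seq u <- 0 :: st.1 | u != v]]
          | v <- st.1].

Definition emin (es : seq event) : event :=
  foldl (fun b e => if e.1 < b.1 then e else b) (head (0, (0, 0)) es) es.

Definition shrink (lab : seq nat) (th : nat) (cm : seq (seq nat)) : seq (seq nat) :=
  tab lab (fun x w => mget cm x w - th).

(** This is splitting off at [v]: a detour through [v] becomes a single edge of the same cost. *)
Definition bypass (lab : seq nat) (v : nat) (cm : seq (seq nat)) : seq (seq nat) :=
  tab lab (fun x w => minn (mget cm x w) (mget cm x v + mget cm v w)).

(* When v is merged into u, it leaves u its unspent potential. *)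
Definition new_pot (lab : seq nat) (e : event) (pl : seq nat) : seq nat :=
  [seq nth 0 pl x - e.1 +
     (if (x == e.2.2) && (e.2.2 != e.2.1) then nth 0 pl e.2.1 - e.1 else 0) | x <- lab].

Definition advance (lab : seq nat) (st : state) : state :=
  let e := emin (events st) in
  ([seq x <- st.1 | x != e.2.1],
   (new_pot lab e st.2.1, bypass lab e.2.1 (shrink lab e.1 st.2.2))).

Definition entry_of (lab : seq nat) (st : state) : entry :=
  let e := emin (events st) in (shrink lab e.1 st.2.2, e.2).

(* Inverse of [bypass]: an edge whose reduced cost is that of a detour through v
   is replaced by the detour. *)
Definition reroute (c : nat -> nat -> nat) (v : nat) (wx : nat * nat) (acc : seq (nat * nat)) :=
  if c wx.2 wx.1 <= c wx.2 v + c v wx.1 then wx :: acc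
  else if v \in unzip1 acc then (wx.1, v) :: acc
  else (wx.1, v) :: (v, wx.2) :: acc.

(** Nothing is attached when [u = v], the event in which [v] has spent its potential, nor when
    rerouting has already brought [v] into the tree. *)
Definition attach (v u : nat) (T : seq (nat * nat)) : seq (nat * nat) :=
  if (u != v) && ((u == 0) || (u \in unzip1 T)) && (v \notin unzip1 T) then (v, u) :: T else T.

Definition lift_tree (en : entry) (T : seq (nat * nat)) : seq (nat * nat) :=
  attach en.2.1 en.2.2 (foldr (reroute (mget en.1) en.2.1) [::] T).

Fixpoint solve (lab : seq nat) (k : nat) (st : state) : seq (nat * nat) :=
  if k is k'.+1 then lift_tree (entry_of lab st) (solve lab k' (advance lab st)) else [::].

Fixpoint parents_ok (T : seq (nat * nat)) : bool :=
  if T is e :: T' then ((e.2 == 0) || (e.2 \in unzip1 T')) && parents_ok T' else true.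

Definition tree_on (A : seq nat) (T : seq (nat * nat)) : Prop :=
  [/\ uniq (unzip1 T), {subset unzip1 T <= A} & parents_ok T].

Lemma emin_mem es : es != [::] -> emin es \in es.
Proof.
case: es => // e es _; rewrite /emin /=.
suff H b (s : seq event) : foldl (fun b e => if e.1 < b.1 then e else b) b s \in b :: s.
  by have := H (if e.1 < e.1 then e else e) es; rewrite if_same.
elim: s b => [|a s IH] b /=; first by rewrite mem_head.
have := IH (if a.1 < b.1 then a else b); rewrite !inE.
by case: ifP => _ /orP[->|->]; rewrite ?orbT.
Qed.

Lemma emin_le es e : e \in es -> (emin es).1 <= e.1.
Proof.
rewrite /emin; move: (head _ _) => b.
suff H (s : seq event) b0 : let m := foldl (fun b e => if e.1 < b.1 then e else b) b0 s in
    m.1 <= b0.1 /\ (e \in s -> m.1 <= e.1) by case: (H es b).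
elim: s b0 => [|a s IH] b0 //=.
have [h1 h2] := IH (if a.1 < b0.1 then a else b0); split.
  by apply: leq_trans h1 _; case: ltnP => // /ltnW.
rewrite inE => /orP[/eqP->|/h2 //]; apply: leq_trans h1 _.
by case: ltnP.
Qed.

Section Step.
Variables (c c2 : nat -> nat -> nat) (v : nat).
Hypothesis c2E : forall x w, c2 x w = minn (c x w) (c x v + c v w).

Lemma reroute_only T a :
  a \in unzip1 (foldr (reroute c v) [::] T) -> a != v -> a \in unzip1 T.
Proof.
elim: T => //= -[b y] T IH; rewrite {1}/reroute /=; case: ifP => _ /=.
  by rewrite !inE => /orP[->//|/IH h /h ->]; rewrite orbT.
case: ifP => _ /=; rewrite !inE.
  by move=> /orP[->//|/IH h /h ->]; rewrite orbT.
by move=> /or3P[->//|->//|/IH h /h ->]; rewrite orbT.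
Qed.

(** The first detour brings in an edge to [v], and later ones reuse it, so [v] keeps a single parent
    and the cost can only drop. Parents stand further down the list, which is why the right fold
    meets them first. *)
Lemma reroute_wf A T : v \notin A -> tree_on A T ->
  let T2 := foldr (reroute c v) [::] T in
  [/\ tree_on (v :: A) T2, {subset unzip1 T <= unzip1 T2} & tcost c T2 <= tcost c2 T].
Proof.
move=> vA; elim: T => [|[w x] T IH] /=; first by case=> _ _ _; split.
case=> /=/andP[wT uT] sT /andP[px pT].
have [|[u2 s2 p2] sub2 co2] := IH.
  by split=> // a aT; apply: sT; rewrite inE aT orbT.
have wA : w \in A by apply: sT; rewrite mem_head.
have wv : w != v by apply: contraNneq vA => <-.
set T2 := foldr _ _ _ in u2 s2 p2 sub2 co2 *.
have only a := @reroute_only T a; rewrite -/T2 in only.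
have wT2 : w \notin unzip1 T2 by apply: contra wT => /only; apply.
have px2 : (x == 0) || (x \in unzip1 T2).
  by case/orP: px => [->//|/sub2 ->]; rewrite orbT.
rewrite /reroute /=; case: leqP => h.
  split; first split=> /=.
  - by rewrite wT2.
  - by move=> a; rewrite inE => /orP[/eqP->|/s2//]; rewrite inE wA orbT.
  - by rewrite px2.
  - by move=> a; rewrite !inE => /orP[->//|/sub2 ->]; rewrite orbT.
  by rewrite /tcost /= c2E (minn_idPl h) leq_add2l.
case: ifP => vT2.
  split; first split=> /=.
  - by rewrite wT2.
  - by move=> a; rewrite inE => /orP[/eqP->|/s2//]; rewrite inE wA orbT.
  - by rewrite vT2 orbT.
  - by move=> a; rewrite !inE => /orP[->//|/sub2 ->]; rewrite orbT.
  rewrite /tcost /= c2E (minn_idPr (ltnW h)); move: co2; rewrite /tcost; lia.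
split; first split=> /=.
- by rewrite inE negb_or wv wT2 vT2.
- by move=> a; rewrite !inE => /or3P[/eqP->|->//|/s2//]; rewrite wA orbT.
- by rewrite mem_head orbT px2.
- by move=> a; rewrite !inE => /orP[->//|/sub2 ->]; rewrite !orbT.
rewrite /tcost /= c2E (minn_idPr (ltnW h)); move: co2; rewrite /tcost; lia.
Qed.

Lemma attach_wf A u T : v \in A -> (u == 0) || (u \in A) -> tree_on A T ->
  (u != v -> c u v = 0) ->
  let T2 := attach v u T in
  [/\ tree_on A T2, {subset unzip1 T <= unzip1 T2}, tcost c T2 <= tcost c T &
      u != v -> (u == 0) || (u \in unzip1 T) -> v \in unzip1 T2].
Proof.
move=> vA uA [uT sT pT] cuv; rewrite /attach /=.
case: ifP => [/andP[/andP[uv h] vT]|H].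
  split; first split=> //=.
  - by rewrite vT.
  - by move=> a; rewrite inE => /orP[/eqP->|/sT].
  - by rewrite h.
  - by move=> a; rewrite inE => ->; rewrite orbT.
  - by rewrite /tcost /= cuv.
  by rewrite mem_head.
by split=> // uv h; move: H; rewrite uv h /= => /negbFE.
Qed.
End Step.

Definition pen (pi : nat -> nat) (A : seq nat) (T : seq (nat * nat)) : nat :=
  \sum_(w <- A | w \notin unzip1 T) pi w.

Lemma parents_in A T e : tree_on A T -> e \in T -> (e.1 \in A) && (e.2 \in 0 :: A).
Proof.
case=> _ sT pT eT; apply/andP; split; first by apply: sT; apply: map_f.
elim: T sT pT eT => // a T IH sT /= /andP[pa pT]; rewrite inE => /orP[/eqP->|eT].
  rewrite inE; case/orP: pa => [->//|h]; apply/orP; right.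
  by apply: sT; rewrite /= inE h orbT.
by apply: IH => // x xT; apply: sT; rewrite /= inE xT orbT.
Qed.

(** * One event: accounting of the duals for the tree and for the walks *)

Section OneStep.
Variables (A : seq nat) (c c1 c2 : nat -> nat -> nat) (pi pi2 : nat -> nat) (th v u : nat).
Let A2 := [seq x <- A | x != v].
Hypothesis uA : uniq A.
Hypothesis A0 : 0 \notin A.
Hypothesis vA : v \in A.
Hypothesis uA0 : u \in 0 :: A.
Hypothesis c1E : forall x w, x \in 0 :: A -> w \in 0 :: A -> c1 x w = c x w - th.
Hypothesis c2E : forall x w, c2 x w = minn (c1 x w) (c1 x v + c1 v w).
Hypothesis pi2E : forall x, x \in A ->
  pi2 x = pi x - th + (if (x == u) && (u != v) then pi v - th else 0).
Hypothesis th_pi : forall w, w \in A -> th <= pi w.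
Hypothesis th_c : forall x w, x \in 0 :: A -> w \in A -> x != w -> th <= c x w.
Hypothesis ev_v : u = v -> pi v = th.
Hypothesis ev_u : u != v -> c u v = th.
Hypothesis ev_u' : u != v -> c v u = th.

Lemma permA : perm_eq A (v :: A2).
Proof.
apply: uniq_perm => //; first by rewrite /= mem_filter eqxx /= filter_uniq.
by move=> x; rewrite inE mem_filter; case: eqVneq => [->|].
Qed.

Lemma sub_A2 : {subset A2 <= A}.
Proof. by move=> x; rewrite mem_filter => /andP[]. Qed.

(** Each node of [A] pays [th] at most once: for the edge to its parent if it is in the tree, out of
    its potential otherwise. If [v] was to be merged into [u] and is missed, then [u] is missed as
    well, and the potential that [v] left to [u] pays the rest of its penalty. *)
Lemma step_upper T' : tree_on A2 T' ->
  let T := attach v u (foldr (reroute c1 v) [::] T') in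
  tree_on A T /\
  tcost c T + pen pi A T <= tcost c2 T' + pen pi2 A2 T' + th * size A.
Proof.
move=> tT'; have vA2 : v \notin A2 by rewrite mem_filter eqxx.
have [tT2 sub2 co2] := reroute_wf c2E vA2 tT'.
set T2 := foldr _ _ _ in tT2 sub2 co2 *.
have {}tT2 : tree_on A T2.
  case: tT2 => h1 h2 h3; split=> // a /h2; rewrite inE => /orP[/eqP->//|].
  exact: sub_A2.
have c1uv : u != v -> c1 u v = 0.
  by move=> uv; rewrite c1E ?inE ?vA ?orbT // ev_u // subnn.
have uA' : (u == 0) || (u \in A) by move: uA0; rewrite inE.
have [tT sub co vT] := attach_wf vA uA' tT2 c1uv.
set T := attach _ _ _ in tT sub co vT *; split=> //.
have sT' : {subset unzip1 T' <= unzip1 T} by move=> a /sub2/sub.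
have H1 : tcost c T <= tcost c1 T + th * size T.
  rewrite /tcost; have : {subset T <= T} by [].
  elim: {1 3 4 5}T => //= e S IH sS.
  have /(parents_in tT)/andP[e1 e2] := sS _ (mem_head _ _).
  have := IH (fun x xS => sS x (mem_behead (s := e :: S) xS)).
  rewrite (c1E e2) ?inE ?e1 ?orbT // mulnS.
  move: (sumn [seq c e.2 e.1 | e <- S]) (sumn _) (th * size S) (c _ _) => a b d k; lia.
have H2 : pen pi A T <= pen (fun w => pi w - th) A T + th * count (fun w => w \notin unzip1 T) A.
  rewrite /pen -sum1_count big_distrr /= -big_split /=.
  rewrite big_seq_cond [X in _ <= X]big_seq_cond; apply: leq_sum => w /andP[wA _]; lia.
have H3 : size T + count (fun w => w \notin unzip1 T) A <= size A.
  rewrite -[size A](count_predC (mem (unzip1 T))) leq_add2r -(size_map fst T).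
  case: tT => h1 h2 h3; rewrite -size_filter; apply: uniq_leq_size => // x xT.
  by rewrite mem_filter /= xT /=; apply: h2.
suff H4 : pen (fun w => pi w - th) A T <= pen pi2 A2 T'.
  have : th * (size T + count (fun w => w \notin unzip1 T) A) <= th * size A by rewrite leq_mul2l H3 orbT.
  rewrite mulnDr; lia.
rewrite /pen (perm_big _ permA) big_cons /=.
have E : \sum_(w <- A2 | w \notin unzip1 T') pi2 w =
   \sum_(w <- A2 | w \notin unzip1 T') (pi w - th) +
   \sum_(w <- A2 | w \notin unzip1 T') (if (w == u) && (u != v) then pi v - th else 0).
  rewrite -big_split /= big_seq_cond [RHS]big_seq_cond; apply: eq_bigr => w /andP[wA _].
  by rewrite pi2E //; apply: sub_A2.
rewrite E.
have L : \sum_(w <- A2 | w \notin unzip1 T) (pi w - th) <=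
    \sum_(w <- A2 | w \notin unzip1 T') (pi w - th).
  rewrite big_mkcond [X in _ <= X]big_mkcond; apply: leq_sum => w _.
  case: (boolP (w \notin unzip1 T)) => // h; rewrite ifT //.
  by apply: contra h => /sT'.
case: ifP => vnT; last by apply: leq_trans L (leq_addr _ _).
rewrite addnC; apply: leq_add => //.
case: (eqVneq u v) => [/ev_v->|uv]; first by rewrite subnn.
have unT : u != 0 /\ u \notin unzip1 T2.
  by split; apply: contraNN vnT => h; apply: vT => //; rewrite h ?orbT.
have uA2 : u \in A2 by rewrite mem_filter uv; move: uA'; rewrite (negbTE unT.1).
rewrite (big_rem u) //= ifT; first by rewrite eqxx leq_addr.
by apply: contra unT.2 => /sub2.
Qed.

Local Open Scope ring_scope.
Variable F : realFieldType.

(** Every node of [A] on the walk, except its start, is entered by an edge from a different node.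
    These edges are distinct and cost at least [th], so that truncated subtraction takes the full
    [th] from each. *)
Lemma wlen_shrink x s : x \in 0%N :: A -> {subset s <= 0%N :: A} ->
  (wlen c1 x s + th * count (fun w => (w \in s) && (w != x)) A <= wlen c x s)%N.
Proof.
elim: s x => [|w s IH] x xA sA /=.
  by rewrite (eq_count (a2 := pred0)) // count_pred0 muln0.
have wA : w \in 0%N :: A by apply: sA; rewrite mem_head.
have := IH w wA (fun y ys => sA y (mem_behead (s := w :: s) ys)).
set n1 := count _ _; set n2 := count _ _ => H.
have n12 : (n2 <= ((w != x) && (w \in A)) + n1)%N.
  case: (eqVneq w x) => [E|wx] /=.
    rewrite add0n; apply: sub_count => y /=; rewrite inE E => /andP[/orP[/eqP->|->//]].
    by rewrite eqxx.
  rewrite -(count_uniq_mem _ uA) -count_predUI; apply: leq_trans (leq_addr _ _).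
  apply: sub_count => y /=; rewrite inE => /andP[/orP[/eqP->|->] _]; rewrite ?eqxx //.
  by case: (eqVneq y w).
apply: leq_trans (_ : c1 x w + ((w != x) && (w \in A)) * th + (wlen c1 w s + th * n1) <= _)%N.
  have : (th * n2 <= th * ((w != x) && (w \in A)) + th * n1)%N.
    by rewrite -mulnDr leq_mul2l n12 orbT.
  by rewrite [(_ * th)%N]mulnC; lia.
apply: leq_add => //; rewrite c1E //; case: andP => [[wx wA']|_]; last by lia.
by have := th_c xA wA'; rewrite eq_sym wx => /(_ isT); lia.
Qed.

Lemma wlen_filter x s : x != v -> x \in 0%N :: A -> {subset s <= 0%N :: A} ->
  (wlen c2 x [seq w <- s | w != v] <= wlen c1 x s)%N.
Proof.
(* The second bound is for a walk that has moved from [x] to [v] while its image still stands at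
   [x]; it covers the middle of a detour, including repeated visits to [v]. *)
suff H : {subset s <= 0%N :: A} ->
    (x \in 0%N :: A -> x != v -> (wlen c2 x [seq w <- s | w != v] <= wlen c1 x s)%N) /\
    (x \in 0%N :: A -> (wlen c2 x [seq w <- s | w != v] <= c1 x v + wlen c1 v s)%N).
  by move=> xv xA /H[h _]; apply: h.
elim: s x => [|w s IH] x sA //=.
have wA : w \in 0%N :: A by apply: sA; rewrite mem_head.
have [h1 h2] := IH w (fun y ys => sA y (mem_behead (s := w :: s) ys)).
have [h3 h4] := IH x (fun y ys => sA y (mem_behead (s := w :: s) ys)).
case: (eqVneq w v) => [E|wv] /=; split=> [xA xv|xA].
- by rewrite E; apply: h4.
- by rewrite E; apply: leq_trans (h4 xA) _; rewrite leq_add2l leq_addl.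
- by rewrite c2E leq_add ?geq_minl // h1.
by rewrite c2E addnA leq_add ?geq_minr // h1.
Qed.

(** Both directed edges between [u] and [v] have reduced cost 0, so moving all visits from [v] to
    [u] turns paths through [v] into bypasses at no cost. *)
Lemma wlen_subst x s : u != v ->
  let f w := if w == v then u else w in x \in 0%N :: A -> {subset s <= 0%N :: A} ->
  (wlen c2 (f x) (map f s) <= wlen c1 x s)%N.
Proof.
move=> uv f; have vA0 : v \in 0%N :: A by rewrite inE vA orbT.
have cuv : c1 u v = 0%N by rewrite c1E // ev_u // subnn.
have cvu : c1 v u = 0%N by rewrite c1E // ev_u' // subnn.
elim: s x => [|w s IH] x //= xA sA.
have wA : w \in 0%N :: A by apply: sA; rewrite mem_head.
apply: leq_add; last by apply: IH => // y ys; apply: sA; rewrite inE ys orbT.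
rewrite /f c2E; case: (eqVneq x v) => [->|xv]; case: (eqVneq w v) => [->|wv].
- by rewrite cuv cvu; lia.
- by rewrite cuv; lia.
- by rewrite cvu; lia.
by lia.
Qed.

Section Lower.
Variables (K : finType) (z : K -> F) (W : K -> seq nat) (y : nat -> F).
Hypothesis z0 : forall k, 0 <= z k.
Hypothesis WA : forall k, {subset W k <= 0%N :: A}.
Hypothesis y1 : forall w, w \in A -> y w <= 1.
Hypothesis yz : forall w, w \in A -> y w <= \sum_(k | w \in W k) z k.

(** For each [w] in [A], the walks entering [w] save at least [th * y w] and the penalty saves
    [th * (1 - y w)]: together at least [th], whatever [y w] is. *)
Lemma lower_shrink :
  (th * size A)%:R + \sum_k z k * (wlen c1 0 (W k))%:R
    + \sum_(w <- A) (pi w - th)%:R * (1 - y w) <=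
  \sum_k z k * (wlen c 0 (W k))%:R + \sum_(w <- A) (pi w)%:R * (1 - y w).
Proof.
have -> : \sum_(w <- A) (pi w)%:R * (1 - y w) =
    \sum_(w <- A) (pi w - th)%:R * (1 - y w) + th%:R * ((size A)%:R - \sum_(w <- A) y w).
  rewrite mulrBr mulr_sumr -sum1_size natr_sum mulr_sumr -sumrB -big_split /=.
  rewrite !big_seq; apply: eq_bigr => w wA; rewrite natrB ?th_pi //; ring.
have H : th%:R * \sum_(w <- A) y w + \sum_k z k * (wlen c1 0 (W k))%:R <=
    \sum_k z k * (wlen c 0 (W k))%:R.
  apply: (@le_trans _ _ (\sum_k z k * (wlen c1 0 (W k) + th * count (fun w => (w \in W k) && (w != 0%N)) A)%:R)).
    have -> : \sum_k z k * (wlen c1 0 (W k) + th * count (fun w => (w \in W k) && (w != 0%N)) A)%:R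
      = th%:R * \sum_k z k * (count (fun w => (w \in W k) && (w != 0%N)) A)%:R +
        \sum_k z k * (wlen c1 0 (W k))%:R.
      by rewrite mulr_sumr -big_split; apply: eq_bigr => k _; rewrite natrD natrM mulrDr mulrCA addrC.
    rewrite lerD2r ler_wpM2l //.
    apply: (@le_trans _ _ (\sum_(w <- A) \sum_(k | w \in W k) z k)).
      by rewrite !big_seq; apply: ler_sum => w wA; apply: yz.
    under eq_bigr do rewrite big_mkcond /=.
    rewrite exchange_big /=; apply: ler_sum => k _.
    rewrite -sum1_count natr_sum mulr_sumr [X in _ <= X]big_mkcond /= big_seq [X in _ <= X]big_seq.
    apply: ler_sum => w wA; rewrite (_ : w != 0%N) ?andbT; last by apply: contraNneq A0 => <-.
    by case: ifP => // _; rewrite mulr1.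
  apply: ler_sum => k _; apply: ler_wpM2l => //.
  by rewrite ler_nat; apply: wlen_shrink => //; rewrite mem_head.
rewrite natrM; move: H; rewrite mulrBr; lra.
Qed.

(* The walks skip v when it has spent its potential, and visit u instead of v
   when v is merged into u. *)
Lemma lower_step : exists (W' : K -> seq nat) (y' : nat -> F),
  [/\ forall k, {subset W' k <= 0%N :: A2},
      forall w, w \in A2 -> y' w <= 1,
      forall w, w \in A2 -> y' w <= \sum_(k | w \in W' k) z k &
   (th * size A)%:R + \sum_k z k * (wlen c2 0 (W' k))%:R
    + \sum_(w <- A2) (pi2 w)%:R * (1 - y' w) <=
  \sum_k z k * (wlen c 0 (W k))%:R + \sum_(w <- A) (pi w)%:R * (1 - y w)].
Proof.
have v0 : (0 != v)%N by apply: contraNneq A0 => ->.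
have sumA (g : nat -> F) : \sum_(w <- A) g w = g v + \sum_(w <- A2) g w.
  by rewrite (perm_big _ permA) big_cons.
case: (eqVneq u v) => uv.
  exists (fun k => [seq w <- W k | w != v]), y; split.
  - move=> k w; rewrite mem_filter => /andP[wv /WA]; rewrite !inE mem_filter wv.
    by case/orP=> ->; rewrite ?orbT.
  - by move=> w /sub_A2/y1.
  - move=> w wA2; apply: le_trans (yz (sub_A2 wA2)) _.
    have wv : w != v by move: wA2; rewrite mem_filter => /andP[].
    by under [X in _ <= X]eq_bigl do rewrite mem_filter wv.
  apply: le_trans lower_shrink; rewrite [X in _ <= _ + X]sumA ev_v // subnn mul0r add0r.
  apply: lerD; last first.
    rewrite le_eqVlt; apply/orP; left; apply/eqP; rewrite big_seq [RHS]big_seq.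
    by apply: eq_bigr => w /sub_A2 wA; rewrite pi2E // uv eqxx andbF addn0.
  rewrite lerD2l; apply: ler_sum => k _; apply: ler_wpM2l => //.
  by rewrite ler_nat; apply: wlen_filter => //; rewrite ?mem_head.
pose f w := if w == v then u else w.
(* Walks that visited [u] or [v] now visit [u], so the larger of the two fractions is covered. Hence
   [1 - y' u] is at most [1 - y u] and at most [1 - y v], the weights of the two potentials that [u]
   now holds. *)
pose y' w := if w == u then Num.max (y u) (y v) else y w.
have inW w k : w != v -> w \in W k -> w \in map f (W k).
  by move=> wv wW; apply/mapP; exists w; rewrite // /f (negbTE wv).
have sum_sub (P Q : pred K) : (forall k, P k -> Q k) -> \sum_(k | P k) z k <= \sum_(k | Q k) z k.
  move=> PQ; rewrite big_mkcond [X in _ <= X]big_mkcond; apply: ler_sum => k _.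
  by case: ifP => [/PQ->//|_]; case: ifP.
exists (fun k => map f (W k)), y'; split.
- move=> k w /mapP[x /WA xA ->]; rewrite /f; case: (eqVneq x v) => [_|xv].
    by move: uA0; rewrite !inE mem_filter uv.
  by move: xA; rewrite !inE mem_filter xv.
- move=> w wA2; rewrite /y'; case: eqP => [E|_]; last exact/y1/sub_A2.
  by rewrite ge_max !y1 // -E; apply: sub_A2.
- move=> w wA2; have wv : w != v by move: wA2; rewrite mem_filter => /andP[].
  rewrite /y'; case: eqP => [E|_]; last first.
    by apply: le_trans (yz (sub_A2 wA2)) _; apply: sum_sub => k; apply: inW.
  rewrite ge_max; apply/andP; split.
    by rewrite -E; apply: le_trans (yz (sub_A2 wA2)) _; apply: sum_sub => k; apply: inW.
  apply: le_trans (yz vA) _; apply: sum_sub => k vW; rewrite E.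
  by apply/mapP; exists v; rewrite // /f eqxx.
apply: le_trans lower_shrink; rewrite [X in _ <= _ + X]sumA.
apply: lerD.
  rewrite lerD2l; apply: ler_sum => k _; apply: ler_wpM2l => //.
  have := @wlen_subst 0 (W k) uv (mem_head _ _) (@WA k).
  by rewrite ler_nat /f (negbTE v0).
have pv : 0 <= (pi v - th)%:R * (1 - y v) by rewrite mulr_ge0 // subr_ge0 y1.
case: (boolP (u \in A2)) => [uA2|uA2]; last first.
  apply: (@le_trans _ _ (\sum_(w <- A2) (pi w - th)%:R * (1 - y w))); last by lra.
  rewrite le_eqVlt; apply/orP; left; apply/eqP; rewrite big_seq [RHS]big_seq.
  apply: eq_bigr => w wA2; have wu : w != u by apply: contraNneq uA2 => <-.
  by rewrite pi2E ?sub_A2 // /y' (negbTE wu) addn0.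
rewrite (big_rem u) //= [X in _ <= _ + X](big_rem u) //=.
have -> : \sum_(w <- rem u A2) (pi2 w)%:R * (1 - y' w) =
    \sum_(w <- rem u A2) (pi w - th)%:R * (1 - y w).
  rewrite big_seq [RHS]big_seq; apply: eq_bigr => w.
  rewrite mem_rem_uniq ?filter_uniq // => /andP[/= wu wA2].
  by rewrite pi2E ?sub_A2 // /y' (negbTE wu) addn0.
rewrite pi2E ?sub_A2 // eqxx uv /= /y' eqxx natrD addrA lerD2r mulrDl addrC.
by apply: lerD; apply: ler_wpM2l => //; rewrite lerD2l lerN2 le_max lexx ?orbT.
Qed.
End Lower.
End OneStep.

(** With the default 0 outside the table, equations between reduced costs hold for all labels,
    without range conditions. *)
Lemma mget_tabE n f u v :
  mget (tab (iota 0 n) f) u v = if (u < n) && (v < n) then f u v else 0.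
Proof.
case: ltnP => un; last by rewrite /mget (nth_default [::]) ?size_map ?size_iota // nth_nil.
case: ltnP => vn; first exact: mget_tab.
by rewrite /mget (nth_map 0) ?size_iota // nth_default // size_map size_iota.
Qed.

Section Solve.
Variable N : nat.
Let lab := iota 0 N.

Definition state_ok (st : state) : Prop :=
  [/\ uniq st.1, 0 \notin st.1, {subset 0 :: st.1 <= lab} &
      forall x w, mget st.2.2 x w = mget st.2.2 w x].

Lemma event_spec (st : state) : st.1 != [::] ->
  let e := emin (events st) in let v := e.2.1 in let u := e.2.2 in
  [/\ v \in st.1, u \in 0 :: st.1,
      (forall w, w \in st.1 -> e.1 <= nth 0 st.2.1 w),
      (forall x w, x \in 0 :: st.1 -> w \in st.1 -> x != w -> e.1 <= mget st.2.2 x w) &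
      (u = v -> nth 0 st.2.1 v = e.1) /\ (u != v -> mget st.2.2 u v = e.1)].
Proof.
case: st => A [pl cm] /= A0; set es := events _; set e := emin es.
have es0 : es != [::] by case: A A0 @es @e.
have := emin_mem es0; rewrite -/e {1}/es mem_cat => He.
have le1 w : w \in A -> e.1 <= nth 0 pl w.
  by move=> wA; apply: (@emin_le es (_, (w, w))); rewrite mem_cat map_f.
have le2 x w : x \in 0 :: A -> w \in A -> x != w -> e.1 <= mget cm x w.
  move=> xA wA xw; apply: (@emin_le es (_, (w, x))); rewrite mem_cat; apply/orP; right.
  apply/flattenP; eexists; first exact: (map_f _ wA).
  by apply: map_f; rewrite mem_filter xw.
case/orP: He => [/mapP[v vA E]|/flattenP[s /mapP[v vA ->] /mapP[u]]].
  rewrite E /= in le1 le2 *; split=> //; first by rewrite inE vA orbT.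
  by split=> //; rewrite eqxx.
rewrite mem_filter => /andP[uv uA] E; rewrite E /= in le1 le2 *.
by split=> //; split=> // E'; rewrite E' eqxx in uv.
Qed.

Lemma advance_ok (st : state) : st.1 != [::] -> state_ok st -> state_ok (advance lab st).
Proof.
move=> st0 [h1 h2 h3 h4]; split.
- by rewrite filter_uniq.
- by rewrite mem_filter negb_and h2 orbT.
- move=> x; rewrite inE mem_filter => /orP[/eqP->|/andP[_ xA]]; apply: h3.
    exact: mem_head.
  by rewrite inE xA orbT.
move=> x w; rewrite /= /bypass /shrink !mget_tabE; set v := (emin _).2.1.
case: (x < N); case: (w < N); case: (v < N) => //=.
by rewrite (h4 x w) (h4 x v) (h4 v w) [in LHS]addnC.
Qed.

Section Bound.
Variable F : realFieldType.
Local Open Scope ring_scope.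

(** Induction on events. Each event adds at most [th * size A] to the value of the tree and at least
    as much to that of the walks, so the two remain comparable without any multiplicative loss. *)
Theorem solve_bound k (st : state) : size st.1 = k -> state_ok st ->
  let T := solve lab k st in
  tree_on st.1 T /\
  forall (K : finType) (z : K -> F) (W : K -> seq nat) (y : nat -> F),
    (forall k, 0 <= z k) -> (forall k, {subset W k <= 0%N :: st.1}) ->
    (forall w, w \in st.1 -> y w <= 1) ->
    (forall w, w \in st.1 -> y w <= \sum_(k | w \in W k) z k) ->
    (tcost (mget st.2.2) T + pen (nth 0%N st.2.1) st.1 T)%:R <=
    \sum_k z k * (wlen (mget st.2.2) 0 (W k))%:R +
    \sum_(w <- st.1) (nth 0%N st.2.1 w)%:R * (1 - y w).
Proof.
elim: k st => [|k IH] st szA ok.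
  have A0 : st.1 = [::] by apply: size0nil.
  split=> [|K z W y z0 _ _ _]; first by rewrite A0.
  rewrite A0 big_nil addr0 /pen big_nil /tcost /=.
  by apply: sumr_ge0 => i _; rewrite mulr_ge0.
have A0 : st.1 != [::] by apply: contra_eqN szA => /eqP->.
have ok' := advance_ok A0 ok.
case: ok => uA A00 subA sym.
set A := st.1 in uA A00 subA.
have [vA uA0 th_pi th_c [ev_v ev_u]] := event_spec A0.
set e := emin _ in vA uA0 th_pi th_c ev_v ev_u.
set v := e.2.1 in vA ev_v ev_u; set u := e.2.2 in uA0 ev_v ev_u.
have szA' : size (advance lab st).1 = k.
  by have := perm_size (permA uA vA); rewrite szA /= => -[].
have [tT' lowT'] := IH _ szA' ok'.
have inN x : x \in 0%N :: A -> (x < N)%N by move=> /subA; rewrite mem_iota.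
pose c1 := mget (shrink lab e.1 st.2.2).
have c1E x w : x \in 0%N :: A -> w \in 0%N :: A -> c1 x w = (mget st.2.2 x w - e.1)%N.
  by move=> /inN xN /inN wN; rewrite /c1 mget_tabE xN wN.
have c2E x w : mget (advance lab st).2.2 x w = minn (c1 x w) (c1 x v + c1 v w).
  rewrite /= /bypass mget_tabE -/e -/v -/c1; case: ifP => // h.
  suff -> : c1 x w = 0%N by rewrite min0n.
  by rewrite /c1 /shrink mget_tabE h.
have pi2E x : x \in A -> nth 0%N (advance lab st).2.1 x =
   (nth 0 st.2.1 x - e.1 + (if (x == u) && (u != v) then nth 0 st.2.1 v - e.1 else 0))%N.
  move=> xA; have xN : (x < N)%N by apply: inN; rewrite inE xA orbT.
  by rewrite /= /new_pot (nth_map 0%N) ?size_iota // nth_iota.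
have ev_u' : u != v -> mget st.2.2 v u = e.1 by move=> /ev_u <-; rewrite sym.
have [tT upT] := step_upper uA A00 vA uA0 c1E c2E pi2E ev_v ev_u ev_u' tT'.
split=> // K z W y z0 WA y1 yz.
have [W' [y' [W'A y'1 y'z low]]] :=
  lower_step uA A00 vA uA0 c1E c2E pi2E th_pi th_c ev_v ev_u ev_u' z0 WA y1 yz.
apply: le_trans low.
apply: (@le_trans _ _ ((tcost (mget (advance lab st).2.2) (solve lab k (advance lab st)) +
  pen (nth 0%N (advance lab st).2.1) (advance lab st).1 (solve lab k (advance lab st)) + e.1 * size A)%:R)).
  by rewrite ler_nat.
rewrite natrD addrC -!addrA lerD2l; exact: lowT'.
Qed.
End Bound.
End Solve.

(** * From trees to tours *)

(** A new leaf [w] is put right after its parent [x]: by the triangle inequality this is a detour of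
    at most twice the edge, and no node gets repeated. *)
Definition ins (x w : nat) (tr : seq nat) : seq nat :=
  if x == 0 then w :: tr
  else foldr (fun a acc => if a == x then a :: w :: acc else a :: acc) [::] tr.

Definition tour_of (T : seq (nat * nat)) : seq nat := foldr (fun e tr => ins e.2 e.1 tr) [::] T.

Definition tour_len (c : nat -> nat -> nat) (s : seq nat) : nat := wlen c 0 (rcons s 0).

(** When no node satisfies [P], the value is the length of the whole walk, so that [lat] never
    exceeds [wlen]. *)
Fixpoint lat (c : nat -> nat -> nat) (u : nat) (s : seq nat) (P : pred nat) : nat :=
  if s is v :: s' then c u v + (if P v then 0 else lat c v s' P) else 0.

Fixpoint dedup (seen s : seq nat) : seq nat :=
  if s is v :: s' then if v \in seen then dedup seen s' else v :: dedup (v :: seen) s'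
  else [::].

Definition metric (c : nat -> nat -> nat) : Prop :=
  [/\ forall u, c u u = 0, forall u v, c u v = c v u &
      forall u v w, c u w <= c u v + c v w].

Lemma wlen_cat c u s t : wlen c u (s ++ t) = wlen c u s + wlen c (last u s) t.
Proof. by elim: s u => //= v s IH u; rewrite IH addnA. Qed.

Lemma insE x w s1 s2 : x != 0 -> x \notin s1 -> x \notin s2 ->
  ins x w (s1 ++ x :: s2) = s1 ++ x :: w :: s2.
Proof.
move=> x0 h1 h2; rewrite /ins (negbTE x0).
have skip s t : x \notin s ->
    foldr (fun a acc => if a == x then a :: w :: acc else a :: acc) t s = s ++ t.
  elim: s => //= a s IH; rewrite inE negb_or => /andP[ax /IH ->].
  by rewrite eq_sym (negbTE ax).
by rewrite foldr_cat skip //= eqxx skip // cats0.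
Qed.

Lemma ins_perm x w tr : (x == 0) || (x \in tr) -> uniq tr ->
  perm_eq (ins x w tr) (w :: tr).
Proof.
case: (eqVneq x 0) => [-> _ _|x0 /= xt]; first by rewrite /ins eqxx.
case/splitPr: xt => s1 s2; rewrite cat_uniq /= negb_or => /and3P[_ /andP[h1 _] /andP[h2 _]].
rewrite insE // perm_sym -[w :: _]cat1s -[x :: w :: s2]/([:: x; w] ++ s2).
rewrite perm_catCA perm_cat2l /= -[x :: w :: s2]/([:: x; w] ++ s2).
by rewrite -[w :: x :: s2]/([:: w; x] ++ s2) perm_cat2r; apply/permP => a /=; lia.
Qed.

Lemma dedup_mem seen s x : (x \in dedup seen s) = (x \in s) && (x \notin seen).
Proof.
elim: s seen => //= v s IH seen; case: ifP => [vs|/negbT vs]; rewrite ?inE IH.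
  by case: eqVneq => [->|//]; rewrite vs andbF.
by rewrite inE negb_or; case: eqVneq => [->|].
Qed.

Lemma dedup_uniq seen s : uniq (dedup seen s).
Proof.
elim: s seen => //= v s IH seen; case: ifP => // _; rewrite /= IH andbT.
by rewrite dedup_mem mem_head andbF.
Qed.

Lemma dedup_foldl s :
  dedup [::] s = rev (foldl (fun acc v => if v \in acc then acc else v :: acc) [::] s).
Proof.
suff H acc : rev (foldl (fun acc v => if v \in acc then acc else v :: acc) acc s) =
    rev acc ++ dedup acc s by rewrite H.
elim: s acc => [|v s IH] acc /=; first by rewrite cats0.
by rewrite IH; case: ifP => //= _; rewrite rev_cons cat_rcons.
Qed.

Section Metric.
Variable c : nat -> nat -> nat.
Hypothesis mc : metric c.

Lemma closed_ins x w tr : (x == 0) || (x \in tr) -> uniq tr ->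
  tour_len c (ins x w tr) <= tour_len c tr + 2 * c x w.
Proof.
case: mc => _ sym tri.
have key y s : wlen c y (w :: rcons s 0) <= wlen c y (rcons s 0) + 2 * c y w.
  case: s => [|a s] /=; first by have := tri w y 0; rewrite (sym w y); lia.
  by have := tri w y a; rewrite (sym w y); lia.
case: (eqVneq x 0) => [-> _ _|x0 /= xt].
  by rewrite /tour_len /ins eqxx rcons_cons; apply: key.
case/splitPr: xt => s1 s2; rewrite cat_uniq /= negb_or => /and3P[_ /andP[h1 _] /andP[h2 _]].
rewrite insE // /tour_len !rcons_cat !wlen_cat -addnA leq_add2l !rcons_cons.
by have /= := key x s2; lia.
Qed.

Lemma tour_of_spec A T : tree_on A T ->
  [/\ perm_eq (tour_of T) (unzip1 T) & tour_len c (tour_of T) <= 2 * tcost c T].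
Proof.
case=> uT _; elim: T uT => [|[w x] T IH] /=; first by case: mc => h _ _; rewrite /tour_len /= h.
case/andP=> wT uT /andP[px pT]; have [pe cl] := IH uT pT.
have px' : (x == 0) || (x \in tour_of T) by rewrite (perm_mem pe).
have ut : uniq (tour_of T) by rewrite (perm_uniq pe).
split; first by apply: perm_trans (ins_perm w px' ut) _; rewrite perm_cons.
by apply: leq_trans (closed_ins w px' ut) _; rewrite /tcost /= in cl *; lia.
Qed.

Lemma wlen_closed s : wlen c 0 s <= tour_len c s.
Proof. by rewrite /tour_len -cats1 wlen_cat leq_addr. Qed.

Lemma lat_le u s P : lat c u s P <= wlen c u s.
Proof. by elim: s u => //= v s IH u; case: ifP => _; rewrite leq_add2l. Qed.

Lemma lat_start x y s P : lat c x s P <= c x y + lat c y s P.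
Proof.
case: mc => _ _ tri; case: s => //= v s.
by rewrite addnA leq_add2r.
Qed.

(** What is found in [s] is charged the whole closed tour; otherwise the walk may be taken to return
    to the root before [t], which makes the cost of [t] independent of [s]. *)
Lemma lat_cat s t P :
  lat c 0 (s ++ t) P <= tour_len c s + (if has P s then 0 else lat c 0 t P).
Proof.
have catE u : lat c u (s ++ t) P =
    if has P s then lat c u s P else wlen c u s + lat c (last u s) t P.
  elim: s u => //= v s IH u; case: (P v) => //=; rewrite IH.
  by case: ifP => // _; rewrite addnA.
rewrite catE; case: ifP => _.
  by rewrite addn0; apply: leq_trans (lat_le _ _ _) (wlen_closed s).
rewrite /tour_len -cats1 wlen_cat /= addn0 -addnA leq_add2l.
exact: lat_start.
Qed.

Lemma lat_dedup s P : lat c 0 (dedup [::] s) P <= lat c 0 s P.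
Proof.
case: mc => c0 _ tri.
(* The shortened walk may still stand at [u] while the original one has reached [x], hence the extra
   term [c u x]. *)
suff H seen u x : (forall y, y \in seen -> ~~ P y) ->
    lat c u (dedup seen s) P <= c u x + lat c x s P.
  by have := H [::] 0 0; rewrite c0; apply.
elim: s seen u x => [|v s IH] seen u x Ps //=.
case: ifP => vs.
  rewrite (negbTE (Ps _ vs)); apply: leq_trans (IH _ _ v Ps) _.
  by rewrite addnA leq_add2r.
rewrite /=; case: ifP => Pv; first by rewrite !addn0.
rewrite addnA; apply: leq_add => //.
have := IH (v :: seen) v v; rewrite c0; apply=> y; rewrite inE => /orP[/eqP->|/Ps //].
by rewrite Pv.
Qed.
End Metric.

(** * Concatenation of tours *)

(* The cost of a tree, the number of nodes that it misses, and a tour around it. *)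
Definition cand := (nat * (nat * seq nat))%type.
(* A bound on the total latency and a concatenation of tours. *)
Definition plan := (nat * seq nat)%type.

(* All plans end with the tour [full], which misses no node. *)
Definition base (full a : cand) : plan := (2 * full.1 * a.2.1, full.2.2).

(** The next tour has length at most [2 * b.1] and delays at most the [a.2.1] nodes missed by the
    last tour. Earlier tours are forgotten, so the state of the dynamic program is one candidate. *)
Definition prepend (a b : cand) (p : plan) : plan :=
  (2 * b.1 * a.2.1 + p.1, b.2.2 ++ p.2).

Definition cheaper (p q : plan) : plan := if p.1 < q.1 then p else q.

Definition relax (full : cand) (S : seq (cand * plan)) (a : cand) : plan :=
  foldl (fun best eb => cheaper (prepend a eb.1 eb.2) best) (base full a) S.

Definition round (full : cand) (S : seq (cand * plan)) : seq (cand * plan) :=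
  [seq (e.1, relax full S e.1) | e <- S].

Definition plans (full : cand) (cs : seq cand) (k : nat) : seq (cand * plan) :=
  iter k (round full) [seq (a, base full a) | a <- cs].

Definition dp (full : cand) (cs : seq cand) (k : nat) (a : cand) : plan :=
  if k is k'.+1 then relax full (plans full cs k') a else base full a.

Lemma plansE full cs k : plans full cs k = [seq (a, dp full cs k a) | a <- cs].
Proof.
case: k => // k; rewrite /plans iterS -/(plans full cs k) /round.
have E : [seq e.1 | e <- plans full cs k] = cs.
  elim: k => [|k IH]; first by rewrite /plans /= -map_comp map_id.
  by rewrite /plans iterS -/(plans full cs k) /round -map_comp.
by rewrite -(congr1 (map (fun a => (a, dp full cs k.+1 a))) E) -map_comp.
Qed.

Lemma relax_le full S a :
  (relax full S a).1 <= (base full a).1 /\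
  forall e, e \in S -> (relax full S a).1 <= (prepend a e.1 e.2).1.
Proof.
rewrite /relax; elim: S (base full a) => [|x S IH] b //=.
have [h1 h2] := IH (cheaper (prepend a x.1 x.2) b).
have hb : (cheaper (prepend a x.1 x.2) b).1 <= b.1 by rewrite /cheaper; case: ifP => // /ltnW.
have hx : (cheaper (prepend a x.1 x.2) b).1 <= (prepend a x.1 x.2).1.
  by rewrite /cheaper; case: ltnP.
split; first exact: leq_trans h1 hb.
move=> e; rewrite inE => /orP[/eqP->|/h2//]; exact: leq_trans h1 hx.
Qed.

Lemma relax_ind full S a (Q : plan -> Prop) : Q (base full a) ->
  (forall e, e \in S -> Q (prepend a e.1 e.2)) -> Q (relax full S a).
Proof.
rewrite /relax; move: (base full a) => b.
elim: S b => //= x S IH b Qb Qe; apply: IH => [|e eS].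
  rewrite /cheaper; case: ifP => // _; apply: Qe; exact: mem_head.
by apply: Qe; rewrite inE eS orbT.
Qed.

Lemma dpS full cs k a b : b \in cs ->
  (dp full cs k.+1 a).1 <= 2 * b.1 * a.2.1 + (dp full cs k b).1.
Proof.
move=> bcs; have [_ h] := relax_le full (plans full cs k) a.
by apply: (h (b, dp full cs k b)); rewrite plansE; apply: map_f.
Qed.

Section DPsound.
Variables (c : nat -> nat -> nat) (n : nat).
Hypothesis mc : metric c.

Definition good_cand (a : cand) : Prop :=
  [/\ tour_len c a.2.2 <= 2 * a.1,
      count (fun j => j \notin a.2.2) (iota 1 n) <= a.2.1 &
      {subset a.2.2 <= iota 1 n}].

(** Only the number of remaining nodes is known to the plan, so its value has to bound the latencies
    of every set of that size. *)
Definition good_plan (a : cand) (p : plan) : Prop :=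
  [/\ {subset iota 1 n <= p.2}, {subset p.2 <= iota 1 n} &
      forall s, uniq s -> {subset s <= iota 1 n} -> size s <= a.2.1 ->
        \sum_(j <- s) lat c 0 p.2 (pred1 j) <= p.1].

Variables (full : cand) (cs : seq cand).
Hypothesis gfull : good_cand full.
Hypothesis full0 : full.2.1 = 0.
Hypothesis gcs : forall a, a \in cs -> good_cand a.

Lemma dp_sound k a : good_plan a (dp full cs k a).
Proof.
have gbase b : good_plan b (base full b).
  case: gfull => h1 h2 h3; rewrite /base; split=> //=.
    move=> j jn; rewrite full0 leqn0 in h2.
    by move: h2; rewrite -leqn0 leqNgt -has_count => /hasPn /(_ j jn) /negbNE.
  move=> s us sn sz; apply: (@leq_trans (\sum_(j <- s) 2 * full.1)).
    apply: leq_sum => j _; apply: leq_trans h1.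
    exact: leq_trans (lat_le _ _ _ _) (wlen_closed _ _).
  by rewrite big_const_seq count_predT iter_addn_0 leq_mul2l sz orbT.
elim: k a => [|k IH] a //; apply: relax_ind => // -[b p]; rewrite plansE.
case/mapP=> x xcs [-> ->]; have [h1 h2 h3] := gcs xcs.
have [g1 g2 g3] := IH x; split=> /=.
- by move=> j /g1; rewrite mem_cat => ->; rewrite orbT.
- by move=> j; rewrite mem_cat => /orP[/h3|/g2].
move=> s us sn sz.
apply: (@leq_trans (\sum_(j <- s) (2 * x.1 +
    if j \in x.2.2 then 0 else lat c 0 (dp full cs k x).2 (pred1 j)))).
  apply: leq_sum => j _; apply: leq_trans (lat_cat mc _ _ _) _.
  by rewrite has_pred1 leq_add2r.
rewrite big_split /=; apply: leq_add.
  by rewrite big_const_seq count_predT iter_addn_0 leq_mul2l sz orbT.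
have -> : \sum_(j <- s) (if j \in x.2.2 then 0 else lat c 0 (dp full cs k x).2 (pred1 j)) =
    \sum_(j <- [seq j <- s | j \notin x.2.2]) lat c 0 (dp full cs k x).2 (pred1 j).
  by rewrite big_filter [RHS]big_mkcond; apply: eq_bigr => j _; case: (j \in _).
apply: g3; first by rewrite filter_uniq.
  by move=> j; rewrite mem_filter => /andP[_ /sn].
apply: leq_trans h2; rewrite -size_filter; apply: uniq_leq_size.
  by rewrite filter_uniq.
by move=> j; rewrite !mem_filter => /andP[-> /sn].
Qed.
End DPsound.

(* The times of the scale (6/5)^k, rounded down. *)
Definition level (k : nat) : nat := 6 ^ k %/ 5 ^ k.

Lemma level_ge t k : (t <= level k) = (t * 5 ^ k <= 6 ^ k).
Proof. by rewrite /level leq_divRL // expn_gt0. Qed.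

Lemma level_gt0 k : 0 < level k.
Proof. by rewrite level_ge mul1n; elim: k => // k IH; rewrite !expnS; nia. Qed.

(** Five levels multiply the time by 7776/3125, which exceeds 2, while [T.+1 <= 2 * T]. Hence [T]
    rounds of five levels reach the horizon. *)
Lemma level_large T k : 5 * T <= k -> T <= level k.
Proof.
move=> Tk; rewrite level_ge -(subnKC Tk); move: (k - 5 * T) => o.
rewrite (expnD 5 (5 * T) o) (expnD 6 (5 * T) o) mulnA; apply: leq_mul; last by case: o => // o; rewrite leq_exp2r.
rewrite (expnM 5 5 T) (expnM 6 5 T) (_ : 5 ^ 5 = 3125) // (_ : 6 ^ 5 = 7776) //.
elim: {Tk k o} T => // -[|T] IH; first by rewrite !expn1.
rewrite (expnS 3125) (expnS 7776 T.+1); move: (3125 ^ T.+1) (7776 ^ T.+1) IH => y z IH.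
rewrite mulnCA; apply: (@leq_trans (3125 * (2 * (T.+1 * y)))).
  by rewrite leq_mul2l; apply/orP; right; nia.
by rewrite mulnA; apply: leq_mul.
Qed.

(** * Comparison of the dynamic program with the LP *)

Section Analysis.
Local Open Scope ring_scope.
Variable R : realFieldType.
Let r : R := 6%:R / 5%:R.

Lemma level_le k : (level k)%:R <= r ^+ k.
Proof.
rewrite /r expr_div_n ler_pdivlMr ?exprn_gt0 // -!natrX -natrM ler_nat.
exact: leq_trunc_div.
Qed.

Lemma level_lt t k : (level k < t)%N -> r ^+ k < t%:R.
Proof.
rewrite ltnNge level_ge -ltnNge => h.
by rewrite /r expr_div_n ltr_pdivrMr ?exprn_gt0 // -!natrX -natrM ltr_nat.
Qed.

(** If [k] is the last index with [level k < t], then [r ^+ k < t], and both sums together are at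
    most the geometric sum up to exponent [k + 5], that is [5 * (r ^+ (k + 6) - 1)]. This is what
    one unit of [x j t] is charged over all five offsets. *)
Lemma geometric_levels (t n : nat) : (0 < t)%N ->
  \sum_(0 <= k < 5) r ^+ k + \sum_(0 <= k < n | (level k < t)%N) r ^+ (k + 5) <= 5%:R * r ^+ 6 * t%:R.
Proof.
move=> t0; have t1 : 1 <= t%:R :> R by rewrite ler1n.
have r1 : 1 <= r by rewrite /r; lra.
have geo m : \sum_(0 <= k < m) r ^+ k = 5%:R * (r ^+ m - 1).
  elim: m => [|m IH]; first by rewrite big_geq // expr0 subrr mulr0.
  by rewrite big_nat_recr //= IH exprS /r; lra.
elim: n => [|n IH].
  rewrite [X in _ + X]big_geq // addr0 geo; have : 0 <= r ^+ 5 by rewrite exprn_ge0 //; lra.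
  rewrite (exprS r 5) /r; move: (_ ^+ 5) => y y0; have : y <= y * t%:R by rewrite ler_peMr.
  by lra.
rewrite [X in _ + X]big_mkcond [X in _ + X]big_nat_recr //= -big_mkcond /=.
case: ifP => [lt|_]; last by rewrite addr0.
apply: (@le_trans _ _ (\sum_(0 <= k < n.+1 + 5) r ^+ k)).
  have -> : \sum_(0 <= k < n.+1 + 5) r ^+ k =
     \sum_(0 <= k < 5) r ^+ k + \sum_(0 <= k < n.+1) r ^+ (k + 5).
    rewrite (@big_cat_nat _ _ _ 5) /=; [congr (_ + _)|by []|lia].
    have := @big_addn R 0 +%R 0 (n.+1 + 5) 5 predT (fun k => r ^+ k).
    by rewrite add0n addnK.
  rewrite lerD2l [X in _ <= X]big_nat_recr //= lerD2r.
  rewrite big_mkcond; apply: ler_sum => k _; case: ifP => // _.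
  by rewrite exprn_ge0 //; lra.
rewrite geo; have := level_lt lt; rewrite addSn -addnS exprD => h.
have : 0 <= r ^+ 6 by rewrite exprn_ge0 //; lra.
have : r ^+ n * r ^+ 6 <= t%:R * r ^+ 6 by rewrite ler_wpM2r ?exprn_ge0 ?ltW //; lra.
by lra.
Qed.

Variables (full : cand) (cs : seq cand) (cd : nat -> cand) (lam : nat -> nat) (m : nat).
Hypothesis cd_cs : forall i, (i <= m)%N -> cd i \in cs.
Hypothesis cd_m : (cd m).2.1 = 0%N.
Hypothesis lam0 : lam 0 = 8%N.
Hypothesis lam_gt0 : forall i, (0 < lam i)%N.
Hypothesis lamS : forall i, (8 * lam i.+1 <= 9 * lam i)%N.
Variables (n T : nat) (b : R) (M : nat -> R).
Hypothesis b_ge : (256 * n)%:R <= b.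
Hypothesis M_ge0 : forall t, 0 <= M t.
Hypothesis M_le : forall t, M t <= n%:R.
Hypothesis MT : M T = 0.
Hypothesis cdP : forall t i, (0 < t <= T)%N -> (i <= m)%N ->
  ((cd i).1 + lam i * (cd i).2.1)%:R <= b * t%:R + (lam i)%:R * M t.

(* A convex combination of the two tours between which the length exceeds the
   budget B; the ratio of their multipliers is at most 9/8. *)
Lemma two_point t : (0 < t <= T)%N -> exists p q (al : R),
  [/\ p \in cs, q \in cs, 0 <= al <= 1,
      (1 - al) * p.1%:R + al * q.1%:R <= 33%:R / 32%:R * (b * t%:R) &
      (1 - al) * p.2.1%:R + al * q.2.1%:R <= 9%:R / 8%:R * M t].
Proof.
move=> tT; have t1 : 1 <= t%:R :> R by rewrite ler1n; case/andP: tT.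
set B := 33%:R / 32%:R * (b * t%:R).
have b0 : 0 <= b by apply: le_trans b_ge; rewrite ler0n.
have bt : b <= b * t%:R by rewrite ler_peMr.
(* The initial multiplier is 8 and [M t <= n], so the tree costs at most [b * t + 8 * n], and
   [8 * n] is at most [b / 32]: this is the origin of 256 and of 33/32. *)
have c0 : (cd 0).1%:R <= B.
  have := cdP tT (leq0n m); rewrite lam0 natrD natrM => h.
  have : 0 <= 8%:R * (cd 0).2.1%:R :> R by rewrite mulr_ge0 ?ler0n.
  move: b_ge (M_le t) h; rewrite natrM /B; lra.
have c_le i : (i <= m)%N -> (cd i).1%:R + (lam i)%:R * (cd i).2.1%:R <= B + (lam i)%:R * M t.
  by move=> im; have := cdP tT im; rewrite natrD natrM /B; lra.
case: (boolP [forall i : 'I_m.+1, (cd i).1%:R <= B]) => [/forallP al|].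
  exists (cd m), (cd m), 0; split; rewrite ?cd_cs ?lexx ?ler01 //.
    by have := al ord_max; rewrite /= subr0 mul1r mul0r addr0.
  by rewrite cd_m !mulr0 addr0 mulr_ge0 // divr_ge0.
rewrite negb_forall => /existsP[i0 /= hi0].
have ex : exists i, (i <= m)%N && (B < (cd i).1%:R).
  by exists i0; rewrite -ltnS ltn_ord ltNge.
case: (ex_minnP ex) => -[|i] /andP[im ci] min_i; first by rewrite ltNge c0 in ci.
have cp : (cd i).1%:R <= B.
  by rewrite leNgt; apply/negP => h; have := min_i i; rewrite (ltnW im) h ltnn => /(_ isT).
have := c_le _ (ltnW im); have := c_le _ im.
have l0 : 0 < (lam i)%:R :> R by rewrite ltr0n.
have l0' : 0 < (lam i.+1)%:R :> R by rewrite ltr0n.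
have lS : 8%:R * (lam i.+1)%:R <= 9%:R * (lam i)%:R :> R by rewrite -!natrM ler_nat.
set cq := (cd i.+1).1%:R in ci *; set uq := (cd i.+1).2.1%:R.
set p1 := (cd i).1%:R in cp *; set up := (cd i).2.1%:R.
move=> hq hp; exists (cd i), (cd i.+1), ((B - p1) / (cq - p1)).
have d0 : 0 < cq - p1 by lra.
have al0 : 0 <= (B - p1) / (cq - p1) by rewrite divr_ge0 //; lra.
have al1 : (B - p1) / (cq - p1) <= 1 by rewrite ler_pdivrMr //; lra.
have Ea : (B - p1) / (cq - p1) * (cq - p1) = B - p1 by rewrite divfK // gt_eqF.
move: ((B - p1) / (cq - p1)) Ea al0 al1 => a Ea a0 a1.
split; rewrite ?cd_cs ?(ltnW im) //; rewrite -/p1 -/cq -/up -/uq.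
- by rewrite a0.
- have -> : (1 - a) * p1 + a * cq = p1 + a * (cq - p1) by ring.
  by rewrite Ea addrC subrK.
have uq0 : 0 <= uq by rewrite /uq ler0n.
have M0 := M_ge0 t.
(* [D] is both the budget left by the shorter tour and the excess of the longer one, each with its
   weight. It adds [D / l] to the first bound on missed nodes and removes [D / l'] from the second;
   since [D <= l' * M t] and [l' <= 9/8 * l], the net loss is at most [M t / 8]. *)
pose D := (1 - a) * (B - p1).
have ED : D = a * (cq - B) by rewrite /D; lra.
have DM : D <= (lam i.+1)%:R * M t.
  rewrite ED; apply: (@le_trans _ _ (cq - B)).
    by rewrite ler_piMl //; lra.
  have : 0 <= (lam i.+1)%:R * uq by rewrite mulr_ge0 // ltW.
  by lra.
have D0 : 0 <= D by rewrite /D mulr_ge0 //; lra.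
have h1 : (lam i)%:R * ((1 - a) * up) <= (lam i)%:R * ((1 - a) * M t) + D.
  have := ler_wpM2l (_ : 0 <= 1 - a) hp; rewrite subr_ge0 => /(_ a1); rewrite /D; lra.
have h2 : (lam i.+1)%:R * (a * uq) <= (lam i.+1)%:R * (a * M t) - D.
  have := ler_wpM2l a0 hq; rewrite ED; lra.
set l := (lam i)%:R in l0 lS h1 *; set l' := (lam i.+1)%:R in l0' lS h2 DM *.
have k1 : (1 - a) * up <= (1 - a) * M t + D / l.
  by rewrite -(ler_pM2l l0) mulrDr [l * (D / l)]mulrC divfK ?gt_eqF.
have k2 : a * uq <= a * M t - D / l'.
  by rewrite -(ler_pM2l l0') mulrBr [l' * (D / l')]mulrC divfK ?gt_eqF.
suff : D / l - D / l' <= 8%:R^-1 * M t by lra.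
have -> : D / l - D / l' = (D / l') * (l' / l - 1).
  by field; rewrite !gt_eqF.
have e1 : D / l' <= M t by rewrite ler_pdivrMr // mulrC.
have e2 : l' / l - 1 <= 8%:R^-1 by rewrite lerBlDr ler_pdivrMr //; lra.
have e0 : 0 <= D / l' by rewrite divr_ge0 // ltW.
apply: (@le_trans _ _ (D / l' * 8%:R^-1)); first by rewrite ler_wpM2l.
by rewrite mulrC ler_wpM2l // invr_ge0 ler0n.
Qed.

Let V k a : R := (dp full cs k a).1%:R.
Let lt k := minn T (level k).
(** The tour taken at level [k + 5] delays the nodes still missed at level [k]. *)
Let w k : R := r ^+ (k + 5) * M (lt k).
Let kap : R := 2%:R * (33%:R / 32%:R) * (9%:R / 8%:R).

(* One more round of the recursion: the next tour is drawn independently of the current one. *)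
Lemma dp_mix k a (p q : cand) (al : R) : p \in cs -> q \in cs -> 0 <= al <= 1 ->
  V k.+1 a <= 2%:R * ((1 - al) * p.1%:R + al * q.1%:R) * a.2.1%:R + ((1 - al) * V k p + al * V k q).
Proof.
move=> pcs qcs /andP[a0 a1].
have key x : x \in cs -> V k.+1 a <= 2%:R * x.1%:R * a.2.1%:R + V k x.
  by move=> xcs; rewrite /V -!natrM -natrD ler_nat; apply: dpS.
have := ler_wpM2l (_ : 0 <= 1 - al) (key p pcs); rewrite subr_ge0 => /(_ a1).
have := ler_wpM2l a0 (key q qcs); lra.
Qed.

Hypothesis T0 : (0 < T)%N.

Lemma lt_in k : (0 < lt k <= T)%N.
Proof. by rewrite /lt leq_min T0 level_gt0 geq_minl. Qed.

Lemma b_ge0 : 0 <= b.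
Proof. by apply: le_trans b_ge; rewrite ler0n. Qed.

Lemma b_level k : b * (lt k)%:R <= b * r ^+ k.
Proof.
rewrite ler_wpM2l ?b_ge0 //; apply: le_trans (level_le k).
by rewrite ler_nat geq_minr.
Qed.

(** Induction on the rounds left. Tours at levels [k] and [k + 5] are mixed independently, so the
    mean of missed nodes times next length is the product of the means, which gives the constant
    [kap]. At the end nothing is missed and the base plan costs nothing. *)
Lemma dp_levels J k (p q : cand) (al : R) : p \in cs -> q \in cs -> 0 <= al <= 1 ->
  (1 - al) * p.2.1%:R + al * q.2.1%:R <= 9%:R / 8%:R * M (lt k) ->
  M (lt (k + 5 * J)) = 0 ->
  (1 - al) * V J p + al * V J q <= kap * b * \sum_(0 <= i < J) w (k + 5 * i).
Proof.
elim: J k p q al => [|J IH] k p q al pcs qcs al01 Hu.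
  rewrite muln0 addn0 big_geq // mulr0 => M0; rewrite M0 mulr0 in Hu.
  rewrite /V /= !natrM; have f0 : 0 <= full.1%:R :> R by rewrite ler0n.
  have := ler_wpM2l f0 Hu; rewrite mulr0; lra.
move=> M0; have [p' [q' [al' [p'cs q'cs al'01 Hc' Hu']]]] := two_point (lt_in (k + 5)).
have := IH (k + 5)%N p' q' al' p'cs q'cs al'01 Hu'.
rewrite -addnA -mulnS => /(_ M0) {}IH.
rewrite big_nat_recl // muln0 addn0 mulrDr.
under eq_bigr do rewrite mulnS addnA.
set S := \sum_(0 <= i < J) _ in IH *.
have hp := dp_mix J p p'cs q'cs al'01; have hq := dp_mix J q p'cs q'cs al'01.
set C := (1 - al') * p'.1%:R + _ in Hc' hp hq; set V' := (1 - al') * V J p' + _ in IH hp hq.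
have C0 : 0 <= C by case/andP: al'01 => a0 a1; rewrite addr_ge0 // mulr_ge0 ?ler0n ?subr_ge0.
have hC : C <= 33%:R / 32%:R * (b * r ^+ (k + 5)).
  by apply: le_trans Hc' _; rewrite ler_wpM2l ?b_level ?divr_ge0 ?ler0n.
have h1 : (1 - al) * V J.+1 p + al * V J.+1 q <=
    2%:R * C * ((1 - al) * p.2.1%:R + al * q.2.1%:R) + V'.
  case/andP: al01 => a0 a1.
  have := ler_wpM2l (_ : 0 <= 1 - al) hp; rewrite subr_ge0 => /(_ a1).
  have := ler_wpM2l a0 hq; lra.
apply: le_trans h1 _; apply: lerD => //.
apply: (@le_trans _ _ (2%:R * C * (9%:R / 8%:R * M (lt k)))).
  by rewrite ler_wpM2l // mulr_ge0 // ler0n.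
have M0' := M_ge0 (lt k).
apply: (@le_trans _ _ (2%:R * (33%:R / 32%:R * (b * r ^+ (k + 5))) * (9%:R / 8%:R * M (lt k)))).
  apply: ler_wpM2r; first by rewrite mulr_ge0 // divr_ge0 ?ler0n.
  by apply: ler_wpM2l => //; rewrite ler0n.
by rewrite /kap /w; lra.
Qed.

(** The optimum is below the value for each of the five offsets, hence five times it is below their
    sum. The levels [o + 5 * i] then run once through all [k < 5 * T]. *)
Lemma dp_start (a : cand) : a.2.1 = n ->
  5%:R * V T.+1 a <= kap * b *
    (n%:R * \sum_(0 <= k < 5) r ^+ k + \sum_(0 <= k < T * 5) w k).
Proof.
move=> an.
have key o : (o < 5)%N -> V T.+1 a <= kap * b * (n%:R * r ^+ o + \sum_(0 <= i < T) w (o + 5 * i)).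
  move=> _; have [p [q [al [pcs qcs al01 Hc Hu]]]] := two_point (lt_in o).
  apply: le_trans (dp_mix T a pcs qcs al01) _; rewrite [X in _ <= X]mulrDr; apply: lerD; last first.
    apply: dp_levels => //; rewrite /lt (minn_idPl _) //.
    by apply: level_large; rewrite leq_addl.
  rewrite an; set C := _ + _ in Hc *.
  have C0 : 0 <= C by case/andP: al01 => a0 a1; rewrite addr_ge0 // mulr_ge0 ?ler0n ?subr_ge0.
  have hC : C <= 33%:R / 32%:R * (b * r ^+ o).
    by apply: le_trans Hc _; rewrite ler_wpM2l ?b_level ?divr_ge0 ?ler0n.
  have n0 : 0 <= n%:R :> R by rewrite ler0n.
  have : C * n%:R <= 33%:R / 32%:R * (b * r ^+ o) * n%:R by rewrite ler_wpM2r.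
  have : 0 <= b * r ^+ o * n%:R.
    by rewrite !mulr_ge0 ?b_ge0 ?exprn_ge0 // /r; lra.
  rewrite /kap; lra.
have -> : 5%:R * V T.+1 a = \sum_(0 <= o < 5) V T.+1 a.
  by rewrite sumr_const_nat subn0 mulr_natl.
apply: (@le_trans _ _ (\sum_(0 <= o < 5) (kap * b * (n%:R * r ^+ o + \sum_(0 <= i < T) w (o + 5 * i))))).
  by rewrite big_nat [X in _ <= X]big_nat; apply: ler_sum => o /andP[_ /key].
rewrite -mulr_sumr big_split -mulr_sumr /=.
suff -> : \sum_(0 <= k < T * 5) w k = \sum_(0 <= o < 5) \sum_(0 <= i < T) w (o + 5 * i) by [].
rewrite exchange_big /=; elim: (T) => [|T' IH]; first by rewrite !big_geq.
rewrite [RHS]big_nat_recr //= -IH mulSn addnC.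
rewrite (@big_cat_nat _ _ _ (T' * 5)) ?leq_addr //=; congr (_ + _).
rewrite -{1}[(T' * 5)%N]add0n big_addn addKn; apply: eq_bigr => i _.
by rewrite mulnC.
Qed.

Variables (mm : nat) (x : 'I_mm -> nat -> R).
Hypothesis x_ge0 : forall j t, (1 <= t <= T)%N -> 0 <= x j t.
Hypothesis nx : n%:R <= \sum_j \sum_(1 <= t < T.+1) x j t.
Hypothesis Mx : forall s, (0 < s <= T)%N -> M s <= \sum_j \sum_(1 <= t < T.+1 | (s < t)%N) x j t.

(** After exchanging sums, each [x j t] is charged at the levels whose time precedes [t], and the
    initial term [n] is spread over the [x j t] as well. *)
Theorem dp_bound (a : cand) : a.2.1 = n ->
  (dp full cs T.+1 a).1%:R <= 7%:R * b * \sum_j \sum_(1 <= t < T.+1) t%:R * x j t.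
Proof.
move=> an; have := dp_start an; rewrite /V.
set v := (dp full cs T.+1 a).1%:R; set L := \sum_j _; set S := n%:R * _ + _ => h.
have kap0 : 0 <= kap by rewrite /kap; lra.
have r0 : 0 <= r by rewrite /r; lra.
suff hS : S <= 5%:R * r ^+ 6 * L.
  have := ler_wpM2l (mulr_ge0 kap0 b_ge0) hS => hS'.
  have L0 : 0 <= b * L.
    rewrite mulr_ge0 ?b_ge0 // sumr_ge0 // => j _.
    rewrite big_nat sumr_ge0 // => t /x_ge0 xt; by rewrite mulr_ge0 // ler0n.
  have E : kap * b * (5%:R * r ^+ 6 * L) = kap * r ^+ 6 * (5%:R * (b * L)).
    have gen (k b' y l : R) : k * b' * (5%:R * y * l) = k * y * (5%:R * (b' * l)) by ring.
    exact: gen.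
  have h5 : 5%:R * v <= kap * r ^+ 6 * (5%:R * (b * L)) by rewrite -E; exact: (le_trans h hS').
  (* 2 for turning trees into tours, times 33/32, 9/8 and (6/5)^6: about 6.93. *)
  have k7 : kap * r ^+ 6 <= 7%:R.
    have r3 : r ^+ 3 = 216%:R / 125%:R by rewrite !exprS expr0 /r; lra.
    by rewrite (exprM r 3 2) r3 expr2 /kap; lra.
  have L5 : 0 <= 5%:R * (b * L) by rewrite mulr_ge0 ?ler0n.
  have := le_trans h5 (ler_wpM2r L5 k7); rewrite -!mulrA; move: (b * L) => y; lra.
apply: (@le_trans _ _ (\sum_j \sum_(1 <= t < T.+1) x j t *
   (\sum_(0 <= k < 5) r ^+ k + \sum_(0 <= k < T * 5 | (level k < t)%N) r ^+ (k + 5)))); last first.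
  rewrite /L mulr_sumr; apply: ler_sum => j _.
  rewrite mulr_sumr big_nat [X in _ <= X]big_nat; apply: ler_sum => t tT.
  rewrite [t%:R * _]mulrC mulrCA ler_wpM2l ?x_ge0 //.
  by apply: geometric_levels; case/andP: tT.
under eq_bigr do under eq_bigr do rewrite mulrDr.
under eq_bigr do rewrite big_split /=.
rewrite big_split /=; apply: lerD.
  under eq_bigr do rewrite -mulr_suml.
  rewrite -mulr_suml ler_wpM2r // big_nat sumr_ge0 // => k _; exact: exprn_ge0.
under [X in _ <= X]eq_bigr do under eq_bigr do rewrite mulr_sumr.
apply: (@le_trans _ _ (\sum_(0 <= k < T * 5) r ^+ (k + 5) *
   \sum_j \sum_(1 <= t < T.+1 | (lt k < t)%N) x j t)).
  by apply: ler_sum => k _; rewrite /w ler_wpM2l ?exprn_ge0 // Mx // lt_in.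
under [X in X <= _]eq_bigr do rewrite mulr_sumr.
rewrite exchange_big /=; apply: ler_sum => j _.
under [X in X <= _]eq_bigr do rewrite mulr_sumr big_mkcond /=.
rewrite exchange_big /= big_nat [X in _ <= X]big_nat; apply: ler_sum => t /andP[t1 tT].
rewrite [X in _ <= X]big_mkcond; apply: ler_sum => k _.
rewrite /lt gtn_min [(T < t)%N]ltnNge -ltnS tT /=.
by case: ifP => // _; rewrite mulrC.
Qed.
End Analysis.

(** * Greedy concatenation for groups *)

Definition visited (tr : seq nat) (a : nat) : bool := (a == 0) || (a \in tr).

Definition grow (tr : seq nat) (e : nat * nat) : seq nat :=
  if visited tr e.1 then if visited tr e.2 then tr else ins e.1 e.2 tr
  else if visited tr e.2 then ins e.2 e.1 tr else tr.

(* Several passes, since the edges are listed in arbitrary order. *)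
Definition build (el : seq (nat * nat)) : seq nat :=
  iter (size el) (fun tr => foldl grow tr el) [::].

Section Build.
Variables (c : nat -> nat -> nat) (el : seq (nat * nat)).
Hypothesis mc : metric c.

Let both (tr : seq nat) (e : nat * nat) := visited tr e.1 && visited tr e.2.
Let ends (a : nat) := has (fun e => (a == e.1) || (a == e.2)) el.

(** Only edges with both ends visited are charged: an insertion completes an edge not charged
    before, which pays for the detour. *)
Definition tour_inv (tr : seq nat) : Prop :=
  [/\ uniq tr, 0 \notin tr, (forall a, a \in tr -> ends a) &
      tour_len c tr <= 2 * \sum_(e <- el | both tr e) c e.1 e.2].

Lemma ins_visited x w tr a : visited tr x -> uniq tr ->
  visited (ins x w tr) a = (a == w) || visited tr a.
Proof.
move=> vx ut; rewrite /visited (perm_mem (ins_perm w vx ut)) inE.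
by rewrite orbCA.
Qed.

Lemma grow_one x w tr e : e \in el -> ((x, w) = e \/ (w, x) = e) ->
  visited tr x -> ~~ visited tr w -> tour_inv tr -> tour_inv (ins x w tr).
Proof.
move=> eel exw vx nw [ut t0 te tc].
have [wt w0] : w \notin tr /\ w != 0 by move: nw; rewrite negb_or => /andP[].
have pe := ins_perm w vx ut.
have cew : c e.1 e.2 = c x w by case: mc => _ sym _; case: exw => <- //=.
split.
- by rewrite (perm_uniq pe) /= wt.
- by rewrite (perm_mem pe) inE negb_or eq_sym w0.
- move=> a; rewrite (perm_mem pe) inE => /orP[/eqP->|/te //].
  by apply/hasP; exists e => //; case: exw => <- /=; rewrite eqxx ?orbT.
apply: leq_trans (closed_ins mc w vx ut) _.
apply: leq_trans (leq_add tc (leqnn _)) _; rewrite -mulnDr leq_mul2l /=.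
rewrite (big_rem e) //= [X in _ <= X](big_rem e) //= -cew.
have -> : both tr e = false by rewrite /both; case: exw => <- /=; rewrite (negbTE nw) ?andbF.
have -> : both (ins x w tr) e.
  by rewrite /both !ins_visited //; case: exw => <- /=; rewrite eqxx vx ?orbT.
rewrite add0n addnC leq_add2l big_mkcond [X in _ <= X]big_mkcond /=; apply: leq_sum => f _.
case: ifP => // /andP[h1 h2].
by rewrite /both !ins_visited // h1 h2 !orbT.
Qed.

Lemma grow_inv tr e : e \in el -> tour_inv tr -> tour_inv (grow tr e).
Proof.
move=> eel ti; rewrite /grow; case: ifP => v1; case: ifP => v2 //.
  by apply: (grow_one eel) => //; [left; case: (e)|rewrite v2].
by apply: (grow_one eel) => //; [right; case: (e)|rewrite v1].
Qed.

Lemma grow_visited tr e a : tour_inv tr ->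
  visited tr a -> visited (grow tr e) a.
Proof.
case=> ut _ _ _ va; rewrite /grow; case: ifP => v1; case: ifP => v2 //;
  by rewrite ins_visited // va orbT.
Qed.

Lemma grow_both tr e : tour_inv tr -> visited tr e.1 || visited tr e.2 -> both (grow tr e) e.
Proof.
case=> ut _ _ _; rewrite /grow /both; case: ifP => v1; case: ifP => v2 //= _.
- by rewrite v1 v2.
- by rewrite !ins_visited // eqxx v1 orbT.
by rewrite !ins_visited // eqxx v2 orbT.
Qed.

Lemma pass_inv tr s : {subset s <= el} -> tour_inv tr ->
  [/\ tour_inv (foldl grow tr s), (forall a, visited tr a -> visited (foldl grow tr s) a) &
      forall e, e \in s -> visited tr e.1 || visited tr e.2 -> both (foldl grow tr s) e].
Proof.
elim: s tr => //= f s IH tr sub ti.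
have fel : f \in el by apply: sub; rewrite mem_head.
have ti' := grow_inv fel ti.
have [h1 h2 h3] := IH _ (fun x xs => sub x (mem_behead (s := f :: s) xs)) ti'.
split=> //; first by move=> a va; apply/h2/grow_visited.
move=> e; rewrite inE => /orP[/eqP->|es] ve.
  have /andP[b1 b2] := grow_both ti ve.
  by rewrite /both !h2.
by apply: h3 => //; case/orP: ve => /(grow_visited f ti) ->; rewrite ?orbT.
Qed.

Let complete tr := all (fun e => visited tr e.1 == visited tr e.2) el.

Lemma pass_complete tr : complete tr -> foldl grow tr el = tr.
Proof.
move=> /allP co; have : {subset el <= el} by [].
elim: {1 3}el => //= e s IH sub.
have -> : grow tr e = tr.
  have /eqP := co e (sub e (mem_head _ _)); rewrite /grow => ->.
  by case: ifP => // ->.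
by apply: IH => x xs; apply: sub; rewrite inE xs orbT.
Qed.

(** A pass that starts with an edge having exactly one visited end increases the number of completed
    edges, so [size el] passes suffice; a complete tour is left unchanged by further passes. *)
Lemma build_inv : tour_inv (build el) /\ complete (build el).
Proof.
have ti0 : tour_inv [::].
  by split=> //; rewrite /tour_len /=; case: mc => -> _ _.
suff H k : let tr := iter k (fun tr => foldl grow tr el) [::] in
    tour_inv tr /\ (complete tr \/ k <= count (both tr) el).
  have [ti co] := H (size el); split=> //; case: co => // h.
  have : all (both (build el)) el by rewrite all_count eqn_leq count_size.
  by move=> al; apply/allP => e /(allP al) /andP[-> ->].
elim: k => [|k [ti IH]] /=; first by split=> //; right.
set tr := iter k _ _ in ti IH *.
have [h1 h2 h3] := pass_inv (fun x h => h) ti; split=> //.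
case: (boolP (complete tr)) => co; first by left; rewrite pass_complete.
right; case: IH => [co'|IH]; first by rewrite co' in co.
apply: leq_ltn_trans IH _.
case/allPn: co => e eel ne.
have be : both tr e = false by move: ne; rewrite /both; do 2!case: visited.
have be' : both (foldl grow tr el) e.
  by apply: h3 => //; move: ne; do 2!case: visited.
rewrite -!sum1_count (big_rem e) //= [X in _ < X](big_rem e) //= be be' add0n add1n ltnS.
rewrite big_mkcond [X in _ <= X]big_mkcond /=; apply: leq_sum => f _.
by case: ifP => // /andP[/h2 b1 /h2 b2]; rewrite /both b1 b2.
Qed.

End Build.

(** * Tours of best ratio and the cost of their concatenation *)

Definition hits (tr g : seq nat) : bool := has (fun a => a \in tr) g.

Definition choice := (nat * (nat * seq nat))%type.

(** Ratios are compared by cross-multiplication; a count 0 in [best] means that no tour has been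
    chosen yet. *)
Definition choose_tour (c : nat -> nat -> nat) (cs : seq (seq nat)) (U : seq (seq nat)) : choice :=
  foldl (fun (best : choice) tr =>
    let k := count (hits tr) U in
    if (0 < k) && ((best.2.1 == 0) || (tour_len c tr * best.2.1 < best.1 * k))
    then (tour_len c tr, (k, tr)) else best) (0, (0, [::])) cs.

Definition missed (tr : seq nat) (U : seq (seq nat)) := [seq g <- U | ~~ hits tr g].

Fixpoint greedy c cs k U : seq nat :=
  if k is k'.+1 then
    let tr := (choose_tour c cs U).2.2 in tr ++ greedy c cs k' (missed tr U)
  else [::].

Lemma choose_tour_spec c cs U :
  let b := choose_tour c cs U in
  [/\ b.1 = tour_len c b.2.2 \/ b.2.1 = 0, b.2.1 = count (hits b.2.2) U,
      (b.2.2 = [::]) \/ (b.2.2 \in cs) &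
      forall tr, tr \in cs -> (count (hits tr) U != 0 -> b.2.1 != 0) /\
        b.1 * count (hits tr) U <= tour_len c tr * b.2.1].
Proof.
suff H s (b0 : choice) :
    let P (b : choice) := [/\ b.1 = tour_len c b.2.2 \/ b.2.1 = 0, b.2.1 = count (hits b.2.2) U &
      b.2.1 = 0 -> b.1 = 0] in P b0 ->
    let b := foldl (fun (best : choice) tr =>
      let k := count (hits tr) U in
      if (0 < k) && ((best.2.1 == 0) || (tour_len c tr * best.2.1 < best.1 * k))
      then (tour_len c tr, (k, tr)) else best) b0 s in
    [/\ P b, (b.2.2 = b0.2.2) \/ (b.2.2 \in s), (b0.2.1 != 0 -> b.2.1 != 0),
       b.1 * b0.2.1 <= b0.1 * b.2.1 &
      forall tr, tr \in s -> (count (hits tr) U != 0 -> b.2.1 != 0) /\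
        b.1 * count (hits tr) U <= tour_len c tr * b.2.1].
  have E : count (hits [::]) U = 0 by elim: U {H} => //= g U ->; rewrite addn0; elim: g.
  have [|[h1 h2 h3] h4 h5 h6 h7] := H cs (0, (0, [::])).
    by split=> //=; right.
  by split.
elim: s b0 => [|tr s IH] b0 P Pb0 /=; first by split=> //; left.
set k := count (hits tr) U.
set b1 := if _ then _ else b0.
have [Pb1 h21 [b01 ne1] le1 letr] : [/\ P b1, b1.2.2 = b0.2.2 \/ b1.2.2 = tr,
   (b0.2.1 != 0 -> b1.2.1 != 0) /\ (k != 0 -> b1.2.1 != 0),
   b1.1 * b0.2.1 <= b0.1 * b1.2.1 & b1.1 * k <= tour_len c tr * b1.2.1].
  rewrite /b1; case: ifP => [/andP[k0 h]|h].
    split=> //=; [by split=> //=; [left|lia]|by right|by split=> _; rewrite -lt0n|].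
    by case/orP: h => [/eqP ->|/ltnW]; rewrite ?muln0.
  case: Pb0 => p1 p2 p3; split=> //; first by left.
    split=> // k0; move/negbT: h; rewrite lt0n k0 /= negb_or => /andP[->].
    by [].
  move/negbT: h; rewrite negb_and -leqNgt leqn0 => /orP[/eqP->|]; first by rewrite muln0.
  by rewrite negb_or -leqNgt => /andP[].
have [Pb h4 h5 h6 h7] := IH _ Pb1.
set b := foldl _ _ _ in Pb h4 h5 h6 h7 *; split=> //.
- case: h4 => [->|h4]; last by right; rewrite inE h4 orbT.
  by case: h21 => ->; [left|right; rewrite mem_head].
- by move/b01/h5.
- case: (posnP b1.2.1) => z; last first.
    rewrite -(leq_pmul2r z) mulnAC; apply: leq_trans (leq_mul h6 (leqnn b0.2.1)) _.
    by rewrite mulnAC -[X in _ <= X]mulnAC leq_mul2r le1 orbT.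
  have z0 : b0.2.1 = 0 by apply/eqP; move: b01; rewrite z; case: eqP => // _ /(_ isT).
  by rewrite z0 muln0.
move=> tr'; rewrite inE => /orP[/eqP->|/h7//]; rewrite -/k; split; first by move/ne1/h5.
case: (posnP b1.2.1) => z; last first.
  rewrite -(leq_pmul2r z) mulnAC; apply: leq_trans (leq_mul h6 (leqnn k)) _.
  by rewrite mulnAC -[X in _ <= X]mulnAC leq_mul2r letr orbT.
have -> : k = 0 by apply/eqP; move: ne1; rewrite z; case: eqP => // _ /(_ isT).
by rewrite muln0.
Qed.

Section GreedySound.
Variables (c : nat -> nat -> nat) (cs : seq (seq nat)).
Hypothesis mc : metric c.

(** Each tour is charged in full to every remaining group, including those it hits. *)
Fixpoint greedy_cost k (U : seq (seq nat)) : nat :=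
  if k is k'.+1 then
    let tr := (choose_tour c cs U).2.2 in
    tour_len c tr * size U + greedy_cost k' (missed tr U)
  else 0.

Lemma lat_greedy k U :
  \sum_(g <- U) lat c 0 (greedy c cs k U) (fun a => a \in g) <= greedy_cost k U.
Proof.
elim: k U => [|k IH] U /=; first by rewrite big1.
set tr := _.2.2; apply: (@leq_trans (\sum_(g <- U) (tour_len c tr +
   if hits tr g then 0 else lat c 0 (greedy c cs k (missed tr U)) (fun a => a \in g)))).
  apply: leq_sum => g _; apply: leq_trans (lat_cat mc _ _ _) _.
  by rewrite /hits has_sym.
rewrite big_split /= big_const_seq count_predT iter_addn_0 leq_add2l.
apply: leq_trans (IH _); rewrite big_filter big_mkcond [X in _ <= X]big_mkcond.
by apply: leq_sum => g _; case: hits.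
Qed.

Lemma greedy_sub k U a : a \in greedy c cs k U -> exists2 tr, tr \in cs & a \in tr.
Proof.
elim: k U => //= k IH U; rewrite mem_cat => /orP[|/IH //].
by have [_ _ [->|]] := choose_tour_spec c cs U; first by []; exists (choose_tour c cs U).2.2.
Qed.

Lemma greedy_hits k U :
  (forall V, V != [::] -> {subset V <= U} -> exists2 tr, tr \in cs & count (hits tr) V != 0) ->
  size U <= k -> forall g, g \in U -> hits (greedy c cs k U) g.
Proof.
elim: k U => [|k IH] U HU szU g gU; first by case: U {HU gU} szU gU.
have U0 : U != [::] by case: U gU {HU szU}.
have [b1 b2 b3 b4] := choose_tour_spec c cs U.
rewrite /=; set tr := (choose_tour c cs U).2.2 in b1 b2 b3 *.
have hcat s t : hits (s ++ t) g = hits s g || hits t g.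
  rewrite /hits -has_predU; apply: eq_has => a /=; exact: mem_cat.
rewrite hcat; case: (boolP (hits tr g)) => //= ng.
have [tr' tr'cs h] := HU U U0 (fun x h => h).
have [ne _] := b4 tr' tr'cs.
have szm : size (missed tr U) < size U.
  have -> : size (missed tr U) = count (predC (hits tr)) U by rewrite size_filter.
  by rewrite -(count_predC (hits tr) U) -b2 -[X in X < _]add0n ltn_add2r lt0n ne.
apply: IH; last by rewrite mem_filter ng.
  by move=> V V0 sV; apply: HU => // x /sV; rewrite mem_filter => /andP[].
by rewrite -ltnS; apply: leq_trans szm szU.
Qed.
End GreedySound.

(** * Comparison of the greedy concatenation with the LP *)

Section GreedyBound.
Local Open Scope ring_scope.
Variables (R : realFieldType) (c : nat -> nat -> nat) (cs : seq (seq nat)).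
Variables (m T : nat) (grp : 'I_m -> seq nat) (x : 'I_m -> nat -> R) (B : R).
Hypothesis B0 : 0 <= B.
Hypothesis x_ge0 : forall j t, (1 <= t <= T)%N -> 0 <= x j t.
Hypothesis x1 : forall j, 1 <= \sum_(1 <= t < T.+1) x j t.

Let Y (I : seq 'I_m) (t : nat) : R := \sum_(j <- I) \sum_(1 <= t' < t.+1) x j t'.

Hypothesis ratio : forall I t, uniq I -> (1 <= t <= T)%N ->
  (choose_tour c cs (map grp I)).1%:R * Y I t <=
  B * t%:R * (choose_tour c cs (map grp I)).2.1%:R.
Hypothesis covered : forall I, uniq I -> I != [::] ->
  exists2 tr, tr \in cs & count (hits tr) (map grp I) != 0%N.

(* [med I] is the first time at which the LP covers half of I. *)
Let half (I : seq 'I_m) (t : nat) : bool := (size I)%:R <= 2%:R * Y I t.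
Let med (I : seq 'I_m) : nat := find (half I) (iota 0 T.+1).

Lemma half_T I : half I T.
Proof.
have : (size I)%:R <= Y I T.
  by rewrite -sum1_size natr_sum; apply: ler_sum => j _; apply: x1.
have : 0 <= (size I)%:R :> R by rewrite ler0n.
by rewrite /half; move: (Y I T) (size I)%:R => y s; lra.
Qed.

Lemma medP I : half I (med I) && (med I <= T)%N.
Proof.
have ha : has (half I) (iota 0 T.+1).
  by apply/hasP; exists T; rewrite ?mem_iota ?ltnSn ?half_T.
have lt : (med I < T.+1)%N by rewrite -[T.+1](size_iota 0) -has_find.
by have := nth_find 0%N ha; rewrite nth_iota // add0n => ->; rewrite -ltnS.
Qed.

Lemma med_lt I s : (s < med I)%N -> ~~ half I s.
Proof.
move=> h; have := before_find 0%N h; rewrite nth_iota ?add0n; first by move=> ->.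
by apply: leq_trans h _; case/andP: (medP I) => _ /leqW.
Qed.

Let late (I : seq 'I_m) (s : nat) : R := \sum_(j <- I) \sum_(s <= t < T.+1) x j t.

Lemma late_med I s : (1 <= s <= med I)%N -> (size I)%:R <= 2%:R * late I s.
Proof.
case: s => // s /andP[_ h]; have := med_lt h; rewrite /half -ltNge => h1.
have sT : (s <= T)%N by apply: leq_trans (ltnW h) _; case/andP: (medP I).
have : (size I)%:R <= Y I s + late I s.+1.
  rewrite /Y /late -big_split -sum1_size natr_sum; apply: ler_sum => j _.
  by apply: le_trans (x1 j) _; rewrite (@big_cat_nat _ _ _ s.+1).
by move: (Y I s) (late I s.+1) (size I)%:R h1 => y l z; lra.
Qed.

Let rest (I : seq 'I_m) : seq 'I_m :=
  [seq j <- I | ~~ hits (choose_tour c cs (map grp I)).2.2 (grp j)].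
Let new (I : seq 'I_m) : nat := (choose_tour c cs (map grp I)).2.1.

Lemma size_rest I : size I = (new I + size (rest I))%N.
Proof.
have [_ E _ _] := choose_tour_spec c cs (map grp I).
rewrite /new E /rest size_filter count_map.
by rewrite -[LHS](count_predC (fun j => hits (choose_tour c cs (map grp I)).2.2 (grp j))).
Qed.

Lemma missed_rest I : missed (choose_tour c cs (map grp I)).2.2 (map grp I) = map grp (rest I).
Proof. by rewrite /missed filter_map. Qed.

(* The groups first hit by a tour chosen when the median was at least s: a layer
   of the cost of the greedy solution. *)
Fixpoint tail k (I : seq 'I_m) (s : nat) : nat :=
  if k is k'.+1 then ((s <= med I) * new I + tail k' (rest I) s)%N else 0%N.

Let all_late s : R := \sum_j \sum_(s <= t < T.+1) x j t.

(** The medians of successive steps need not be monotone, but all groups counted are still present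
    at the first step whose median is at least [s]. Before time [s] the LP covers less than half of
    that set, so twice its late mass bounds its size. *)
Lemma tail_le k I s : uniq I -> (1 <= s)%N ->
  (tail k I s <= size I)%N /\ (tail k I s)%:R <= 2%:R * all_late s.
Proof.
move=> uI s1.
have late_ge0 j : 0 <= \sum_(s <= t < T.+1) x j t.
  rewrite big_nat sumr_ge0 // => t /andP[st tT]; apply: x_ge0.
  by rewrite (leq_trans s1 st).
have late_sub J : uniq J -> late J s <= all_late s.
  move=> uJ; rewrite /late /all_late big_uniq //= [X in _ <= X](bigID (mem J)) /=.
  by rewrite lerDl sumr_ge0.
elim: k I uI => [|k IH] I uI /=.
  split=> //; rewrite mulr_ge0 ?ler0n // /all_late sumr_ge0 //.
have uR : uniq (rest I) by rewrite filter_uniq.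
have [h1 h2] := IH _ uR.
have h3 : ((s <= med I) * new I + tail k (rest I) s <= size I)%N.
  by rewrite size_rest leq_add //; case: (s <= med I)%N; rewrite ?mul1n ?mul0n.
split=> //; case: (boolP (s <= med I)%N) => h; last by rewrite mul0n add0n.
apply: (@le_trans _ _ (size I)%:R); first by rewrite ler_nat; move: h3; rewrite h.
apply: le_trans (late_med (s := s) _) _; first by rewrite s1 h.
by rewrite ler_wpM2l ?ler0n ?late_sub.
Qed.

(** At the median, [size I] is at most twice the covered amount, so the best ratio bounds the tour
    length times [size I] by [2 * B * med I * new I]. The product [med I * new I] is then cut into
    one layer for each [s <= med I]. *)
Lemma greedy_cost_tail k I : uniq I ->
  (greedy_cost c cs k (map grp I))%:R <=
  2%:R * B * \sum_(1 <= s < T.+1) (tail k I s)%:R.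
Proof.
elim: k I => [|k IH] I uI /=.
  by rewrite mulr_ge0 ?mulr_ge0 ?ler0n ?sumr_ge0 // => s _; rewrite ler0n.
rewrite missed_rest natrD natrM size_map.
under eq_bigr do rewrite natrD.
rewrite big_split mulrDr; apply: lerD; last by apply: IH; rewrite filter_uniq.
under eq_bigr do rewrite natrM.
rewrite -mulr_suml.
have -> : \sum_(1 <= s < T.+1) (s <= med I)%N%:R = (med I)%:R :> R.
  case/andP: (medP I) => _ mT.
  rewrite (@big_cat_nat _ _ _ (med I).+1) //= [X in X + _]big_nat [X in _ + X]big_nat.
  rewrite (eq_bigr (fun _ => 1)) => [|s /andP[_ h]]; last by rewrite -ltnS h.
  rewrite [X in _ + X]big1 ?addr0 => [|s /andP[h _]]; last by rewrite leqNgt h.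
  by rewrite -big_nat sumr_const_nat subn1.
have [b1 b2 b3 b4] := choose_tour_spec c cs (map grp I).
set b := choose_tour c cs (map grp I) in b1 b2 b3 b4 *.
have len0 : I != [::] -> tour_len c b.2.2 = b.1.
  move=> I0; case: b1 => // z; have [tr trcs h] := covered uI I0.
  by have [/(_ h)] := b4 tr trcs; rewrite z.
case: (eqVneq I [::]) => [E|I0].
  by rewrite E /= mulr0 !mulr_ge0 ?ler0n.
have /andP[hm mT] := medP I; rewrite len0 //.
have b10 : 0 <= b.1%:R :> R by rewrite ler0n.
have med0 : (0 < med I)%N.
  rewrite lt0n; apply: contra_neq I0 => m0; move: hm; rewrite m0.
  rewrite /half /Y big1 => [|j _]; last by rewrite big_geq.
  by rewrite mulr0 lern0 => /nilP.
have := ratio uI (t := med I); rewrite med0 mT => /(_ isT).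
have := ler_wpM2l b10 hm; rewrite -/b /new -/b.
move: (Y I _) (size I)%:R => y sz; lra.
Qed.

(** This is the histogram argument of greedy min-sum set cover: one factor 2 comes from the choice
    of the median, the other from the late mass, whose sum over [s] is the LP cost. *)
Theorem greedy_cost_bound k I : uniq I ->
  (greedy_cost c cs k (map grp I))%:R <=
  4%:R * B * \sum_j \sum_(1 <= t < T.+1) t%:R * x j t.
Proof.
move=> uI; apply: le_trans (greedy_cost_tail k uI) _.
have -> : \sum_j \sum_(1 <= t < T.+1) t%:R * x j t = \sum_(1 <= s < T.+1) all_late s.
  rewrite /all_late [RHS]exchange_big /=; apply: eq_bigr => j _.
  have E t : (t <= T)%N -> t%:R * x j t = \sum_(1 <= s < T.+1) (if (s <= t)%N then x j t else 0).
    move=> tT; rewrite -big_mkcond /= (@big_cat_nat _ _ _ t.+1) //=.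
    rewrite [X in _ + X]big_nat_cond [X in _ + X]big1 ?addr0; last first.
      by move=> s /andP[/andP[h _]]; rewrite leqNgt h.
    rewrite big_nat_cond (eq_bigl (fun s => (1 <= s < t.+1)%N && true)) => [|s]; last first.
      by rewrite ltnS -andbA andbb andbT.
    by rewrite -big_nat_cond sumr_const_nat subn1 mulr_natl.
  rewrite big_nat; under eq_bigr => t /andP[_ tT] do rewrite E //.
  rewrite -big_nat exchange_big /= big_nat [RHS]big_nat; apply: eq_bigr => s /andP[s1 sT].
  rewrite -big_mkcond (@big_cat_nat _ _ _ s) ?(leqW _) //= ?(ltnW sT) //.
  rewrite [X in X + _]big_nat_cond [X in X + _]big1 ?add0r; last first.
    by move=> t /andP[/andP[_ h]]; rewrite leqNgt h.
  by rewrite big_nat_cond [RHS]big_nat_cond; apply: eq_bigl => t; rewrite andbT;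
     case: (leqP s t); rewrite ?andbF ?andbT.
set S := \sum_(1 <= s < T.+1) all_late s.
have -> : 4%:R * B * S = 2%:R * B * (2%:R * S) by ring.
apply: ler_wpM2l; first by rewrite mulr_ge0 ?ler0n.
rewrite mulr_sumr.
rewrite big_nat [X in _ <= X]big_nat; apply: ler_sum => s /andP[s1 _].
by case: (tail_le k uI s1).
Qed.
End GreedyBound.

(** * Running times *)

Notation eM := (eL (eL eN)).
Notation eS := (eP (eL eN) (eP (eL eN) eM)).
Notation eE := (eP eN (eP eN eN)).
Notation eT := (eL (eP eN eN)).
Notation eC := (eP eN (eP eN (eL eN))).
Notation eR := (eP eN (eL eN)).

Lemma size_enc_mem (A : eqType) (ea : A -> data) a s :
  a \in s -> data_size (ea a) < data_size (eL ea s).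
Proof. by move/occursP; apply: size_enc_occurs. Qed.

Lemma leq_sum_uniq (A : eqType) (f : A -> nat) (s t : seq A) :
  uniq s -> {subset s <= t} -> \sum_(x <- s) f x <= \sum_(x <- t) f x.
Proof.
elim: s t => [|a s IH] t /=; first by rewrite big_nil.
case/andP=> as_ us sub; have at_ : a \in t by apply: sub; rewrite mem_head.
rewrite big_cons [X in _ <= X](big_rem a) //= leq_add2l; apply: IH => // x xs.
have := sub x (mem_behead (s := a :: s) xs).
rewrite (perm_mem (perm_to_rem at_)) inE => /orP[/eqP E|//].
by rewrite -E xs in as_.
Qed.

Lemma size_enc_sub (A : eqType) (ea : A -> data) (s t : seq A) :
  uniq s -> {subset s <= t} -> data_size (eL ea s) <= data_size (eL ea t).
Proof. by move=> us st; rewrite !size_enc_seq ltnS leq_sum_uniq. Qed.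

Lemma foldl_pick A (r : A -> A -> bool) (a : A) s :
  let x := foldl (fun b e => if r e b then e else b) a s in x = a \/ occurs x s.
Proof.
elim: s a => [|y s IH] a /=; first by left.
have [->|[s1 [s2 E]]] := IH (if r y a then y else a).
  by case: ifP => _; [right; exists [::], s|left].
by right; exists (y :: s1), s2; rewrite {1}E.
Qed.

Lemma occurs_cat A (a : A) s t : occurs a s -> occurs a (s ++ t).
Proof. by case=> s1 [s2 ->]; exists s1, (s2 ++ t); rewrite -catA. Qed.

Lemma PT_ltn (X : ctx) (f g : pt X -> nat) :
  PT eN f -> PT eN g -> PT eB (fun e => f e < g e).
Proof.
move=> pf pg; apply: PT_ext (PT_leq (PT_add pf (PT_cst X 1)) pg) => e _.
by rewrite addn1.
Qed.

Section Pick.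
Variables (X : ctx) (A : Type) (ea : A -> data) (d : A).

Lemma PT_pick (es : pt X -> seq A) (a : pt X -> A) (r : A -> A -> bool) :
  PT (eL ea) es -> PT ea a ->
  (forall (Z : ctx) (x y : pt Z -> A), PT ea x -> PT ea y -> PT eB (fun z => r (x z) (y z))) ->
  PT ea (fun e => foldl (fun b e => if r e b then e else b) (a e) (es e)).
Proof.
move=> pe pa pr.
apply: (PT_foldl d (f := fun _ b e => if r e b then e else b)
  (pbndD (PT_size pe) (PT_size pa)) _ pe pa) => [e s1 s2 de E|Z p b x wk dz pb px].
  have [->|oc] := foldl_pick r (a e) s1; first by rewrite leq_addl.
  apply: leq_trans (leq_addr _ _); apply/ltnW/size_enc_occurs.
  by rewrite E; apply: occurs_cat.
by apply: PT_if => //; apply: pr.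
Qed.
End Pick.

Section Funs.
Variable X : ctx.

Lemma PT_emin (es : pt X -> seq event) : PT (eL eE) es -> PT eE (fun e => emin (es e)).
Proof.
move=> pe; pose d : event := (0, (0, 0)).
have pd : PT eE (fun _ : pt X => d) by do 2?apply: PT_pair; apply: PT_cst.
apply: (PT_pick d (r := fun e b => e.1 < b.1) pe (PT_head pe pd)).
by move=> Z x y px py; apply: PT_ltn (PT_fst px) (PT_fst py).
Qed.

Lemma PT_events (st : pt X -> state) : PT eS st -> PT (eL eE) (fun e => events (st e)).
Proof.
move=> ps; have pA := PT_fst ps; have pl := PT_fst (PT_snd ps).
have pc := PT_snd (PT_snd ps); have d : event := (0, (0, 0)).
apply: (PT_cat d).
  apply: (PT_map 0 pA) => Z p a wk dz pa.
  by apply: PT_pair (PT_nth (wk _ _ _ pl) (PT_cst Z 0) pa) (PT_pair pa pa).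
apply: (PT_flatten d); apply: (PT_map 0 pA) => Z p v wk dz pv.
apply: (PT_map 0).
  apply: (PT_filter 0).
    by apply: PT_cons (PT_cst Z 0) (wk _ _ _ pA).
  move=> W q u wk2 dw pu; apply: PT_not; apply: PT_eqn pu (wk2 _ _ _ pv).
move=> W q u wk2 dw pu.
apply: PT_pair (PT_pair (wk2 _ _ _ pv) pu).
exact: PT_mget (wk2 _ _ _ (wk _ _ _ pc)) pu (wk2 _ _ _ pv).
Qed.

Lemma PT_shrink (lab : pt X -> seq nat) (th : pt X -> nat) (cm : pt X -> seq (seq nat)) :
  PT (eL eN) lab -> PT eN th -> PT eM cm -> PT eM (fun e => shrink (lab e) (th e) (cm e)).
Proof.
move=> pl pt pc; apply: (PT_tab pl) => Z p u v wk dz pu pv.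
exact: PT_sub (PT_mget (wk _ _ _ pc) pu pv) (wk _ _ _ pt).
Qed.

Lemma PT_bypass (lab : pt X -> seq nat) (v : pt X -> nat) (cm : pt X -> seq (seq nat)) :
  PT (eL eN) lab -> PT eN v -> PT eM cm -> PT eM (fun e => bypass (lab e) (v e) (cm e)).
Proof.
move=> pl pv pc; apply: (PT_tab pl) => Z p x w wk dz px pw.
have pc' := wk _ _ _ pc; have pv' := wk _ _ _ pv.
apply: PT_minn (PT_mget pc' px pw) _.
exact: PT_add (PT_mget pc' px pv') (PT_mget pc' pv' pw).
Qed.

Lemma PT_new_pot (lab : pt X -> seq nat) (ev : pt X -> event) (pl : pt X -> seq nat) :
  PT (eL eN) lab -> PT eE ev -> PT (eL eN) pl ->
  PT (eL eN) (fun e => new_pot (lab e) (ev e) (pl e)).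
Proof.
move=> plab pe ppl; apply: (PT_map 0 plab) => Z p x wk dz px.
have pth := wk _ _ _ (PT_fst pe); have pv := wk _ _ _ (PT_fst (PT_snd pe)).
have pu := wk _ _ _ (PT_snd (PT_snd pe)); have pl' := wk _ _ _ ppl.
have p0 : PT eN (fun _ : pt Z => 0) by apply: PT_cst.
apply: (PT_add (PT_sub (PT_nth pl' p0 px) pth)).
apply: (PT_if (PT_and (PT_eqn px pu) (PT_not (PT_eqn pu pv))) _ p0).
exact: PT_sub (PT_nth pl' p0 pv) pth.
Qed.

Variables (lab : pt X -> seq nat) (st : pt X -> state).
Hypothesis plab : PT (eL eN) lab.
Hypothesis pst : PT eS st.

Let pev := PT_emin (PT_events pst).

Lemma PT_advance : PT eS (fun e => advance (lab e) (st e)).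
Proof.
apply: PT_pair; last apply: PT_pair.
- apply: (PT_filter 0 (PT_fst pst)) => Z p x wk dz px.
  exact: PT_not (PT_eqn px (wk _ _ _ (PT_fst (PT_snd pev)))).
- exact: PT_new_pot plab pev (PT_fst (PT_snd pst)).
apply: PT_bypass plab (PT_fst (PT_snd pev)) _.
exact: PT_shrink plab (PT_fst pev) (PT_snd (PT_snd pst)).
Qed.

Lemma PT_entry_of : PT (eP eM (eP eN eN)) (fun e => entry_of (lab e) (st e)).
Proof.
apply: PT_pair (PT_snd pev).
exact: PT_shrink plab (PT_fst pev) (PT_snd (PT_snd pst)).
Qed.
End Funs.

Section Lift.
Variable X : ctx.

Lemma PT_unzip1 (T : pt X -> seq (nat * nat)) : PT eT T -> PT (eL eN) (fun e => unzip1 (T e)).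
Proof. by move=> pT; apply: (PT_map (0, 0) pT) => Z p a wk dz pa; apply: PT_fst pa. Qed.

Lemma reroute_size c v T :
  data_size (eT (foldr (reroute c v) [::] T)) <= data_size (eT T) * (2 * data_size (eN v) + 20).
Proof.
elim: T => [|wx T IH].
  by rewrite (_ : data_size (eT [::]) = 1) // mul1n; lia.
rewrite /= -/(data_size (eT T)) in IH *; set acc := foldr _ _ _ in IH *.
set s := data_size (eT T) in IH *; set k := bitlen v in IH *.
set a := bitlen wx.1; set b := bitlen wx.2; rewrite /reroute.
have H : a + b + 2 * k + 6 <= (a + b + 2) * (2 * k + 20).
  have := leq_addl (2 * k) 20; nia.
have E : (a + b + 2 + s) * (2 * k + 20) = (a + b + 2) * (2 * k + 20) + s * (2 * k + 20).
  by rewrite mulnDl.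
have -> : ((a + b).+1 + s).+1 = a + b + 2 + s by lia.
rewrite E; case: ifP => _ /=; last case: ifP => _ /=; rewrite -/(data_size (eT acc)) -/k -/a -/b.
- by apply: leq_trans (leq_add H IH); lia.
- by apply: leq_trans (leq_add H IH); lia.
by apply: leq_trans (leq_add H IH); lia.
Qed.

Lemma PT_lift (en : pt X -> entry) (T : pt X -> seq (nat * nat)) :
  PT (eP eM (eP eN eN)) en -> PT eT T -> PT eT (fun e => lift_tree (en e) (T e)).
Proof.
move=> pen pT; have pc := PT_fst pen; have pv := PT_fst (PT_snd pen).
have pu := PT_snd (PT_snd pen).
have pF : PT eT (fun e => foldr (reroute (mget (en e).1) (en e).2.1) [::] (T e)).
  apply: (PT_foldr (0, 0) (f := fun e => reroute (mget (en e).1) (en e).2.1)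
     (bd := fun e => data_size (eT (T e)) * (2 * data_size (eN (en e).2.1) + 20)) _ _ pT (PT_nil X _)).
  - apply: pbndM (PT_size pT) (pbndD (pbndM (@pbnd_const X 2) (PT_size pv)) (@pbnd_const X 20)).
  - move=> e s1 s2 de E; apply: leq_trans (reroute_size _ _ _) _.
    by rewrite E leq_mul2r size_enc_suffix orbT.
  move=> Z p b a wk dz pb pa.
  have pv' := wk _ _ _ pv; have pc' := wk _ _ _ pc.
  have px := PT_snd pa; have pw := PT_fst pa.
  apply: PT_if; first apply: (PT_leq (PT_mget pc' px pw)).
  - exact: PT_add (PT_mget pc' px pv') (PT_mget pc' pv' pw).
  - exact: PT_cons.
  apply: PT_if; first apply: (fun h => PT_mem h pv').
  - by apply: (PT_map (0, 0) pb) => W q x wk2 dw px'; apply: PT_fst px'.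
  - exact: PT_cons (PT_pair pw pv') pb.
  exact: PT_cons (PT_pair pw pv') (PT_cons (PT_pair pv' px) pb).
have puz := PT_unzip1 pF; apply: PT_if; last exact: pF.
  apply: PT_and; last exact: PT_not (PT_mem puz pv).
  apply: PT_and; first exact: PT_not (PT_eqn pu pv).
  exact: PT_or (PT_eqn pu (PT_cst X 0)) (PT_mem puz pu).
exact: PT_cons (PT_pair pv pu) pF.
Qed.
End Lift.

(** * Trees for one multiplier: sizes and computation *)

Definition start_state (lab A0 : seq nat) (cm : seq (seq nat)) (lam : nat) : state :=
  (A0, ([seq lam | _ <- lab], cm)).

Definition cand_of lab A0 cm lam : cand :=
  let T := solve lab (size A0) (start_state lab A0 cm lam) in
  (tcost (mget cm) T, (size A0 - size T, tour_of T)).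

Section Iterate.
Variables (N : nat) (st : state).
Let lab := iota 0 N.
Hypothesis ok : state_ok N st.
Let it i := iter i (advance lab) st.

Lemma iter_advance_ok i : i <= size st.1 ->
  [/\ state_ok N (it i), size (it i).1 = size st.1 - i & {subset (it i).1 <= st.1}].
Proof.
elim: i => [|i IH] li; first by split; rewrite ?subn0.
have [h1 h2 h3] := IH (ltnW li); have A0 : (it i).1 != [::].
  by apply: contraTneq li => E; rewrite E /= in h2; lia.
have h4 := advance_ok A0 h1; rewrite /it iterS -/(it i).
have sub : {subset (advance lab (it i)).1 <= (it i).1}.
  by move=> x; rewrite mem_filter => /andP[].
split=> //; last by move=> x /sub/h3.
case: h1 => uA _ _ _; have [vA _ _ _ _] := event_spec A0.
have E := perm_size (permA uA vA); rewrite h2 /= in E.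
by rewrite subnS E.
Qed.

Lemma iter_advance_le i x w : mget (it i).2.2 x w <= mget st.2.2 x w.
Proof.
elim: i => // i IH; rewrite /it iterS -/(it i) /= /bypass mget_tabE; case: ifP => // h.
by apply: leq_trans (geq_minl _ _) _; rewrite /shrink mget_tabE h; apply: leq_trans (leq_subr _ _) IH.
Qed.

(* Potentials may double at each event, so that their bit length stays linear. *)
Lemma iter_pot_le i x B : (forall y, nth 0 st.2.1 y <= B) -> nth 0 (it i).2.1 x <= 2 ^ i * B.
Proof.
move=> hB; elim: i x => [|i IH] x; first by rewrite mul1n.
rewrite /it iterS -/(it i) /= /new_pot.
case: (ltnP x N) => xN; last by rewrite nth_default // size_map size_iota.
rewrite (nth_map 0) ?size_iota // nth_iota // add0n expnS.
have := IH x; have := IH (emin (events (it i))).2.1.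
by case: ifP => _; lia.
Qed.

(** After any event, costs and potentials are tables over [lab], so that a bound on their entries
    bounds their encoded sizes. *)
Lemma iter_shape i : exists cm pl,
  ((it i).2.2 = st.2.2 \/ (it i).2.2 = tab lab cm) /\
  ((it i).2.1 = st.2.1 \/ (it i).2.1 = [seq pl x | x <- lab]).
Proof.
case: i => [|i]; first by exists (fun _ _ => 0), (fun _ => 0); split; left.
by do 2!eexists; split; right; rewrite /it iterS.
Qed.
End Iterate.

Lemma bitlen_mget cm x w : bitlen (mget cm x w) <= data_size (eM cm).
Proof.
rewrite /mget; case: (ltnP x (size cm)) => hx; last first.
  by rewrite (nth_default [::]) // nth_nil data_size_gt0.
have /(size_enc_mem (eL eN)) := mem_nth [::] hx; move: (nth [::] cm x) => s hs.
case: (ltnP w (size s)) => hw; last by rewrite nth_default // data_size_gt0.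
by have h := size_enc_mem eN (mem_nth 0 hw); exact: (leq_trans (ltnW h) (ltnW hs)).
Qed.

Lemma size_enc_map (A : eqType) B (eb : B -> data) (f : A -> B) s b :
  (forall a, a \in s -> data_size (eb (f a)) <= b) ->
  data_size (eL eb (map f s)) <= size s * b.+1 + 1.
Proof.
elim: s => // a s IH H; have h := H a (mem_head _ _).
have {}IH := IH (fun x xs => H x (mem_behead (s := a :: s) xs)).
have -> : data_size (eL eb (map f (a :: s))) =
  data_size (eb (f a)) + data_size (eL eb (map f s)) + 1 by rewrite addn1.
rewrite (_ : size (a :: s) = (size s).+1) // mulSn.
move: h IH; move: (data_size (eb (f a))) (data_size (eL eb (map f s))) (size s * _) => p q r; lia.
Qed.

Lemma state_size N (st : state) i : state_ok N st -> i <= size st.1 ->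
  let k := data_size (eS st) + N in
  data_size (eS (iter i (advance (iota 0 N)) st)) <= 10 * (k + 1) * (k + 1) * (k + 1).
Proof.
move=> ok li; set k := data_size _ + N; cbv zeta; set s := iter _ _ _.
have [_ _ sub] := iter_advance_ok ok li; rewrite -/s in sub.
have [[uA _ subA _] sz _] := iter_advance_ok ok li; rewrite -/s in uA sz.
have [cm [pl [hc hp]]] := iter_shape N st i; rewrite -/s in hc hp.
have iN : i <= N.
  apply: leq_trans li _; case: ok => u0 n0 sub0 _.
  have := uniq_leq_size u0 (_ : {subset st.1 <= iota 0 N}); rewrite size_iota; apply.
  by move=> x xs; apply: sub0; rewrite inE xs orbT.
have dk : data_size (eS st) = (data_size (eL eN st.1) + (data_size (eL eN st.2.1) + data_size (eM st.2.2)).+1).+1 by [].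
have -> : data_size (eS s) = (data_size (eL eN s.1) + (data_size (eL eN s.2.1) + data_size (eM s.2.2)).+1).+1 by [].
have hA : data_size (eL eN s.1) <= data_size (eL eN st.1) by apply: size_enc_sub.
have hC : data_size (eM s.2.2) <= N * (N * k.+1 + 1).+1 + 1 + k.
  case: hc => E; first by rewrite E /k dk; lia.
  rewrite E /tab; apply: leq_trans (leq_addr _ _).
  apply: leq_trans (size_enc_map (b := N * k.+1 + 1) _) _; last by rewrite size_iota.
  move=> x xN; apply: leq_trans (size_enc_map (b := k) _) _; last by rewrite size_iota.
  move=> w wN; rewrite !mem_iota in xN wN.
  have <- : mget s.2.2 x w = cm x w by rewrite E mget_tab.
  apply: leq_trans (bitlen_le2 (iter_advance_le N st i x w)) _.
  by apply: leq_trans (bitlen_mget _ _ _) _; rewrite /k dk; lia.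
have hP : data_size (eL eN s.2.1) <= N * (N + k).+3 + 1 + k.
  case: hp => E; first by rewrite E /k dk; lia.
  rewrite E; apply: leq_trans (leq_addr _ _).
  apply: leq_trans (size_enc_map (b := (N + k).+2) _) _; last by rewrite size_iota.
  move=> x; rewrite mem_iota => /andP[_ xN].
  have <- : nth 0 s.2.1 x = pl x by rewrite E (nth_map 0) ?size_iota // nth_iota.
  have hB y : nth 0 st.2.1 y <= 2 ^ data_size (eL eN st.2.1).
    case: (ltnP y (size st.2.1)) => hy; last by rewrite nth_default.
    apply: leq_trans (ltnW (bitlen_lt _)) _; rewrite leq_exp2l //.
    by have := size_enc_mem eN (mem_nth 0 hy) => /ltnW.
  have := iter_pot_le N i x hB; rewrite -/s -expnD => h.
  apply: (@leq_trans (i + data_size (eL eN st.2.1)).+2).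
    by rewrite /=; apply: bitlen_leP; apply: leq_ltn_trans h _; rewrite ltn_exp2l.
  by rewrite !ltnS leq_add // /k dk; lia.
have kN : N <= k by rewrite /k leq_addl.
have kA : data_size (eL eN st.1) <= k by rewrite /k dk; lia.
move: hA hC hP; move: (data_size (eL eN s.1)) (data_size (eL eN s.2.1)) (data_size (eM s.2.2)).
move=> a b c; nia.
Qed.

Lemma filter_iota_lt N i : i <= N -> [seq x <- iota 0 N | x < i] = iota 0 i.
Proof.
move=> iN; rewrite -{1}(subnKC iN) iotaD filter_cat add0n.
rewrite (@eq_in_filter _ _ predT) => [|x]; last by rewrite mem_iota.
rewrite filter_predT (@eq_in_filter _ _ pred0) => [|x]; last first.
  by rewrite mem_iota => /andP[h _]; rewrite ltnNge h.
by rewrite filter_pred0 cats0.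
Qed.

(** The recursion descends through states and then lifts trees back. As a fold it recomputes the
    [i]-th state from the initial one, so no stack of states is kept. *)
Lemma solve_foldr lab k st j :
  solve lab k (iter j (advance lab) st) =
  foldr (fun i T => lift_tree (entry_of lab (iter i (advance lab) st)) T) [::] (iota j k).
Proof. by elim: k j => //= k IH j; rewrite -IH. Qed.

Lemma tree_size A T : tree_on A T -> data_size (eT T) <=
  data_size (eL eN A) * (2 * data_size (eL eN A) + 2) + 1.
Proof.
move=> tT; have [uT sT pT] := tT.
have szT : size T <= size A by rewrite -(size_map fst T); apply: uniq_leq_size.
apply: leq_trans (size_enc_le (b := 2 * data_size (eL eN A) + 1) _) _.
  move=> s1 e s2 E; have eT' : e \in T by rewrite E mem_cat mem_head orbT.
  have /andP[/(size_enc_mem eN) h1 h2] := parents_in tT eT'.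
  have h3 : data_size (eN e.2) <= data_size (eL eN A).
    move: h2; rewrite inE => /orP[/eqP->|/(size_enc_mem eN)/ltnW //].
    exact: data_size_gt0.
  have -> : data_size (eP eN eN e) = data_size (eN e.1) + data_size (eN e.2) + 1 by rewrite addn1.
  by rewrite leq_add2r mul2n -addnn leq_add // ltnW.
rewrite leq_add2r -addnS leq_mul2r; apply/orP; right.
exact: leq_trans szT (leq_size_enc eN A).
Qed.

Lemma PT_iter_advance (X : ctx) (lab : pt X -> seq nat) (st : pt X -> state) (i : pt X -> nat) :
  (forall e : pt X, dom e -> exists N,
     [/\ lab e = iota 0 N, state_ok N (st e) & i e <= size (st e).1]) ->
  PT (eL eN) lab -> PT eS st -> PT eN i ->
  PT eS (fun e => iter (i e) (advance (lab e)) (st e)).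
Proof.
move=> ok pl ps pi.
(* A list of length [i e]: the number of rounds in unary. *)
pose l (e : pt X) := [seq x <- lab e | x < i e].
have pll : PT (eL eN) l.
  apply: (PT_filter 0 pl) => Z p a wk dz pa; exact: PT_ltn pa (wk _ _ _ pi).
have iN (e : pt X) : dom e -> size (l e) = i e.
  move=> /ok[N [E oke li]]; rewrite /l E filter_iota_lt ?size_iota //.
  apply: leq_trans li _; case: oke => u0 n0 sub0 _.
  have := uniq_leq_size u0 (_ : {subset (st e).1 <= iota 0 N}); rewrite size_iota; apply.
  by move=> x xs; apply: sub0; rewrite inE xs orbT.
pose bd (e : pt X) := 10 * (data_size (eS (st e)) + data_size (eL eN (lab e)) + 1) *
   (data_size (eS (st e)) + data_size (eL eN (lab e)) + 1) *
   (data_size (eS (st e)) + data_size (eL eN (lab e)) + 1).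
apply: PT_ext (PT_iter 0 (f := fun e => advance (lab e)) (bd := bd) _ _ pll ps _).
- by move=> e de; rewrite iN.
- have h : pbnd (fun e : pt X => data_size (eS (st e)) + data_size (eL eN (lab e)) + 1).
    by apply: pbndD (@pbnd_const X 1); apply: pbndD; [apply: PT_size ps|apply: PT_size pl].
  by do 3?apply: pbndM => //; apply: pbnd_const.
- move=> e j de lj; have [N [E oke li]] := ok e de; rewrite iN // in lj.
  have := state_size oke (leq_trans lj li); rewrite -E => h; apply: leq_trans h _.
  have h : N <= data_size (eL eN (lab e)).
    by rewrite -{1}[N](size_iota 0) -E; apply: leq_size_enc.
  have hh : data_size (eS (st e)) + N + 1 <= data_size (eS (st e)) + data_size (eL eN (lab e)) + 1.
    by rewrite leq_add2r leq_add2l.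
  by rewrite /bd; do 3!apply: leq_mul => //.
move=> Z p b wk dz pb; apply: PT_advance pb; exact: wk pl.
Qed.

Section Solve.
Variable X : ctx.
Variables (lab A0 : pt X -> seq nat) (cm : pt X -> seq (seq nat)) (lam : pt X -> nat).
Hypothesis ok : forall e : pt X, dom e -> exists N,
  lab e = iota 0 N /\ state_ok N (start_state (lab e) (A0 e) (cm e) (lam e)).
Hypothesis plab : PT (eL eN) lab.
Hypothesis pA : PT (eL eN) A0.
Hypothesis pcm : PT eM cm.
Hypothesis plam : PT eN lam.

Lemma PT_start : PT eS (fun e => start_state (lab e) (A0 e) (cm e) (lam e)).
Proof.
apply: PT_pair pA (PT_pair _ pcm); apply: (PT_map 0 plab) => Z p a wk dz pa.
exact: wk plam.
Qed.

Let T e := solve (lab e) (size (A0 e)) (start_state (lab e) (A0 e) (cm e) (lam e)).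

Lemma solve_tree (e : pt X) : dom e -> tree_on (A0 e) (T e).
Proof.
move=> /ok[N [E oke]]; rewrite /T E.
rewrite E in oke.
by have [] := @solve_bound N rat (size (A0 e)) (start_state (iota 0 N) (A0 e) (cm e) (lam e)) erefl oke.
Qed.

Lemma PT_solve : PT eT T.
Proof.
pose st0 e := start_state (lab e) (A0 e) (cm e) (lam e).
pose bd (e : pt X) := data_size (eL eN (A0 e)) * (2 * data_size (eL eN (A0 e)) + 2) + 1.
apply: PT_ext (PT_foldr 0
  (f := fun e i T => lift_tree (entry_of (lab e) (iter i (advance (lab e)) (st0 e))) T)
  (bd := bd) _ _ (PT_iota 0 pA) (PT_nil X _) _).
- by move=> e _; rewrite /T -(solve_foldr (lab e) (size (A0 e)) (st0 e) 0).
- apply: pbndD (@pbnd_const X 1); apply: pbndM (PT_size pA) _.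
  exact: pbndD (pbndM (@pbnd_const X 2) (PT_size pA)) (@pbnd_const X 2).
- move=> e s1 s2 de E.
  have [N [EN oke]] := ok de.
  have Es : s2 = iota (size s1) (size s2).
    have szE : size (A0 e) = size s1 + size s2 by rewrite -size_cat -E size_iota.
    by move: E; rewrite szE iotaD add0n => /eqP; rewrite eqseq_cat ?size_iota // => /andP[_ /eqP].
  have li : size s1 <= size (A0 e).
    by rewrite -(size_iota 0 (size (A0 e))) E size_cat leq_addr.
  rewrite Es -solve_foldr EN; rewrite EN in oke.
  have [ok' sz' sub'] := iter_advance_ok oke li.
  rewrite /st0 EN; set st1 := iter _ _ _ in ok' sz' sub' *.
  have szs : size st1.1 = size s2.
    by rewrite sz' /= -(size_iota 0 (size (A0 e))) E size_cat addKn.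
  rewrite -szs.
  have [tT _] := @solve_bound N rat (size st1.1) st1 erefl ok'.
  have hs : data_size (eL eN st1.1) <= data_size (eL eN (A0 e)).
    by apply: size_enc_sub => //; case: ok'.
  apply: leq_trans (tree_size tT) _; rewrite /bd leq_add2r leq_mul // leq_add2r leq_mul2l hs.
  by rewrite orbT.
move=> Z p b a wk dz pb pa.
apply: PT_lift pb; apply: PT_entry_of; first exact: wk plab.
apply: PT_iter_advance; [|exact: wk plab|exact: wk PT_start|exact: pa].
move=> z /dz[dp [s1 [s2 [E _]]]]; have [N [EN oke]] := ok dp; exists N; split=> //.
have : a z \in iota 0 (size (A0 (p z))) by rewrite E mem_cat mem_head orbT.
by rewrite mem_iota /= => /ltnW.
Qed.

End Solve.

(** * Computing tours and candidates *)

Lemma foldr_ins_size x w tr :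
  data_size (eL eN (foldr (fun a acc => if a == x then a :: w :: acc else a :: acc) [::] tr)) <=
  data_size (eL eN tr) * (data_size (eN w) + 2).
Proof.
elim: tr => [|a tr IH]; first by rewrite (_ : data_size (eL eN [::]) = 1) // mul1n; lia.
set k := data_size (eN w) in IH *.
have -> : data_size (eL eN (a :: tr)) = data_size (eN a) + data_size (eL eN tr) + 1 by rewrite addn1.
rewrite [foldr _ _ _]/=; set t := foldr _ _ _ in IH *.
have ha : data_size (eN a) + k + 2 <= (data_size (eN a) + 1) * (k + 2).
  by have := data_size_gt0 (eN a); nia.
have E : (data_size (eN a) + data_size (eL eN tr) + 1) * (k + 2) =
  (data_size (eN a) + 1) * (k + 2) + data_size (eL eN tr) * (k + 2) by rewrite -mulnDl; congr (_ * _); lia.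
rewrite E; apply: leq_trans (leq_add ha IH).
have h1 : data_size (eL eN (a :: t)) = data_size (eN a) + data_size (eL eN t) + 1 by rewrite addn1.
have h2 : data_size (eL eN (a :: w :: t)) = data_size (eN a) + (k + data_size (eL eN t) + 1) + 1.
  by rewrite !addn1.
by case: ifP => _; rewrite ?h1 ?h2; lia.
Qed.

Section Tours.
Variable X : ctx.

Lemma PT_ins (x w : pt X -> nat) (tr : pt X -> seq nat) :
  PT eN x -> PT eN w -> PT (eL eN) tr -> PT (eL eN) (fun e => ins (x e) (w e) (tr e)).
Proof.
move=> px pw pt_; apply: (PT_if (PT_eqn px (PT_cst X 0)) (PT_cons pw pt_)).
apply: (PT_foldr 0 (f := fun e a acc => if a == x e then a :: w e :: acc else a :: acc)
  (pbndM (PT_size pt_) (pbndD (PT_size pw) (@pbnd_const X 2))) _ pt_ (PT_nil X _)).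
  move=> e s1 s2 de E; apply: leq_trans (foldr_ins_size _ _ _) _.
  by rewrite E leq_mul2r size_enc_suffix orbT.
move=> Z p b a wk dz pb pa.
apply: (PT_if (PT_eqn pa (wk _ _ _ px)) _ (PT_cons pa pb)).
exact: PT_cons pa (PT_cons (wk _ _ _ pw) pb).
Qed.
End Tours.

Section Cands.
Variable X : ctx.

Lemma PT_tour_of (T : pt X -> seq (nat * nat)) :
  (forall e : pt X, dom e -> exists A, tree_on A (T e)) ->
  PT eT T -> PT (eL eN) (fun e => tour_of (T e)).
Proof.
move=> tT pT.
have szu := PT_size (PT_unzip1 pT).
apply: (PT_foldr (0, 0) (f := fun e a tr => ins a.2 a.1 tr) szu _ pT (PT_nil X _)).
  move=> e s1 s2 de E; have [A [uT _ pT']] := tT e de.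
  have tree2 : tree_on (unzip1 s2) s2.
    rewrite E in uT pT'; split=> //.
      by move: uT; rewrite /unzip1 map_cat cat_uniq => /and3P[].
    by elim: (s1) pT' => //= a s IH /andP[_ /IH].
  have m0 : metric (fun _ _ => 0) by split.
  have [pe _] := tour_of_spec m0 tree2.
  apply: leq_trans (size_enc_sub eN (t := unzip1 s2) _ _) _.
  - by rewrite (perm_uniq pe); case: tree2.
  - by move=> x; rewrite (perm_mem pe).
  by rewrite E /unzip1 map_cat size_enc_suffix.
move=> Z p b a wk dz pb pa; exact: PT_ins (PT_snd pa) (PT_fst pa) pb.
Qed.

Lemma PT_tcost (cm : pt X -> seq (seq nat)) (T : pt X -> seq (nat * nat)) :
  PT eM cm -> PT eT T -> PT eN (fun e => tcost (mget (cm e)) (T e)).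
Proof.
move=> pc pT; apply: PT_sumn; apply: (PT_map (0, 0) pT) => Z p a wk dz pa.
exact: PT_mget (wk _ _ _ pc) (PT_snd pa) (PT_fst pa).
Qed.

Variables (lab A0 : pt X -> seq nat) (cm : pt X -> seq (seq nat)) (lam : pt X -> nat).
Hypothesis ok : forall e : pt X, dom e -> exists N,
  lab e = iota 0 N /\ state_ok N (start_state (lab e) (A0 e) (cm e) (lam e)).
Hypothesis plab : PT (eL eN) lab.
Hypothesis pA : PT (eL eN) A0.
Hypothesis pcm : PT eM cm.
Hypothesis plam : PT eN lam.

Lemma PT_cand : PT eC (fun e => cand_of (lab e) (A0 e) (cm e) (lam e)).
Proof.
have pT := PT_solve ok plab pA pcm plam.
apply: PT_pair (PT_tcost pcm pT) (PT_pair _ _).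
  exact: PT_sub (PT_length 0 pA) (PT_length (0, 0) pT).
apply: PT_tour_of pT => e de; exists (A0 e); exact: solve_tree de.
Qed.
End Cands.

(* Multipliers grow by a factor at most 9/8, and double every 16 steps. *)
Definition lam_next (l : nat) : nat := l + l %/ 8.
Definition lamk (i : nat) : nat := iter i lam_next 8.

Lemma lamk_ge8 i : 8 <= lamk i.
Proof. by elim: i => // i IH; rewrite /lamk iterS -/(lamk i) /lam_next; lia. Qed.

Lemma lamkS_le i : 8 * lamk i.+1 <= 9 * lamk i.
Proof.
rewrite /lamk iterS -/(lamk i) /lam_next; have := leq_trunc_div (lamk i) 8; lia.
Qed.

(** From 8 on, [l %/ 8] is at least [l / 16], so each of the 16 steps adds at least a sixteenth of
    the starting value. *)
Lemma lamk_double i : 2 * lamk i <= lamk (16 + i).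
Proof.
suff H j : (16 + j) * lamk i <= 16 * lamk (j + i) by have := H 16; lia.
elim: j => [|j IH]; first by rewrite addn0.
rewrite addSn /lamk iterS -/(lamk (j + i)) -/(lamk i) /lam_next.
have h8 := lamk_ge8 (j + i).
have : lamk (j + i) <= 16 * (lamk (j + i) %/ 8).
  have := ltn_ceil (lamk (j + i)) (isT : 0 < 8).
  have : 0 < lamk (j + i) %/ 8 by rewrite divn_gt0.
  lia.
have : lamk i <= lamk (j + i).
  by elim: (j) => // j' IH'; rewrite addSn /lamk iterS -/(lamk _) /lam_next; apply: leq_trans IH' (leq_addr _ _).
nia.
Qed.

Lemma lamk_large m : 2 ^ m <= lamk (16 * m).
Proof.
elim: m => // m IH; rewrite mulnS expnS.
by apply: leq_trans (lamk_double _); rewrite leq_mul2l.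
Qed.

Lemma lamk_le i : lamk i <= 8 * 2 ^ i.
Proof.
elim: i => // i IH; rewrite /lamk iterS -/(lamk i) /lam_next expnS.
have := leq_div (lamk i) 8; lia.
Qed.

Definition lam_step (ls : seq nat) : seq nat := lam_next (head 0 ls) :: ls.

Lemma iter_lam_step i : iter i lam_step [:: 8] = [seq lamk j | j <- rev (iota 0 i.+1)].
Proof.
have revS m : rev (iota 0 m.+1) = m :: rev (iota 0 m) by rewrite -addn1 iotaD rev_cat.
by elim: i => // i IH; rewrite iterS IH revS [in RHS]revS [in RHS]revS.
Qed.

(** * Quality of the candidate for one multiplier *)

Section CandFacts.
Variables (n : nat) (c : nat -> nat -> nat) (cm : seq (seq nat)).
Let lab := iota 0 n.+1.
Let A0 := iota 1 n.
Hypothesis mc : metric c.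
Hypothesis cmE : forall u v, u <= n -> v <= n -> mget cm u v = c u v.
Hypothesis cm_sym : forall u v, mget cm u v = mget cm v u.

Lemma start_ok lam : state_ok n.+1 (start_state lab A0 cm lam).
Proof.
split; [exact: iota_uniq|by rewrite mem_iota| |exact: cm_sym].
by move=> x; rewrite inE !mem_iota => /orP[/eqP->//|]; lia.
Qed.

Lemma wlen_cm u s : u <= n -> {subset s <= lab} -> wlen (mget cm) u s = wlen c u s.
Proof.
elim: s u => //= v s IH u un sub.
have vn : v <= n by have := sub v (mem_head _ _); rewrite mem_iota.
by rewrite cmE // IH // => x xs; apply: sub; rewrite inE xs orbT.
Qed.

Lemma cand_good lam : good_cand c n (cand_of lab A0 cm lam).
Proof.
have [tT _] := @solve_bound n.+1 rat n (start_state lab A0 cm lam) (size_iota 1 n) (start_ok lam).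
rewrite /cand_of size_iota; set T := solve _ _ _ in tT *.
have [pe cl] := tour_of_spec mc tT.
have tc : tcost (mget cm) T = tcost c T.
  rewrite /tcost; congr sumn; apply/eq_in_map => e eT.
  have /andP[e1 e2] := parents_in tT eT.
  rewrite cmE //; first by move: e2; rewrite inE mem_iota => /orP[/eqP->//|/andP[_]].
  by move: e1; rewrite mem_iota => /andP[_].
have [uT sT _] := tT.
split=> /=; first by rewrite tc.
  rewrite -(size_map fst T) -/(unzip1 T) -(perm_size pe) leq_subRL; last first.
    by rewrite (perm_size pe) -[X in _ <= X](size_iota 1 n); exact: uniq_leq_size.
  rewrite -[X in _ <= X](size_iota 1 n) -(count_predC (mem (tour_of T)) (iota 1 n)).
  apply: leq_add => //; rewrite -size_filter; apply: uniq_leq_size; first by rewrite (perm_uniq pe).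
  by move=> x xt; rewrite mem_filter /= xt /=; apply: sT; rewrite -(perm_mem pe).
by move=> x; rewrite (perm_mem pe) => /sT.
Qed.

Section Bound.
Variable F : realFieldType.
Local Open Scope ring_scope.

Lemma cand_bound lam (K : finType) (z : K -> F) (W : K -> seq nat) (y : nat -> F) :
  (forall k, 0 <= z k) -> (forall k, {subset W k <= lab}) ->
  (forall w, w \in A0 -> y w <= 1) ->
  (forall w, w \in A0 -> y w <= \sum_(k | w \in W k) z k) ->
  ((cand_of lab A0 cm lam).1 + lam * (cand_of lab A0 cm lam).2.1)%:R <=
    \sum_k z k * (wlen c 0 (W k))%:R + lam%:R * \sum_(w <- A0) (1 - y w).
Proof.
move=> z0 WA y1 yz.
have [tT low] := @solve_bound n.+1 F n (start_state lab A0 cm lam) (size_iota 1 n) (start_ok lam).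
have labA : lab = 0%N :: A0 by [].
have nlam w : w \in A0 -> nth 0%N [seq lam | _ <- lab] w = lam.
  by rewrite mem_iota => h; rewrite (nth_map 0%N) ?size_iota //; lia.
have := low K z W y z0 (fun k => _) y1 yz; rewrite -labA => /(_ WA).
rewrite -/lab /=; set T := solve _ _ _ => {}low.
have -> : \sum_k z k * (wlen c 0 (W k))%:R = \sum_k z k * (wlen (mget cm) 0 (W k))%:R.
  by apply: eq_bigr => k _; rewrite wlen_cm.
have -> : lam%:R * \sum_(w <- A0) (1 - y w) =
    \sum_(w <- A0) (nth 0%N [seq lam | _ <- lab] w)%:R * (1 - y w).
  by rewrite mulr_sumr !big_seq; apply: eq_bigr => w /nlam ->.
apply: le_trans low; rewrite ler_nat /cand_of size_iota -/T /= leq_add2l.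
rewrite /pen big_seq_cond (eq_bigr (fun _ => lam)) => [|w /andP[/nlam -> _] //].
rewrite -big_seq_cond big_const_seq iter_addn_0 leq_mul2l; apply/orP; right.
have [uT sT _] := tT.
rewrite leq_subLR -{1}(size_iota 1 n) -(count_predC (mem (unzip1 T)) (iota 1 n)) leq_add2r.
rewrite -(size_map fst T) -size_filter; apply: uniq_leq_size; first by rewrite filter_uniq ?iota_uniq.
by move=> x; rewrite mem_filter => /andP[].
Qed.
End Bound.

(** The walk through consecutive labels uses at most one entry of each row. *)
Lemma wlen_total i k : wlen (mget cm) i (iota i.+1 k) <= sumn (flatten (drop i cm)).
Proof.
elim: k i => [|k IH] i //=; have := IH i.+1.
case: (ltnP i (size cm)) => hi; last first.
  have Z u v : size cm <= u -> mget cm u v = 0 by move=> h; rewrite /mget (nth_default [::]) // nth_nil.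
  have : forall s u, size cm <= u -> (forall x, x \in s -> size cm <= x) -> wlen (mget cm) u s = 0.
    elim=> //= v s IHs u hu hs; rewrite Z // IHs //; first by apply: hs; rewrite mem_head.
    by move=> x xs; apply: hs; rewrite inE xs orbT.
  move=> Wz _; rewrite Z // Wz // => [|x]; first by apply: leqW.
  by rewrite mem_iota => /andP[h _]; exact: (leq_trans hi (ltnW (ltnW h))).
rewrite (drop_nth [::] hi) /= sumn_cat => h; apply: leq_add => //.
rewrite /mget; move: (nth [::] cm i) => s; elim: s (i.+1) => [|a s IHs] [|j] //=; first exact: leq_addr.
by have := IHs j; lia.
Qed.

(** The tree is compared with the single walk through all nodes, taken with weight 1: its length is
    below [lam], the price of one missed node. *)
Lemma cand_spans lam : sumn (flatten cm) < lam -> (cand_of lab A0 cm lam).2.1 = 0.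
Proof.
move=> h.
have A2 (k : 'I_1) : {subset A0 <= lab} by move=> x; rewrite !mem_iota; lia.
have A4 w : w \in A0 -> (1 <= \sum_(k < 1 | w \in A0) 1 :> rat)%R.
  by move=> wA; rewrite big_ord1_cond wA.
have := @cand_bound rat lam 'I_1 (fun _ => 1%R) (fun _ => A0) (fun _ => 1%R)
  (fun _ => ler01) A2 (fun _ _ => lexx _) A4.
rewrite big_ord1 mul1r big1 ?mulr0 ?addr0 => [|w _]; last by rewrite subrr.
rewrite ler_nat => hb; have := leq_trans hb (_ : _ <= sumn (flatten cm)).
rewrite -(wlen_cm (leq0n n)) => [|x]; last by rewrite mem_iota /lab mem_iota; lia.
have := wlen_total 0 n; rewrite drop0 => -> /(_ isT) {}hb.
by case: (_.2.1) hb => // u; rewrite mulnS; lia.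
Qed.
End CandFacts.

Notation eD := (eL (eP eC eR)).

Definition inst (n : nat) (c : nat -> nat -> nat) (cm : seq (seq nat)) : Prop :=
  [/\ metric c, forall u v, u <= n -> v <= n -> mget cm u v = c u v &
      forall u v, mget cm u v = mget cm v u].

Definition lam_count (lab A0 : seq nat) (cm : seq (seq nat)) : nat :=
  find (fun i => (cand_of lab A0 cm (lamk i)).2.1 == 0)
       (iota 0 (16 * bitlen (sumn (flatten cm))).+1).

Definition lams lab A0 cm : seq nat := iter (lam_count lab A0 cm) lam_step [:: 8].

Definition cands lab A0 cm : seq cand := [seq cand_of lab A0 cm l | l <- lams lab A0 cm].

Definition cand0 : cand := (0, (0, [::])).

(** The starting candidate is the empty tour, which misses every node. One round serves the offset
    and [T] further rounds reach the horizon; the head of [cs] belongs to the largest multiplier and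
    spans all nodes. *)
Definition ml_walk lab A0 cm T : seq nat :=
  let cs := cands lab A0 cm in
  dedup [::] (dp (head cand0 cs) cs T.+1 (0, (size A0, [::]))).2.

Section LamCount.
Variables (n : nat) (c : nat -> nat -> nat) (cm : seq (seq nat)).
Hypothesis ic : inst n c cm.
Let lab := iota 0 n.+1.
Let A0 := iota 1 n.
Let K := lam_count lab A0 cm.

Lemma lam_has : has (fun i => (cand_of lab A0 cm (lamk i)).2.1 == 0)
       (iota 0 (16 * bitlen (sumn (flatten cm))).+1).
Proof.
case: ic => mc cmE cs; apply/hasP; exists (16 * bitlen (sumn (flatten cm))).
  by rewrite mem_iota ltnSn.
apply/eqP; apply: (cand_spans cmE cs).
exact: leq_trans (bitlen_lt _) (lamk_large _).
Qed.

Lemma lam_count_le : K <= 16 * bitlen (sumn (flatten cm)).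
Proof. by have := lam_has; rewrite has_find size_iota ltnS. Qed.

Lemma lam_count_stop : (cand_of lab A0 cm (lamk K)).2.1 = 0.
Proof.
have := nth_find 0 lam_has; rewrite -/(lam_count lab A0 cm) -/K nth_iota ?ltnS ?lam_count_le //.
by move/eqP.
Qed.

Lemma lam_count_run i : i < K -> (cand_of lab A0 cm (lamk i)).2.1 != 0.
Proof.
move=> iK; have := before_find 0 iK; rewrite nth_iota ?add0n; first by move=> ->.
by rewrite ltnS; apply: leq_trans (ltnW iK) lam_count_le.
Qed.

Lemma head_lams i : head 0 (iter i lam_step [:: 8]) = lamk i.
Proof. by rewrite iter_lam_step -addn1 iotaD rev_cat. Qed.

Lemma candsE : cands lab A0 cm = [seq cand_of lab A0 cm (lamk j) | j <- rev (iota 0 K.+1)].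
Proof. by rewrite /cands /lams iter_lam_step -map_comp. Qed.

Lemma full_cands : head cand0 (cands lab A0 cm) = cand_of lab A0 cm (lamk K).
Proof. by rewrite candsE -addn1 iotaD rev_cat. Qed.
End LamCount.

Lemma lams_size i : data_size (eL eN (iter i lam_step [:: 8])) <= i.+1 * (i + 6) + 1.
Proof.
rewrite iter_lam_step; apply: leq_trans (size_enc_map (b := i + 5) _) _.
  move=> j; rewrite mem_rev mem_iota => /andP[_ ji].
  apply: (@leq_trans (j + 4).+1); last by lia.
  apply: bitlen_leP; apply: leq_ltn_trans (lamk_le j) _.
  by rewrite expnD; have := expn_gt0 2 j; rewrite /=; lia.
by rewrite size_rev size_iota -addnS.
Qed.

Section PTml.
Variable X : ctx.
Variables (lab A0 : pt X -> seq nat) (cm : pt X -> seq (seq nat)).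
Hypothesis ok : forall e : pt X, dom e -> exists n c,
  [/\ lab e = iota 0 n.+1, A0 e = iota 1 n & inst n c (cm e)].
Hypothesis plab : PT (eL eN) lab.
Hypothesis pA : PT (eL eN) A0.
Hypothesis pcm : PT eM cm.

Lemma ok_start e lam : dom e -> exists N,
  lab e = iota 0 N /\ state_ok N (start_state (lab e) (A0 e) (cm e) lam).
Proof.
move=> /ok[n [c [El EA [mc cmE cs]]]]; exists n.+1; split=> //; rewrite El EA.
exact: start_ok.
Qed.

(** The loop state is the list of multipliers so far, and the test recomputes the tree for its head.
    There are linearly many multipliers in the bit length of the costs, each of linear bit
    length. *)
Lemma PT_lams : PT (eL eN) (fun e => lams (lab e) (A0 e) (cm e)).
Proof.
pose K e := lam_count (lab e) (A0 e) (cm e).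
pose P (e : pt X) ls := exists2 i, i <= K e & ls = iter i lam_step [:: 8].
have Kb : pbnd K.
  apply: (pbnd_le (g := fun e => 16 * bitlen (sumn (flatten (cm e))))) => [e de|].
    have [n [c [El EA ic]]] := ok de.
    by rewrite /K El EA; apply: (lam_count_le ic).
  apply: pbndM (@pbnd_const X 16) _; exact: PT_size (PT_sumn (PT_flatten 0 pcm)).
have PTu (Z : ctx) (p : pt Z -> pt X) (l : pt Z -> nat) : weakens p ->
   (forall z : pt Z, dom z -> dom (p z)) -> PT eN l ->
   PT eC (fun z => cand_of (lab (p z)) (A0 (p z)) (cm (p z)) (l z)).
  move=> wk dz pl'; apply: PT_cand; [|exact: wk plab|exact: wk pA|exact: wk pcm|exact: pl'].
  by move=> z /dz; apply: ok_start.
apply: (@PT_while X _ (eL eN) P (fun _ => [:: 8])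
  (fun e ls => (cand_of (lab e) (A0 e) (cm e) (head 0 ls)).2.1 != 0) (fun _ => lam_step) K).
- apply: (@pbnd_le (ext P (eL eN)) (fun z => (K z.1).+1 * (K z.1 + 6) + 1)) => [[e ls] [de [i iK /= ->]]|].
    apply: leq_trans (lams_size i) _; rewrite leq_add2r leq_mul // ?ltnS // leq_add2r //.
  apply: (pbnd_ext P (eL eN) (f := fun e => (K e).+1 * (K e + 6) + 1)).
  apply: pbndD (@pbnd_const X 1); apply: pbndM (pbndS Kb) _.
  exact: pbndD Kb (@pbnd_const X 6).
- exact: Kb.
- exact: PT_cons (PT_cst X 8) (PT_nil X _).
- move=> pv; apply: PT_not; apply: (fun h => PT_eqn h (PT_cst _ 0)).
  apply: (PT_fst (ea := eN) (eb := eL eN)); apply: (PT_snd (ea := eN)).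
  apply: (PTu (ext P (eL eN)) fst (fun z => head 0 z.2)) => [C ec g pg|z [dz _]|]; [exact: PT_weak|exact: dz|].
  exact: PT_head pv (PT_cst _ 0).
- move=> pv; have ph := PT_head pv (PT_cst _ 0).
  exact: PT_cons (PT_add ph (PT_div ph (PT_cst _ 8))) pv.
- by move=> e _; exists 0.
- move=> e ls de [i iK ->]; rewrite head_lams => tst; exists i.+1 => //.
  rewrite ltn_neqAle iK andbT; apply: contraNneq tst => ->.
  have [n [c [El EA ic]]] := ok de; rewrite /K El EA; apply/eqP.
  exact: lam_count_stop ic.
- move=> e de; have [n [c [El EA ic]]] := ok de; rewrite head_lams negbK /K El EA; apply/eqP.
  exact: lam_count_stop ic.
move=> e i de; have [n [c [El EA ic]]] := ok de; rewrite head_lams /K El EA.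
exact: (lam_count_run ic).
Qed.

Lemma PT_cands : PT (eL eC) (fun e => cands (lab e) (A0 e) (cm e)).
Proof.
apply: (PT_map 0 PT_lams) => Z p l wk dz pl.
apply: PT_cand; [|exact: wk plab|exact: wk pA|exact: wk pcm|exact: pl].
by move=> z /dz[dp _]; apply: ok_start.
Qed.
End PTml.

(** * Computing the dynamic program *)

Lemma prepend_size a b p :
  data_size (eR (prepend a b p)) <= data_size (eC a) + data_size (eC b) + data_size (eR p) + 10.
Proof.
rewrite /prepend; set r := b.2.2 ++ p.2; set v := 2 * b.1 * a.2.1 + p.1.
have hr : data_size (eL eN r) <= data_size (eL eN b.2.2) + data_size (eL eN p.2).
  by rewrite -size_enc_cat -/r; lia.
have hv : bitlen v <= 2 + bitlen b.1 + bitlen a.2.1 + bitlen p.1.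
  apply: leq_trans (bitlenD _ _) _; rewrite leq_add2r.
  apply: leq_trans (bitlenM _ _) _; rewrite leq_add2r.
  exact: bitlenM.
rewrite (_ : data_size (eR (v, r)) = (bitlen v + data_size (eL eN r)).+1) //.
rewrite (_ : data_size (eC a) = (bitlen a.1 + (bitlen a.2.1 + data_size (eL eN a.2.2)).+1).+1) //.
rewrite (_ : data_size (eC b) = (bitlen b.1 + (bitlen b.2.1 + data_size (eL eN b.2.2)).+1).+1) //.
rewrite (_ : data_size (eR p) = (bitlen p.1 + data_size (eL eN p.2)).+1) //.
by lia.
Qed.

Lemma base_size full a : data_size (eR (base full a)) <= data_size (eC full) + data_size (eC a) + 10.
Proof.
have hv : bitlen (2 * full.1 * a.2.1) <= 2 + bitlen full.1 + bitlen a.2.1.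
  apply: leq_trans (bitlenM _ _) _; rewrite leq_add2r; exact: bitlenM.
rewrite (_ : data_size (eR (base full a)) =
  (bitlen (2 * full.1 * a.2.1) + data_size (eL eN full.2.2)).+1) //.
rewrite (_ : data_size (eC a) = (bitlen a.1 + (bitlen a.2.1 + data_size (eL eN a.2.2)).+1).+1) //.
rewrite (_ : data_size (eC full) = (bitlen full.1 + (bitlen full.2.1 + data_size (eL eN full.2.2)).+1).+1) //.
by lia.
Qed.

Lemma PT_base (X : ctx) (full a : pt X -> cand) : PT eC full -> PT eC a ->
  PT eR (fun e => base (full e) (a e)).
Proof.
move=> pf pa; apply: PT_pair (PT_snd (PT_snd pf)).
exact: PT_mul (PT_mul (PT_cst X 2) (PT_fst pf)) (PT_fst (PT_snd pa)).
Qed.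

Lemma PT_relax (X : ctx) (full a : pt X -> cand) (S : pt X -> seq (cand * plan)) :
  PT eC full -> PT eC a -> PT eD S -> PT eR (fun e => relax (full e) (S e) (a e)).
Proof.
move=> pf pa pS.
pose bd (e : pt X) := data_size (eC (full e)) + data_size (eC (a e)) + data_size (eD (S e)) + 10.
apply: (PT_foldl (cand0, (0, [::])) (f := fun e best eb => cheaper (prepend (a e) eb.1 eb.2) best)
  (bd := bd) _ _ pS (PT_base pf pa)).
- apply: pbndD (@pbnd_const X 10); apply: pbndD (PT_size pS).
  exact: pbndD (PT_size pf) (PT_size pa).
- move=> e s1 s2 de E; rewrite -/(relax (full e) s1 (a e)).
  apply: (relax_ind (Q := fun p => data_size (eR p) <= bd e)) => [|[b p] bS].
    by apply: leq_trans (base_size _ _) _; rewrite /bd; lia.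
  apply: leq_trans (prepend_size _ _ _) _.
  have : data_size (eP eC eR (b, p)) < data_size (eD (S e)).
    by apply: size_enc_mem; rewrite E mem_cat bS.
  rewrite (_ : data_size (eP eC eR (b, p)) = (data_size (eC b) + data_size (eR p)).+1) // /bd /=.
  by lia.
move=> Z p b x wk dz pb px; have pb1 := PT_fst px; have pa' := wk _ _ _ pa.
have pp : PT eR (fun z => prepend (a (p z)) (x z).1 (x z).2).
  apply: PT_pair.
    apply: PT_add (PT_fst (PT_snd px)).
    exact: PT_mul (PT_mul (PT_cst Z 2) (PT_fst pb1)) (PT_fst (PT_snd pa')).
  exact: (PT_cat 0 (PT_snd (PT_snd pb1)) (PT_snd (PT_snd px))).
exact: PT_if (PT_ltn (PT_fst pp) (PT_fst pb)) pp pb.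
Qed.

Lemma dp_size full cs k a :
  data_size (eR (dp full cs k a)) <=
  data_size (eC full) + data_size (eC a) + 10 + k.+1 * (data_size (eC full) + data_size (eL eC cs)).
Proof.
have hr : data_size (eL eN (dp full cs k a).2) <= k.+1 * (data_size (eC full) + data_size (eL eC cs)).
  elim: k a => [|k IH] a.
    rewrite mul1n; apply: leq_trans (leq_addr _ _).
    rewrite (_ : data_size (eC full) = (bitlen full.1 + (bitlen full.2.1 + data_size (eL eN full.2.2)).+1).+1) //.
    by rewrite (_ : dp full cs 0 a = base full a) //= -/(data_size (eL eN _)); lia.
  apply: (relax_ind (Q := fun p => data_size (eL eN p.2) <=
    k.+2 * (data_size (eC full) + data_size (eL eC cs)))) => [|e].
    rewrite mulSn -addnA; apply: leq_trans (leq_addr _ _).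
    rewrite (_ : data_size (eC full) = (bitlen full.1 + (bitlen full.2.1 + data_size (eL eN full.2.2)).+1).+1) //.
    by rewrite /base /=; lia.
  rewrite plansE => /mapP[x xcs ->] /=; rewrite mulSn.
  apply: (@leq_trans (data_size (eL eN x.2.2) + data_size (eL eN (dp full cs k x).2))).
    by rewrite -size_enc_cat leqnSn.
  apply: leq_add (IH x); apply: leq_trans (leq_addl _ _).
  apply: leq_trans (ltnW (size_enc_mem eC xcs)).
  rewrite (_ : data_size (eC x) = (bitlen x.1 + (bitlen x.2.1 + data_size (eL eN x.2.2)).+1).+1) //.
  by lia.
have hv : bitlen (dp full cs k a).1 <= data_size (eC full) + data_size (eC a) + 2.
  (* A plan replaces the base plan only if it is cheaper, so values never grow with the number of
     rounds. *)
  apply: leq_trans (bitlen_le2 (_ : _ <= 2 * full.1 * a.2.1)) _.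
    by case: k {hr} => [|k] //; have [h _] := relax_le full (plans full cs k) a.
  apply: leq_trans (bitlenM _ _) _.
  apply: leq_trans (leq_add (bitlenM _ _) (leqnn _)) _.
  rewrite (_ : data_size (eC a) = (bitlen a.1 + (bitlen a.2.1 + data_size (eL eN a.2.2)).+1).+1) //.
  rewrite (_ : data_size (eC full) = (bitlen full.1 + (bitlen full.2.1 + data_size (eL eN full.2.2)).+1).+1) //.
  by rewrite (_ : bitlen 2 = 2) //; lia.
rewrite (_ : data_size (eR (dp full cs k a)) =
  (bitlen (dp full cs k a).1 + data_size (eL eN (dp full cs k a).2)).+1) //.
by move: hr hv; move: (k.+1 * _) => m; lia.
Qed.

Lemma PT_plans (X : ctx) B (eb : B -> data) (b0 : B) (full : pt X -> cand)
   (cs : pt X -> seq cand) (zs : pt X -> seq B) :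
  PT eC full -> PT (eL eC) cs -> PT (eL eb) zs ->
  PT eD (fun e => plans (full e) (cs e) (size (zs e))).
Proof.
move=> pf pc pz.
have p0 : PT eD (fun e => [seq (a, base (full e) a) | a <- cs e]).
  apply: (PT_map cand0 pc) => Z p a wk dz pa.
  exact: PT_pair pa (PT_base (wk _ _ _ pf) pa).
pose F e := data_size (eC (full e)); pose C e := data_size (eL eC (cs e)).
pose k e := (data_size (eL eb (zs e))).+1.
pose bd e := C e * (C e + (F e + C e + 10 + k e * (F e + C e)) + 1).+1 + 1.
have Fb : pbnd F := PT_size pf.
have Cb : pbnd C := PT_size pc.
have kb : pbnd k := pbndS (PT_size pz).
apply: (PT_iter b0 (f := fun e => round (full e)) (bd := bd) _ _ pz p0).
- have FC := pbndD Fb Cb.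
  apply: pbndD (@pbnd_const X 1); apply: (pbndM Cb (pbndS _)).
  apply: pbndD (@pbnd_const X 1); apply: (pbndD Cb).
  exact: pbndD (pbndD FC (@pbnd_const X 10)) (pbndM kb FC).
- move=> e i de li; rewrite -/(plans (full e) (cs e) i) plansE.
  apply: leq_trans (size_enc_map (b := C e + (F e + C e + 10 + k e * (F e + C e)) + 1) _) _; last first.
    by rewrite /bd leq_add2r leq_mul2r; apply/orP; right; exact: leq_size_enc.
  move=> a acs; rewrite (_ : data_size (eP eC eR (a, dp (full e) (cs e) i a)) =
    data_size (eC a) + data_size (eR (dp (full e) (cs e) i a)) + 1) ?addn1 //.
  have ha := size_enc_mem eC acs; rewrite ltnS; apply: leq_add; first exact: ltnW.
  apply: leq_trans (dp_size _ _ _ _) _; apply: leq_add.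
    by rewrite leq_add2r leq_add2l ltnW.
  rewrite leq_mul2r; apply/orP; right; rewrite ltnS.
  exact: leq_trans li (leq_size_enc eb _).
move=> Z p b wk dz pb.
apply: (PT_map (cand0, (0, [::])) pb) => W q x wk2 dw px.
apply: PT_pair (PT_fst px) _.
exact: PT_relax (wk2 _ _ _ (wk _ _ _ pf)) (PT_fst px) (wk2 _ _ _ pb).
Qed.

Lemma PT_dedup (X : ctx) (s : pt X -> seq nat) :
  PT (eL eN) s -> PT (eL eN) (fun e => dedup [::] (s e)).
Proof.
move=> ps; apply: PT_ext (PT_rev 0 (PT_foldl 0
  (f := fun _ acc v => if v \in acc then acc else v :: acc) (PT_size ps) _ ps (PT_nil X _) _)).
- by move=> e _; rewrite dedup_foldl.
- move=> e s1 s2 de E; rewrite -size_enc_rev -dedup_foldl.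
  apply: size_enc_sub; first exact: dedup_uniq.
  by move=> x; rewrite dedup_mem E mem_cat => /andP[->].
move=> Z p b a wk dz pb pa.
exact: PT_if (PT_mem pb pa) pb (PT_cons pa pb).
Qed.

Section PTwalk.
Variables (X : ctx) (B : Type) (eb : B -> data) (b0 : B).
Variables (lab A0 : pt X -> seq nat) (cm : pt X -> seq (seq nat)) (zs : pt X -> seq B).
Hypothesis ok : forall e : pt X, dom e -> exists n c,
  [/\ lab e = iota 0 n.+1, A0 e = iota 1 n & inst n c (cm e)].
Hypothesis plab : PT (eL eN) lab.
Hypothesis pA : PT (eL eN) A0.
Hypothesis pcm : PT eM cm.
Hypothesis pz : PT (eL eb) zs.

Lemma PT_ml_walk : PT (eL eN) (fun e => ml_walk (lab e) (A0 e) (cm e) (size (zs e))).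
Proof.
have pcs := PT_cands ok plab pA pcm.
have pn := PT_length 0 pA.
have pnil := PT_nil X eN.
have p0 := PT_cst X 0.
have pf := PT_head (a0 := cand0) pcs (PT_pair p0 (PT_pair p0 pnil)).
apply: PT_dedup; apply: (PT_snd (ea := eN)).
exact: PT_relax pf (PT_pair p0 (PT_pair pn pnil)) (PT_plans b0 pf pcs pz).
Qed.
End PTwalk.

(** * Computing the greedy concatenation *)

Lemma wlen_sumn c u s :
  wlen c u s = sumn [seq c (nth 0 (u :: s) i) (nth 0 s i) | i <- iota 0 (size s)].
Proof.
elim: s u => //= v s IH u; rewrite IH; congr (_ + sumn _).
by rewrite (iotaDl 1 0) -map_comp.
Qed.

Lemma PT_tour_len (X : ctx) (cm : pt X -> seq (seq nat)) (tr : pt X -> seq nat) :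
  PT eM cm -> PT (eL eN) tr -> PT eN (fun e => tour_len (mget (cm e)) (tr e)).
Proof.
move=> pc pt_; have p0 := PT_cst X 0.
have ps := PT_cat 0 pt_ (PT_cons p0 (PT_nil X eN)).
have pus := PT_cons p0 ps.
apply: (PT_ext (f := fun e => sumn [seq mget (cm e) (nth 0 (0 :: tr e ++ [:: 0]) i) (nth 0 (tr e ++ [:: 0]) i)
   | i <- iota 0 (size (tr e ++ [:: 0]))])).
  by move=> e _; rewrite /tour_len -cats1 wlen_sumn.
apply: PT_sumn; apply: (PT_map 0 (PT_iota 0 ps)) => Z p i wk dz pi.
have p0' := PT_cst Z 0.
exact: PT_mget (wk _ _ _ pc) (PT_nth (wk _ _ _ pus) p0' pi) (PT_nth (wk _ _ _ ps) p0' pi).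
Qed.

Section Build.
Let c0 := fun _ _ : nat => 0.
Lemma m0 : metric c0. Proof. by split. Qed.

(** What matters here is which nodes a partial tour contains, not its length, hence the zero metric
    [c0]. *)
Lemma iter_pass_inv el k : tour_inv c0 el (iter k (fun tr => foldl grow tr el) [::]).
Proof.
elim: k => [|k IH]; first by split=> //; rewrite /tour_len.
by rewrite iterS; have [] := pass_inv m0 (fun x h => h) IH.
Qed.

Lemma tour_inv_size el tr : tour_inv c0 el tr ->
  data_size (eL eN tr) <= data_size (eL eN (unzip1 el ++ unzip2 el)).
Proof.
case=> ut _ te _; apply: size_enc_sub => // a /te /hasP[e eel].
by rewrite mem_cat => /orP[] /eqP ->; apply/orP; [left|right]; apply: map_f.
Qed.

Lemma PT_visited (X : ctx) (tr : pt X -> seq nat) (a : pt X -> nat) :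
  PT (eL eN) tr -> PT eN a -> PT eB (fun e => visited (tr e) (a e)).
Proof. by move=> ptr pa; exact: PT_or (PT_eqn pa (PT_cst X 0)) (PT_mem ptr pa). Qed.

Lemma PT_grow (X : ctx) (tr : pt X -> seq nat) (f : pt X -> nat * nat) :
  PT (eL eN) tr -> PT (eP eN eN) f -> PT (eL eN) (fun e => grow (tr e) (f e)).
Proof.
move=> ptr pf; have p1 := PT_fst pf; have p2 := PT_snd pf.
have v2 := PT_visited ptr p2.
apply: (PT_if (PT_visited ptr p1)).
  exact: PT_if v2 ptr (PT_ins p1 p2 ptr).
exact: PT_if v2 (PT_ins p2 p1 ptr) ptr.
Qed.

Lemma PT_build (X : ctx) (el : pt X -> seq (nat * nat)) :
  PT (eL (eP eN eN)) el -> PT (eL eN) (fun e => build (el e)).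
Proof.
move=> pl.
have pu2 : PT (eL eN) (fun e => unzip2 (el e)).
  by apply: (PT_map (0, 0) pl) => Z p a wk dz pa; apply: PT_snd pa.
have pu := PT_cat 0 (PT_unzip1 pl) pu2.
apply: (PT_iter (0, 0) (f := fun e tr => foldl grow tr (el e)) (PT_size pu) _ pl (PT_nil X eN)).
  by move=> e i de li; apply: tour_inv_size; apply: iter_pass_inv.
move=> Z p b wk dz pb.
apply: (PT_foldl (0, 0) (f := fun _ => grow) (PT_size (wk _ _ _ pu)) _ (wk _ _ _ pl) pb).
  move=> z s1 s2 de E; apply: tour_inv_size.
  have [dp [i _ Eb]] := dz z de.
  have ti : tour_inv c0 (el (p z)) (b z) by rewrite Eb; apply: iter_pass_inv.
  have sub : {subset s1 <= el (p z)} by move=> x xs; rewrite E mem_cat xs.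
  by have [] := pass_inv m0 sub ti.
by move=> W q t a wk2 dw pt_ pa; apply: PT_grow.
Qed.
End Build.

Section Choose.
Variable X : ctx.

Lemma PT_hits (tr g : pt X -> seq nat) :
  PT (eL eN) tr -> PT (eL eN) g -> PT eB (fun e => hits (tr e) (g e)).
Proof.
move=> ptr pg; apply: (PT_has 0 pg) => Z p a wk dz pa.
exact: PT_mem (wk _ _ _ ptr) pa.
Qed.
End Choose.

Definition beats (it best : choice) : bool :=
  (0 < it.2.1) && ((best.2.1 == 0) || (it.1 * best.2.1 < best.1 * it.2.1)).

(** Measuring all tours beforehand makes the choice a selection among the elements of a list, whose
    sizes bound the result. *)
Lemma choose_tourE c cs U : choose_tour c cs U =
  foldl (fun best it => if beats it best then it else best) (0, (0, [::]))
    [seq (tour_len c tr, (count (hits tr) U, tr)) | tr <- cs].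
Proof.
rewrite /choose_tour; move: (0, (0, [::])) => b.
by elim: cs b => //= tr cs IH b; rewrite IH.
Qed.

Section Greedy.
Variable X : ctx.
Variables (cm : pt X -> seq (seq nat)) (cs : pt X -> seq (seq nat)).
Hypothesis pcm : PT eM cm.
Hypothesis pcs : PT (eL (eL eN)) cs.

Lemma PT_choose (U : pt X -> seq (seq nat)) : PT (eL (eL eN)) U ->
  PT eC (fun e => choose_tour (mget (cm e)) (cs e) (U e)).
Proof.
move=> pU; have p0 := PT_cst X 0.
apply: (PT_ext (f := fun e => foldl (fun best it => if beats it best then it else best) (0, (0, [::]))
    [seq (tour_len (mget (cm e)) tr, (count (hits tr) (U e), tr)) | tr <- cs e])).
  by move=> e _; rewrite choose_tourE.
apply: (PT_pick (0, (0, [::])) (r := beats)).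
- apply: (PT_map [::] pcs) => Z p tr wk dz ptr.
  apply: PT_pair (PT_tour_len (wk _ _ _ pcm) ptr) (PT_pair _ ptr).
  apply: (PT_ext (f := fun z => size [seq g <- U (p z) | hits (tr z) g])).
    by move=> z _; rewrite size_filter.
  apply: (PT_length [::]); apply: (PT_filter [::] (wk _ _ _ pU)) => W q g wk2 dw pg.
  exact: PT_hits (wk2 _ _ _ ptr) pg.
- exact: PT_pair p0 (PT_pair p0 (PT_nil X eN)).
move=> Z x y px py; have px2 := PT_fst (PT_snd px); have py2 := PT_fst (PT_snd py).
apply: PT_and; first exact: PT_ltn (PT_cst Z 0) px2.
apply: PT_or; first exact: PT_eqn py2 (PT_cst Z 0).
exact: PT_ltn (PT_mul (PT_fst px) py2) (PT_mul (PT_fst py) px2).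
Qed.
End Greedy.

Definition greedy_step c cs (s : seq (seq nat) * seq nat) : seq (seq nat) * seq nat :=
  let tr := (choose_tour c cs s.1).2.2 in (missed tr s.1, s.2 ++ tr).

Lemma greedy_iter c cs k U r :
  (iter k (greedy_step c cs) (U, r)).2 = r ++ greedy c cs k U.
Proof.
elim: k U r => [|k IH] U r; first by rewrite /= cats0.
by rewrite iterSr /greedy_step /= IH catA.
Qed.

Lemma greedy_step_size c cs U i :
  let s := iter i (greedy_step c cs) (U, [::]) in
  data_size (eL (eL eN) s.1) <= data_size (eL (eL eN) U) /\
  data_size (eL eN s.2) <= i * data_size (eL (eL eN) cs) + 1.
Proof.
elim: i => [|i [IH1 IH2]] //; rewrite iterS; cbv zeta.
set s := iter i _ _ in IH1 IH2 *; rewrite /greedy_step /=.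
set tr := _.2.2; split.
  apply: leq_trans IH1; elim: s.1 => // g U' IH.
  rewrite (_ : data_size (eL (eL eN) (g :: U')) = data_size (eL eN g) + data_size (eL (eL eN) U') + 1) ?addn1 //.
  rewrite /missed /=; case: ifP => _; last by apply: leqW; exact: (leq_trans IH (leq_addl _ _)).
  rewrite (_ : data_size (eL (eL eN) (g :: missed tr U')) =
     data_size (eL eN g) + data_size (eL (eL eN) (missed tr U')) + 1) ?addn1 //.
  by rewrite ltnS leq_add2l.
have htr : data_size (eL eN tr) <= data_size (eL (eL eN) cs).
  have [_ _ [E|h] _] := choose_tour_spec c cs s.1; first by rewrite /tr E data_size_gt0.
  exact: ltnW (size_enc_mem (eL eN) h).
have := size_enc_cat eN s.2 tr; have := data_size_gt0 (eL eN tr).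
rewrite mulSn; move: htr IH2; move: (data_size (eL eN tr)) (data_size (eL eN s.2)) (data_size (eL eN (s.2 ++ tr))).
move: (data_size (eL (eL eN) cs)) (i * _) => a b p q r; lia.
Qed.

Definition mgl_walk cm cs U : seq nat := dedup [::] (greedy (mget cm) cs (size U) U).

Lemma PT_mgl_walk (X : ctx) (cm cs U : pt X -> seq (seq nat)) :
  PT eM cm -> PT (eL (eL eN)) cs -> PT (eL (eL eN)) U ->
  PT (eL eN) (fun e => mgl_walk (cm e) (cs e) (U e)).
Proof.
move=> pcm pcs pU; apply: PT_dedup.
pose bd (e : pt X) := data_size (eL (eL eN) (U e)) +
   (data_size (eL (eL eN) (U e)) * data_size (eL (eL eN) (cs e)) + 1) + 1.
apply: PT_ext (PT_snd (PT_iter (eb := eP (eL (eL eN)) (eL eN)) [::]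
  (f := fun e => greedy_step (mget (cm e)) (cs e)) (bd := bd) _ _ pU (PT_pair pU (PT_nil X eN)) _)).
- by move=> e _; rewrite greedy_iter.
- apply: pbndD (@pbnd_const X 1); apply: pbndD (PT_size pU) _.
  apply: pbndD (@pbnd_const X 1); exact: pbndM (PT_size pU) (PT_size pcs).
- move=> e i de li; have [] := greedy_step_size (mget (cm e)) (cs e) (U e) i.
  set s := iter _ _ _ => h1 h2.
  rewrite (_ : data_size (eP (eL (eL eN)) (eL eN) s) =
    data_size (eL (eL eN) s.1) + data_size (eL eN s.2) + 1) ?addn1 //.
  rewrite /bd addn1 ltnS leq_add //; apply: leq_trans h2 _.
  by rewrite leq_add2r leq_mul2r (leq_trans li (leq_size_enc _ _)) orbT.
move=> Z p b wk dz pb; have pU' := PT_fst pb.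
have ptr := PT_snd (PT_snd (PT_choose (wk _ _ _ pcm) (wk _ _ _ pcs) pU')).
apply: PT_pair (PT_cat 0 (PT_snd pb) ptr).
apply: (PT_filter [::] pU') => W q g wk2 dw pg.
exact: PT_not (PT_hits (wk2 _ _ _ ptr) pg).
Qed.

Notation eQ := (eL (eL (eP eN eN))).

(** * From computable maps to programs *)

Section Extract.
Variables (A : Type) (ea : A -> data) (D : A -> Prop).

Lemma det_env_size (a : A) : D a -> size [:: ea a] = 1.
Proof. by []. Qed.

Definition det_ctx : ctx :=
  {| pt := A; dom := D; env := fun a => [:: ea a]; nvars := 1;
     msz := fun a => data_size (ea a); env_size := det_env_size |}.

Lemma PT_det : @PT det_ctx A ea id.
Proof.
have b : @pbnd det_ctx (fun a => data_size (ea a)) := @pbnd_msz det_ctx.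
split=> // k; exists [::], (Var 0), (fun _ => 1); split; first exact: pbnd_const.
by move=> p _ e rest de; exists 1 => //; exact: (@EvVar p (ea e :: rest) 0).
Qed.

Lemma rand_env_size (a : A * seq bool) : D a.1 -> size [:: Node (ea a.1) (enc_bits a.2)] = 1.
Proof. by []. Qed.

(* The coin flips are never read, so that the cost is measured against the rest
   of the input alone. *)
Definition rand_ctx : ctx :=
  {| pt := (A * seq bool)%type; dom := fun a => D a.1;
     env := fun a => [:: Node (ea a.1) (enc_bits a.2)]; nvars := 1;
     msz := fun a => data_size (ea a.1); env_size := rand_env_size |}.

Lemma PT_rand : @PT rand_ctx A ea fst.
Proof.
have b : @pbnd rand_ctx (fun a => data_size (ea a.1)) := @pbnd_msz rand_ctx.
split=> // k; exists [::], (Fst (Var 0)), (fun _ => 2); split; first exact: pbnd_const.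
move=> p _ e rest de; exists 2 => //; apply: EvFst (enc_bits e.2) _ _.
exact: (@EvVar p (Node (ea e.1) (enc_bits e.2) :: rest) 0).
Qed.

End Extract.

Definition time_bound (a : nat) : {poly nat} := (('X + a%:P) ^+ a)%R.

Lemma time_boundE s a : ((time_bound a).[s])%R = (s + a) ^ a.
Proof.
rewrite /time_bound horner_exp hornerD hornerX hornerC.
have -> : (s + a)%R = s + a by []; move: (s + a) => x.
by elim: a => // a IH; rewrite GRing.exprS IH expnS.
Qed.

Lemma PT_program X A (ea : A -> data) (f : pt X -> A) : nvars X = 1 -> PT ea f ->
  exists (alg : program) (a : nat), forall (e : pt X) v, dom e -> env e = [:: v] ->
    computes alg v (ea (f e)) ((time_bound a).[msz e])%R.
Proof.
(* Function 0 is the entry point [t], so its auxiliary functions start at number 1. *)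
move=> nv [_ Hf]; have [fs [t [b [[a ba] Ht]]]] := Hf 1.
exists (t :: fs), a => e v de Ev.
have hp : has_at (t :: fs) 1 fs by move=> i li; rewrite add1n.
have [c lc ev] := Ht _ hp e [::] de.
exists c; last by rewrite Ev in ev.
by rewrite time_boundE; apply: leq_trans lc (ba e de).
Qed.

(** The product of all denominators has at most as many bits as the denominators together, which
    keeps it polynomial. *)
Definition common_den (dm : seq (seq (nat * nat))) : nat := foldr muln 1 (unzip2 (flatten dm)).

(* Clears denominators; the factor 256 makes the n missed nodes, at the initial
   multiplier 8, cheaper than 1/32 of the unit of time. *)
Definition scale (dm : seq (seq (nat * nat))) : nat := 256 * size dm * common_den dm.

Definition scaled (dm : seq (seq (nat * nat))) : seq (seq nat) :=
  [seq [seq 256 * size dm * (q.1 * (common_den dm %/ q.2)) | q <- row] | row <- dm].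

Section Scaled.
Variables (X : ctx) (dm : pt X -> seq (seq (nat * nat))).
Hypothesis pdm : PT eQ dm.

Lemma PT_scaled : PT eM (fun e => scaled (dm e)).
Proof.
have pfl : PT (eL eN) (fun e => unzip2 (flatten (dm e))).
  by apply: (PT_map (0, 0) (PT_flatten (0, 0) pdm)) => Z p a wk dz pa; apply: PT_snd pa.
have pden : PT eN (fun e => common_den (dm e)).
  apply: (PT_foldr 0 (f := fun _ => muln) (PT_size pfl) _ pfl (PT_cst X 1)).
    move=> e s1 s2 de ->; apply: leq_trans (size_enc_suffix eN s1 s2).
    elim: s2 => // a s IH; rewrite [foldr _ _ _]/=; apply: leq_trans (bitlenM _ _) _.
    rewrite (_ : data_size (eL eN (a :: s)) = (bitlen a + data_size (eL eN s)).+1) //.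
    by apply: leqW; rewrite leq_add2l.
  by move=> Z p b a wk dz pb pa; apply: PT_mul.
have pk := PT_mul (PT_cst X 256) (PT_length [::] pdm).
apply: (PT_map [::] pdm) => Z p row wk dz pr.
apply: (PT_map (0, 0) pr) => W q x wk2 dw px.
apply: PT_mul (wk2 _ _ _ (wk _ _ _ pk)) (PT_mul (PT_fst px) _).
exact: PT_div (wk2 _ _ _ (wk _ _ _ pden)) (PT_snd px).
Qed.
End Scaled.

Definition labels (dm : seq (seq (nat * nat))) : seq nat := iota 0 (size dm).
Definition nonroot (dm : seq (seq (nat * nat))) : seq nat := [seq x <- labels dm | x != 0].

Definition ml_input : Type := (seq (seq (nat * nat)) * (nat * (data * seq data)))%type.
Definition enc_ml_input : ml_input -> data := eP eQ (eP eN (eP id (eL id))).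

(** The horizon is read off as the length of the list of the [z] at successive times, a unary
    number, so that a number of rounds equal to it is polynomial in the input size. *)
Definition ml_program (i : ml_input) : seq nat :=
  ml_walk (labels i.1) (nonroot i.1) (scaled i.1) (size i.2.2.2).

Definition mgl_input : Type :=
  (seq (seq (nat * nat)) * (seq (seq nat) * (nat * (data *
     seq (seq (seq (nat * nat) * (nat * nat)))))))%type.
Definition enc_mgl_input : mgl_input -> data :=
  eP eQ (eP (eL (eL eN)) (eP eN (eP id (eL (eL (eP eT (eP eN eN))))))).

Definition mgl_tours (i : mgl_input) : seq (seq nat) :=
  [seq build q.1 | q <- flatten i.2.2.2.2].

Definition mgl_program (i : mgl_input) : seq nat :=
  mgl_walk (scaled i.1) (mgl_tours i) i.2.1.

Section Programs.
Variable X : ctx.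

Lemma PT_ml_program (i : pt X -> ml_input) :
  (forall e : pt X, dom e -> exists n c, size (i e).1 = n.+1 /\ inst n c (scaled (i e).1)) ->
  PT enc_ml_input i -> PT (eL eN) (fun e => ml_program (i e)).
Proof.
move=> ok pi; have pdm := PT_fst pi; have pz := PT_snd (PT_snd (PT_snd pi)).
have plab : PT (eL eN) (fun e => labels (i e).1) := PT_iota [::] pdm.
have pA : PT (eL eN) (fun e => nonroot (i e).1).
  by apply: (PT_filter 0 plab) => Z p a wk dz pa; apply: PT_not (PT_eqn pa (PT_cst Z 0)).
apply: (PT_ml_walk (Atom 0) _ plab pA (PT_scaled pdm) pz) => e /ok[n [c [E ic]]].
exists n, c; split=> //; first by rewrite /labels E.
rewrite /nonroot /labels E /=; apply/all_filterP/allP => x.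
by rewrite mem_iota => /andP[]; case: x.
Qed.

Lemma PT_mgl_program (i : pt X -> mgl_input) :
  PT enc_mgl_input i -> PT (eL eN) (fun e => mgl_program (i e)).
Proof.
move=> pi; have pdm := PT_fst pi; have pg := PT_fst (PT_snd pi).
have pz := PT_snd (PT_snd (PT_snd (PT_snd pi))).
apply: PT_mgl_walk (PT_scaled pdm) _ pg.
apply: (PT_map ([::], (0, 0)) (PT_flatten ([::], (0, 0)) pz)) => Z p q wk dz pq.
exact: PT_build (PT_fst pq).
Qed.
End Programs.

(** * The rounding theorems *)

Lemma enc_seq_map A B (f : A -> B) (eb : B -> data) s :
  enc_seq (fun a => eb (f a)) s = enc_seq eb (map f s).
Proof. by elim: s => //= a s ->. Qed.

Lemma eq_enc_seq A (e1 e2 : A -> data) s : e1 =1 e2 -> enc_seq e1 s = enc_seq e2 s.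
Proof. by move=> E; elim: s => //= a s ->; rewrite E. Qed.

Section Instance.
Variables (n : nat) (d : distance n).
Hypothesis md : is_metric d.

Definition rat_pair (q : rat) : nat * nat := (absz (numq q), absz (denq q)).

Definition dist_matrix : seq (seq (nat * nat)) :=
  [seq [seq rat_pair (d u v) | v <- enum (vertex n)] | u <- enum (vertex n)].

Lemma enc_distanceE : enc_distance d = eQ dist_matrix.
Proof.
rewrite /enc_distance /dist_matrix -enc_seq_map; apply: eq_enc_seq => u.
by rewrite -enc_seq_map.
Qed.

Lemma size_dist_matrix : size dist_matrix = n.+1.
Proof. by rewrite size_map size_enum_ord. Qed.

Let Kd := scale dist_matrix.

(** [inord] assigns a vertex to every natural number, so this is a metric on all labels. *)
Definition sdist (u v : nat) : nat :=
  let q := rat_pair (d (inord u) (inord v)) in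
  256 * n.+1 * (q.1 * (common_den dist_matrix %/ q.2)).

Lemma map_enum_vertex B (f : vertex n -> B) :
  [seq f u | u <- enum (vertex n)] = [seq f (inord u) | u <- iota 0 n.+1].
Proof.
rewrite -val_enum_ord -map_comp; apply: eq_map => u /=.
by rewrite inord_val.
Qed.

Lemma scaledE : scaled dist_matrix = tab (iota 0 n.+1) sdist.
Proof.
rewrite /scaled size_dist_matrix [in X in map _ X]/dist_matrix -map_comp map_enum_vertex.
by apply: eq_map => u /=; rewrite -map_comp map_enum_vertex.
Qed.

Lemma den_dvd u v : absz (denq (d u v)) %| common_den dist_matrix.
Proof.
rewrite /common_den; set s := unzip2 _.
have : absz (denq (d u v)) \in s.
  apply/mapP; exists (rat_pair (d u v)) => //; apply/flattenP.
  exists [seq rat_pair (d u v) | v <- enum (vertex n)]; first by apply: map_f; rewrite mem_enum.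
  by apply: map_f; rewrite mem_enum.
elim: s => //= a s IH; rewrite inE => /orP[/eqP->|/IH h]; first exact: dvdn_mulr.
exact: dvdn_mull.
Qed.

Lemma common_den_gt0 : 0 < common_den dist_matrix.
Proof.
rewrite /common_den; set s := unzip2 _.
have : forall a, a \in s -> 0 < a.
  move=> a /mapP[q /flattenP[r /mapP[u _ ->] /mapP[v _ ->]] ->] /=.
  by rewrite absz_gt0 denq_neq0.
elim: s => //= a s IH H; rewrite muln_gt0 H ?mem_head ?IH // => x xs.
by apply: H; rewrite inE xs orbT.
Qed.

Lemma scale_ge : 256 * n.+1 <= Kd.
Proof. by rewrite /Kd /scale size_dist_matrix leq_pmulr // common_den_gt0. Qed.

Lemma scale_gt0 : 0 < Kd.
Proof. exact: leq_trans (_ : 0 < 256 * n.+1) scale_ge. Qed.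

Local Open Scope ring_scope.

Lemma sdistE u v : (sdist u v)%:R = Kd%:R * d (inord u) (inord v) :> rat.
Proof.
rewrite /sdist /Kd /scale size_dist_matrix /rat_pair; move: (256 * n.+1)%N => m.
set q := d _ _; have q0 : 0 <= q by case: md => _ h _ _; apply: h.
have /dvdnP[k Ek] : (absz (denq q) %| common_den dist_matrix)%N by apply: den_dvd.
have den0 : (0 < absz (denq q))%N by rewrite absz_gt0 denq_neq0.
rewrite Ek (mulnK _ den0) !natrM -!mulrA; congr (_ * _).
rewrite mulrC; congr (_ * _).
have -> : (absz (denq q))%:R = (denq q)%:~R :> rat by rewrite natr_absz ger0_norm ?denq_ge0.
have -> : (absz (numq q))%:R = (numq q)%:~R :> rat by rewrite natr_absz ger0_norm // numq_ge0.
by rewrite numqE mulrC.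
Qed.

Lemma sdist_metric : metric sdist.
Proof.
have k0 : 0 < Kd%:R :> rat by rewrite ltr0n scale_gt0.
case: md => d0 _ ds dt; split.
- by move=> u; apply/eqP; rewrite -(eqr_nat rat) sdistE d0 mulr0.
- by move=> u v; apply/eqP; rewrite -(eqr_nat rat) !sdistE ds.
by move=> u v w; rewrite -(ler_nat rat) natrD !sdistE -mulrDr ler_pM2l // dt.
Qed.

Lemma scaled_inst : inst n sdist (scaled dist_matrix).
Proof.
have [_ sy _] := sdist_metric.
split; first exact: sdist_metric.
  by move=> u v un vn; rewrite scaledE mget_tab.
by move=> u v; rewrite scaledE !mget_tabE andbC; case: ifP => // _; rewrite sy.
Qed.

Lemma sdist_val (u v : vertex n) : (sdist u v)%:R = Kd%:R * d u v :> rat.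
Proof. by rewrite sdistE !inord_val. Qed.

Lemma latency_lat (p : seq (vertex n)) (S : {set vertex n}) (P : pred nat) :
  (forall v : vertex n, P v = (v \in S)) ->
  Kd%:R * latency d p S = (lat sdist 0 (map val p) P)%:R :> rat.
Proof.
move=> PS; rewrite /latency /path_len.
suff H (u : vertex n) : Kd%:R * walk_len d u (take (find (mem S) p).+1 p) =
    (lat sdist u (map val p) P)%:R by rewrite (H Defs.root).
elim: p u => [|v p IH] u /=; first by rewrite mulr0.
rewrite PS natrD sdist_val mulrDr; case: (v \in S) => /=; first by rewrite take0 /= mulr0.
by rewrite -IH.
Qed.

Lemma wlen_path (p : seq (vertex n)) :
  (wlen sdist 0 (map val p))%:R = Kd%:R * path_len d p :> rat.
Proof.
rewrite /path_len; suff H (u : vertex n) : (wlen sdist u (map val p))%:R = Kd%:R * walk_len d u p.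
  by rewrite (H Defs.root).
elim: p u => [|v p IH] u /=; first by rewrite mulr0.
by rewrite natrD sdist_val IH mulrDr.
Qed.

Definition tree_edges (Q : edges n) : seq (nat * nat) :=
  [seq (nat_of_ord e.1, nat_of_ord e.2) | e <- enum Q].

Lemma enc_treeE Q : enc_tree Q = eT (tree_edges Q).
Proof. by rewrite /tree_edges -enc_seq_map. Qed.

Lemma tree_walk_sub Q : {subset build (tree_edges Q) <= iota 1 n}.
Proof.
have [[_ b0 be _] _] := build_inv (tree_edges Q) sdist_metric.
move=> a ab; have /hasP[e /mapP[[u v] _ ->]] := be a ab.
have a0 : a != 0%N by apply: contraNneq b0 => <-.
by rewrite mem_iota lt0n a0 add1n /= => /orP[] /eqP ->; apply: ltn_ord.
Qed.

Lemma tree_walk_len Q :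
  (tour_len sdist (build (tree_edges Q)))%:R <= 2%:R * (Kd%:R * tree_len d Q) :> rat.
Proof.
have [[_ _ _ bl] _] := build_inv (tree_edges Q) sdist_metric.
apply: (@le_trans _ _ (2 * \sum_(e <- tree_edges Q) sdist e.1 e.2)%:R).
  rewrite ler_nat; apply: leq_trans bl _; rewrite leq_mul2l /= big_mkcond.
  by apply: leq_sum => e _; case: ifP.
rewrite natrM ler_wpM2l //; rewrite natr_sum big_map big_enum /= /tree_len mulr_sumr.
by apply: ler_sum => e _; rewrite sdist_val.
Qed.

(** Since both or none of the ends of each edge are visited, being visited propagates along the path
    of the tree from the root to [v]. *)
Lemma tree_walk_nodes Q (v : vertex n) : rooted_tree Q -> v != Defs.root -> v \in tree_nodes Q ->
  val v \in build (tree_edges Q).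
Proof.
case/and3P=> _ /forallP conn _ v0 vQ; have := conn v; rewrite vQ /= => /connectP[p pth Ev].
have [_ /allP co] := build_inv (tree_edges Q) sdist_metric.
set tr := build _ in co *.
have step (x y : vertex n) : adj Q x y -> visited tr x -> visited tr y.
  have co' (a b : vertex n) : (a, b) \in Q -> visited tr a = visited tr b.
    move=> h; apply/eqP/(co (nat_of_ord a, nat_of_ord b)).
    by apply/mapP; exists (a, b); rewrite ?mem_enum.
  by case/orP=> /co' ->.
suff : visited tr v by rewrite /visited => /orP[/eqP E|//]; case/eqP: v0; apply: val_inj.
rewrite Ev; have : visited tr (Defs.root : vertex n) by [].
elim: p (Defs.root : vertex n) pth {Ev} => //= y p IH x /andP[xy pth] vx.
by apply: IH => //; apply: step xy vx.
Qed.

End Instance.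

Local Open Scope ring_scope.

Lemma sum_iota1 (V : nmodType) n (f : nat -> V) :
  \sum_(w <- iota 1 n) f w = \sum_(j < n) f j.+1.
Proof.
rewrite -(big_mkord predT (fun j => f j.+1)) /= -[1%N]addn0 iotaDl big_map.
by rewrite /index_iota subn0.
Qed.

(** * Rounding for ML, with each LP subgraph represented by a walk *)

Section MLRound.
Variables (R : realType) (n : nat) (d : distance n) (T : nat) (U : finType).
Variables (avail : nat -> pred U) (covers : U -> 'I_n -> bool) (walk : U -> seq nat).
Variables (x : 'I_n -> nat -> rat) (z : U -> nat -> rat) (rho g : R).
Hypothesis md : is_metric d.
Hypothesis rho1 : 1 <= rho.
Hypothesis g1 : 1 <= g.
Hypothesis lpf : lp_feasible T rho avail covers x z.
Let dm := dist_matrix d.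
Let Kd := scale dm.
Hypothesis walk_in : forall t Q, (1 <= t <= T)%N -> avail t Q ->
  {subset walk Q <= iota 0 n.+1}.
Hypothesis walk_len : forall t Q, (1 <= t <= T)%N -> avail t Q ->
  (wlen (sdist d) 0 (walk Q))%:R <= g * Kd%:R * t%:R :> R.
Hypothesis walk_covers : forall t Q (j : 'I_n), (1 <= t <= T)%N -> avail t Q -> covers Q j ->
  j.+1 \in walk Q.

Let lab := iota 0 n.+1.
Let A0 := iota 1 n.
Let cm := scaled dm.
Let c := sdist d.
Let K := lam_count lab A0 cm.
Let cs := cands lab A0 cm.
Let start : cand := (0%N, (n, [::])).

Let xR (j : 'I_n) (t : nat) : R := ratr (x j t).

Let xR_ge0 j t : (1 <= t <= T)%N -> 0 <= xR j t.
Proof. by case: lpf => h _ _ _ _ /h; rewrite ler0q. Qed.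

Let xR_sum j : 1 <= \sum_(1 <= t < T.+1) xR j t.
Proof.
case: lpf => _ _ h _ _; have := h j; rewrite -(ler_rat R) rmorph1.
by rewrite rmorph_sum.
Qed.

(** The sums of [x] may exceed 1, whereas the comparison of trees with walks takes covered fractions
    of at most 1. *)
Let part (t : nat) (j : 'I_n) : R := Num.min 1 (\sum_(1 <= t' < t.+1) xR j t').

(** The default 0 makes [0 <= M t <= n] hold at all times, and [M T = 0] even for [T = 0]. *)
Let M (t : nat) : R := if (1 <= t <= T)%N then \sum_j (1 - part t j) else 0.

Let part_le1 t j : part t j <= 1.
Proof. by rewrite /part ge_min lexx. Qed.

Let part_ge0 t j : (t <= T)%N -> 0 <= part t j.
Proof.
move=> tT; rewrite /part le_min ler01 /= big_nat sumr_ge0 // => s /andP[s1 st].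
by apply: xR_ge0; rewrite s1 (leq_trans _ tT).
Qed.

Let M_ge0 t : 0 <= M t.
Proof.
rewrite /M; case: ifP => // _; apply: sumr_ge0 => j _.
by rewrite subr_ge0 part_le1.
Qed.

Let M_le t : M t <= n%:R.
Proof.
rewrite /M; case: ifP => [/andP[_ tT]|_]; last by rewrite ler0n.
rewrite -[n in n%:R]card_ord -sumr_const; apply: ler_sum => j _.
by rewrite gerBl part_ge0.
Qed.

Let M_T : M T = 0.
Proof.
rewrite /M; case: ifP => // /andP[T1 _]; apply: big1 => j _; apply/eqP.
by rewrite subr_eq0 eq_sym /part; apply/eqP/min_idPl; apply: xR_sum.
Qed.

Let M_x s : (0 < s <= T)%N -> M s <= \sum_j \sum_(1 <= t < T.+1 | (s < t)%N) xR j t.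
Proof.
move=> sT; rewrite /M sT; apply: ler_sum => j _; case/andP: sT => s1 sT.
have E : \sum_(1 <= t < T.+1) xR j t =
    \sum_(1 <= t < s.+1) xR j t + \sum_(1 <= t < T.+1 | (s < t)%N) xR j t.
  rewrite (bigID (fun t => (t <= s)%N)) /=; congr (_ + _); last first.
    by apply: eq_bigl => t; rewrite ltnNge.
  rewrite [RHS](big_nat_widen _ _ T.+1) //; by apply: eq_bigl => t; rewrite ltnS.
have tail0 : 0 <= \sum_(1 <= t < T.+1 | (s < t)%N) xR j t.
  rewrite big_nat_cond sumr_ge0 // => t /andP[/andP[t1 tT] _].
  by apply: xR_ge0; rewrite t1 -ltnS.
have := xR_sum j; rewrite E /part minEle; case: ifP => _; lra.
Qed.

Let b : R := rho * g * Kd%:R.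

Let rg1 : 1 <= rho * g.
Proof. by apply: mulr_ege1. Qed.

Let b_ge : (256 * n)%:R <= b.
Proof.
apply: (@le_trans _ _ Kd%:R).
  by rewrite ler_nat; apply: leq_trans (scale_ge d); rewrite leq_mul2l leqnSn.
by rewrite /b ler_peMl ?ler0n.
Qed.

Let ic : inst n c cm := scaled_inst md.

Let cd i := cand_of lab A0 cm (lamk i).

Let cd_cs i : (i <= K)%N -> cd i \in cs.
Proof.
move=> iK; rewrite /cs (candsE n); apply: map_f.
by rewrite mem_rev mem_iota ltnS.
Qed.

(** The tree is compared with the walks of the LP at time [t]: their total weight is at most [rho]
    and each is no longer than [g * Kd * t], which together give [b * t]. Client [j] has label
    [j.+1]. *)
Let cd_bound t i : (0 < t <= T)%N -> (i <= K)%N ->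
  ((cd i).1 + lamk i * (cd i).2.1)%:R <= b * t%:R + (lamk i)%:R * M t.
Proof.
move=> tT _; case: lpf => _ hz _ hrho hcov.
pose zz Q : R := if avail t Q then ratr (z Q t) else 0.
pose W Q := if avail t Q then walk Q else [::].
pose y w := if (insub w.-1 : option 'I_n) is Some j then part t j else 0.
have zz0 Q : 0 <= zz Q.
  by rewrite /zz; case: ifP (hz Q t tT) => // _; rewrite ler0q.
have ys (j : 'I_n) : y j.+1 = part t j by rewrite /y /= valK.
have inA w : w \in A0 -> exists j : 'I_n, w = j.+1.
  rewrite mem_iota add1n => /andP[w0 wn]; case: w w0 wn => // w _ wn.
  by exists (Ordinal (wn : (w < n)%N)).
have [mc cmE sy] := ic.
have WA Q : {subset W Q <= lab} by rewrite /W; case: ifP => // /(walk_in tT).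
have y1 w : w \in A0 -> y w <= 1 by move=> /inA[j ->]; rewrite ys.
have yz w : w \in A0 -> y w <= \sum_(Q | w \in W Q) zz Q.
  move=> /inA[j ->]; rewrite ys.
  apply: (@le_trans _ _ (\sum_(1 <= t' < t.+1) xR j t')); first by rewrite /part ge_min lexx orbT.
  apply: (@le_trans _ _ (ratr (\sum_(Q | avail t Q && covers Q j) z Q t))).
    by rewrite -rmorph_sum ler_rat; apply: hcov.
  rewrite rmorph_sum big_mkcond [X in _ <= X]big_mkcond; apply: ler_sum => Q _.
  rewrite /W /zz; case: (boolP (avail t Q)) => av /=; last by [].
  case: ifP => [cov|_]; first by rewrite (walk_covers tT av cov).
  by case: ifP => // _; have := zz0 Q; rewrite /zz av.
have := @cand_bound n c cm cmE sy R (lamk i) U zz W y zz0 WA y1 yz.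
rewrite -/(cd i) => h; apply: le_trans h _; apply: lerD; last first.
  by rewrite sum_iota1 /M tT; apply: ler_wpM2l; rewrite ?ler0n //;
     apply: ler_sum => j _; rewrite ys.
apply: (@le_trans _ _ (\sum_Q zz Q * (g * Kd%:R * t%:R))).
  apply: ler_sum => Q _; case: (boolP (avail t Q)) => av; last by rewrite /zz (negbTE av) !mul0r.
  by rewrite /W av; apply: ler_wpM2l => //; apply: walk_len.
rewrite -mulr_suml /b -!mulrA ler_wpM2r ?mulr_ge0 ?ler0n //; first by apply: le_trans g1.
by apply: le_trans (hrho t tT); rewrite rmorph_sum [X in _ <= X]big_mkcond.
Qed.

Let plan_ := dp (head cand0 cs) cs T.+1 start.

Let value_bound : plan_.1%:R <= 7%:R * b * (ratr (lp_cost T x) : R).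
Proof.
have LPE : ratr (lp_cost T x) = \sum_j \sum_(1 <= t < T.+1) t%:R * xR j t.
  rewrite rmorph_sum; apply: eq_bigr => j _; rewrite rmorph_sum; apply: eq_bigr => t _.
  by rewrite rmorphM /= ratr_nat.
(* For [T = 0] the constraints that each client be served force [n = 0], and the plan costs
   nothing. *)
case: (posnP T) => [T0|T0].
  have n0 : n = 0%N.
    case: (posnP n) => // n0; have := xR_sum (Ordinal n0).
    by rewrite T0 big_geq // ler10.
  have -> : plan_.1 = 0%N.
    apply/eqP; rewrite -leqn0; have [h _] := relax_le (head cand0 cs) (plans (head cand0 cs) cs T) start.
    by apply: leq_trans h _; rewrite /base /= n0 muln0.
  rewrite LPE big1 ?mulr0 // => j _; rewrite T0 big_geq //.
rewrite LPE; apply: (@dp_bound R (head cand0 cs) cs cd lamk K _ _ _ _ _ n T b M) => //.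
- by rewrite /cd; apply: (lam_count_stop ic).
- by move=> i; apply: leq_trans (lamk_ge8 i).
- exact: lamkS_le.
apply: (@le_trans _ _ (\sum_(j < n) 1)); first by rewrite sumr_const card_ord.
by apply: ler_sum => j _; apply: xR_sum.
Qed.

Theorem ml_round : exists p : seq (vertex n),
  [/\ map val p = ml_walk lab A0 cm T, ml_solution p &
      ratr (ml_cost d p) <= 7%:R * (rho * g) * (ratr (lp_cost T x) : R)].
Proof.
have mc := sdist_metric md.
have [_ cmE sy] := ic.
have gcs a : a \in cs -> good_cand c n a.
  by move=> /mapP[l _ ->]; apply: (cand_good mc cmE sy).
have fullE : head cand0 cs = cd K by rewrite /cs (full_cands n).
have full_in : head cand0 cs \in cs by rewrite fullE; apply: cd_cs.
have full0 : (head cand0 cs).2.1 = 0%N by rewrite fullE; apply: (lam_count_stop ic).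
have [p1 p2 p3] := dp_sound mc (gcs _ full_in) full0 gcs T.+1 start.
rewrite -/plan_ in p1 p2 p3.
set W := ml_walk lab A0 cm T.
have WE : W = dedup [::] plan_.2 by rewrite /W /ml_walk size_iota.
have W_in w : w \in W -> (0 < w <= n)%N.
  by rewrite WE dedup_mem andbT => /p2; rewrite mem_iota add1n ltnS.
pose p : seq (vertex n) := [seq inord w | w <- W].
have pW : map val p = W.
  rewrite /p -map_comp -[RHS]map_id; apply/eq_in_map => w /W_in /andP[_ wn] /=.
  by rewrite inordK.
have p_uniq : uniq (Defs.root :: p).
  rewrite -(map_inj_uniq val_inj) /= pW WE dedup_uniq andbT -WE.
  by apply/negP => /W_in.
have nodeP (j : 'I_n) : val (node j) = j.+1 by [].
have p_mem (j : 'I_n) : node j \in p.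
  rewrite -(mem_map val_inj) pW nodeP WE dedup_mem andbT; apply: p1.
  by rewrite mem_iota add1n /= ltnS ltn_ord.
exists p; split=> //.
have k0 : 0 < Kd%:R :> R by rewrite ltr0n scale_gt0.
have H : Kd%:R * ml_cost d p <= plan_.1%:R :> rat.
  rewrite /ml_cost mulr_sumr.
  rewrite (eq_bigr (fun j : 'I_n => (lat c 0 W (pred1 j.+1))%:R)) => [|j _]; last first.
    rewrite /ml_latency (@latency_lat n d md p [set node j] (pred1 j.+1)) ?pW // => v.
    by rewrite inE /= -val_eqE.
  rewrite -natr_sum ler_nat.
  apply: leq_trans (p3 (iota 1 n) (iota_uniq _ _) (fun x h => h) _); last by rewrite size_iota.
  rewrite -(big_mkord predT (fun j => lat c 0 W (pred1 j.+1))) /=.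
  rewrite -[1%N in X in (_ <= X)%N]addn0 iotaDl big_map /index_iota subn0.
  by apply: leq_sum => j _; rewrite WE; apply: lat_dedup.
rewrite -(ler_pM2l k0) -(ratr_nat R) -rmorphM /=.
apply: (@le_trans _ _ plan_.1%:R); first by rewrite -(ratr_nat R) ler_rat.
apply: le_trans value_bound _; rewrite /b ratr_nat le_eqVlt; apply/orP; left; apply/eqP.
by move: (ratr _) (Kd%:R) => l k; ring.
Qed.
End MLRound.

(** The program reads costs in the matrix while the analysis uses [sdist]; they agree on labels up
    to [n], hence on all tours in play. *)
Lemma eq_greedy (c1 c2 : nat -> nat -> nat) cs k U :
  (forall tr, tr \in cs -> tour_len c1 tr = tour_len c2 tr) ->
  greedy c1 cs k U = greedy c2 cs k U.
Proof.
move=> E; have Ec V : choose_tour c1 cs V = choose_tour c2 cs V.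
  by rewrite !choose_tourE; congr foldl; apply/eq_in_map => tr /E ->.
by elim: k U => //= k IH U; rewrite Ec IH.
Qed.

(** * Rounding for MGL *)

Section MGLRound.
Variables (R : realType) (n m : nat) (d : distance n) (G : groups n m) (T : nat).
Variables (x : 'I_m -> nat -> rat) (z : edges n -> nat -> rat) (rho g : R).
Hypothesis md : is_metric d.
Hypothesis rho1 : 1 <= rho.
Hypothesis g1 : 1 <= g.
Hypothesis lpf : lp'_tree_feasible d G T rho g x z.
Let dm := dist_matrix d.
Let Kd := scale dm.
Let cm := scaled dm.
Let c := sdist d.

Definition tree_list : seq (seq (seq (nat * nat) * (nat * nat))) :=
  [seq [seq (tree_edges Q, rat_pair (z Q t)) | Q <- [seq Q <- enum (edges n) | z Q t != 0]]
  | t <- iota 1 T].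

Definition group_list (j : 'I_m) : seq nat := [seq nat_of_ord v | v <- enum (group_nodes G j)].

Let cs := [seq build q.1 | q <- flatten tree_list].
Let avail t := trees_le d (g * t%:R).
Let tour (Q : edges n) := build (tree_edges Q).

Let xR (j : 'I_m) (t : nat) : R := ratr (x j t).

Let xR_ge0 j t : (1 <= t <= T)%N -> 0 <= xR j t.
Proof. by case: lpf => h _ _ _ _ /h; rewrite ler0q. Qed.

Let xR_sum j : 1 <= \sum_(1 <= t < T.+1) xR j t.
Proof.
case: lpf => _ _ h _ _; have := h j; rewrite -(ler_rat R) rmorph1.
by rewrite rmorph_sum.
Qed.

Let tour_in Q t : (1 <= t <= T)%N -> z Q t != 0 -> tour Q \in cs.
Proof.
move=> tT zQ; apply/mapP; exists (tree_edges Q, rat_pair (z Q t)) => //.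
apply/flattenP; eexists; first by apply: map_f; rewrite mem_iota add1n ltnS; exact: tT.
by apply: (map_f (fun Q => (tree_edges Q, rat_pair (z Q t)))); rewrite mem_filter zQ mem_enum.
Qed.

Let cs_sub tr : tr \in cs -> {subset tr <= iota 1 n}.
Proof.
case/mapP=> q /flattenP[s /mapP[t _ ->] /mapP[Q _ ->]] ->.
exact: (tree_walk_sub md).
Qed.

Let tour_le Q t : (1 <= t <= T)%N -> avail t Q ->
  (tour_len c (tour Q))%:R <= 2%:R * g * Kd%:R * t%:R :> R.
Proof.
move=> tT /andP[_ hl].
have := tree_walk_len md Q; rewrite -(ler_rat R) ratr_nat => h; apply: le_trans h _.
rewrite 2!(rmorphM (ratr : rat -> R)) /= !ratr_nat -/dm -/Kd.
have k0 : 0 <= 2%:R * Kd%:R :> R by rewrite mulr_ge0 ?ler0n.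
rewrite mulrA; apply: le_trans (ler_wpM2l k0 hl) _.
by rewrite le_eqVlt; apply/orP; left; apply/eqP; ring.
Qed.

Let tour_hits Q t j : avail t Q -> group_nodes G j :&: tree_nodes Q != set0 ->
  hits (tour Q) (group_list j).
Proof.
move=> /andP[tQ _] /set0Pn[v]; rewrite inE => /andP[vG vQ].
apply/hasP; exists (nat_of_ord v); first by apply: map_f; rewrite mem_enum.
apply: (tree_walk_nodes md) => //.
by case/imsetP: vG => f _ ->.
Qed.

Let grps I := map group_list I.

Let weight t Q : R := if avail t Q then ratr (z Q t) else 0.

Let weight_ge0 t Q : (1 <= t <= T)%N -> 0 <= weight t Q.
Proof.
case: lpf => _ h _ _ _ tT; have := h Q t tT; rewrite /weight /avail.
by case: ifP => // _; rewrite ler0q.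
Qed.

(** At time [T] the trees hitting a group have total weight at least 1, so one of them has nonzero
    weight and appears in the input. *)
Let covered I : uniq I -> I != [::] ->
  exists2 tr, tr \in cs & count (hits tr) (grps I) != 0%N.
Proof.
case: I => // j I _ _.
have T0 : (0 < T)%N.
  by rewrite lt0n; apply: contraTneq (xR_sum j) => ->; rewrite big_geq // ler10.
have TT : (1 <= T <= T)%N by rewrite T0 leqnn.
case: lpf => _ hz hx _ hc; have := le_trans (hx j) (hc j T TT) => h.
have : \sum_(Q | avail T Q && (group_nodes G j :&: tree_nodes Q != set0)) z Q T != 0.
  by apply: contraTneq h => ->; rewrite ler10.
case: (pickP [pred Q | [&& avail T Q, group_nodes G j :&: tree_nodes Q != set0 & z Q T != 0]])
  => [Q /andP[av /andP[cov zQ]] _|al]; last first.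
  by rewrite big1 ?eqxx // => Q /andP[a1 a2]; have := al Q; rewrite /= a1 a2 => /negbFE/eqP.
exists (tour Q); first exact: (tour_in TT).
by rewrite /grps /= (tour_hits av cov).
Qed.

Let B : R := 2%:R * (rho * g) * Kd%:R.

(** The best tour is no worse than the average over the LP trees at time [t]: their total weight is
    at most [rho], their tours are at most twice as long as [g * Kd * t], and the groups of [I] they
    hit, counted with weight, are at least the covered amount. *)
Let ratio I t : uniq I -> (1 <= t <= T)%N ->
  (choose_tour c cs (grps I)).1%:R * (\sum_(j <- I) \sum_(1 <= t' < t.+1) xR j t') <=
  B * t%:R * (choose_tour c cs (grps I)).2.1%:R.
Proof.
move=> uI tT; have [_ _ _ b4] := choose_tour_spec c cs (grps I).
set b := choose_tour c cs (grps I) in b4 *.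
case: lpf => _ hz _ hrho hc.
have b0 : 0 <= b.1%:R :> R by rewrite ler0n.
have n0 : 0 <= b.2.1%:R :> R by rewrite ler0n.
apply: (@le_trans _ _ (b.1%:R * \sum_Q weight t Q * (count (hits (tour Q)) (grps I))%:R)).
  rewrite ler_wpM2l //.
  apply: (@le_trans _ _ (\sum_(j <- I) \sum_Q weight t Q * (hits (tour Q) (group_list j))%:R)).
    apply: ler_sum => j _.
    apply: (@le_trans _ _ (ratr (\sum_(Q | avail t Q && (group_nodes G j :&: tree_nodes Q != set0)) z Q t))).
      by rewrite -rmorph_sum ler_rat; apply: hc.
    rewrite rmorph_sum big_mkcond; apply: ler_sum => Q _; have := weight_ge0 Q tT; rewrite /weight.
    case: (boolP (avail t Q)) => av /= w0; last by rewrite mul0r.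
    case: ifP => cov; first by rewrite (tour_hits av cov) mulr1.
    by rewrite mulr_ge0 ?ler0n.
  rewrite exchange_big /=; apply: ler_sum => Q _; rewrite -mulr_sumr ler_wpM2l ?weight_ge0 //.
  rewrite /grps count_map -sum1_count natr_sum [X in _ <= X]big_mkcond /=.
  by apply: ler_sum => j _; case: (hits _ _).
rewrite mulr_sumr; apply: (@le_trans _ _ (\sum_Q weight t Q * (2%:R * g * Kd%:R * t%:R * b.2.1%:R))).
  apply: ler_sum => Q _; rewrite mulrCA; have w0 := weight_ge0 Q tT.
  case: (boolP (avail t Q)) => av; last by rewrite /weight (negbTE av) !mul0r.
  case: (eqVneq (z Q t) 0) => zQ; first by rewrite /weight av zQ rmorph0 !mul0r.
  rewrite ler_wpM2l //; have [_ h] := b4 _ (tour_in tT zQ).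
  apply: (@le_trans _ _ ((tour_len c (tour Q))%:R * b.2.1%:R)).
    by rewrite -!natrM ler_nat.
  by rewrite ler_wpM2r // tour_le.
rewrite -mulr_suml; apply: (@le_trans _ _ (rho * (2%:R * g * Kd%:R * t%:R * b.2.1%:R))).
  rewrite ler_wpM2r ?mulr_ge0 ?ler0n //; first by apply: le_trans g1.
  by apply: le_trans (hrho t tT); rewrite rmorph_sum [X in _ <= X]big_mkcond.
rewrite /B le_eqVlt; apply/orP; left; apply/eqP.
by move: (Kd%:R) (t%:R) (b.2.1%:R) => k t' w; ring.
Qed.

Theorem mgl_round : exists p : seq (vertex n),
  [/\ map val p = mgl_walk cm cs [seq group_list j | j <- enum 'I_m],
      mgl_solution G p &
      ratr (mgl_cost d G p) <= 8%:R * (rho * g) * (ratr (lp_cost T x) : R)].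
Proof.
have mc := sdist_metric md.
have [_ cmE sy] := scaled_inst md.
set U := [seq group_list j | j <- enum 'I_m].
set W := mgl_walk cm cs U.
set route := greedy c cs m U.
have WE : W = dedup [::] route.
  rewrite /W /mgl_walk /route size_map size_enum_ord; congr dedup; apply: eq_greedy => tr /cs_sub sub.
  rewrite /tour_len (wlen_cm cmE) // => a; rewrite mem_rcons inE => /orP[/eqP->|/sub].
    by rewrite mem_iota.
  by rewrite !mem_iota; lia.
have W_in w : w \in W -> (0 < w <= n)%N.
  rewrite WE dedup_mem andbT => /greedy_sub[tr /cs_sub sub /sub].
  by rewrite mem_iota add1n ltnS.
pose p : seq (vertex n) := [seq inord w | w <- W].
have pW : map val p = W.
  rewrite /p -map_comp -[RHS]map_id; apply/eq_in_map => w /W_in /andP[_ wn] /=.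
  by rewrite inordK.
have p_uniq : uniq (Defs.root :: p).
  rewrite -(map_inj_uniq val_inj) /= pW WE dedup_uniq andbT -WE.
  by apply/negP => /W_in.
have p_hits j : has (mem (group_nodes G j)) p.
  have HU V : V != [::] -> {subset V <= U} -> exists2 tr, tr \in cs & count (hits tr) V != 0%N.
    case: V => // h V _ sub; have /mapP[j' _ Eh] := sub h (mem_head _ _).
    have [tr trcs] := @covered [:: j'] isT isT; rewrite /grps /= addn0 eqb0 negbK => ht.
    by exists tr; rewrite //= Eh ht.
  have szU : (size U <= m)%N by rewrite size_map size_enum_ord.
  have gU : group_list j \in U by apply: map_f; rewrite mem_enum.
  have /hasP[a /mapP[v vG ->] vr] := greedy_hits c HU szU gU.
  apply/hasP; exists v; last by rewrite mem_enum in vG.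
  by rewrite -(mem_map val_inj) pW WE dedup_mem andbT.
exists p; split=> //.
have k0 : 0 < Kd%:R :> R by rewrite ltr0n scale_gt0.
have H : Kd%:R * mgl_cost d G p <= (greedy_cost c cs m U)%:R :> rat.
  rewrite /mgl_cost mulr_sumr.
  rewrite (eq_bigr (fun j : 'I_m => (lat c 0 W (fun a => a \in group_list j))%:R)) => [|j _]; last first.
    rewrite /mgl_latency (@latency_lat n d md p _ (fun a => a \in group_list j)) ?pW // => v.
    by rewrite (mem_map val_inj) mem_enum.
  rewrite -natr_sum ler_nat; apply: leq_trans (lat_greedy cs mc m U).
  rewrite /U big_map big_enum /=; apply: leq_sum => j _; rewrite WE; exact: lat_dedup.
have B0 : 0 <= B by rewrite /B !mulr_ge0 ?ler0n ?(le_trans ler01).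
have LPE : ratr (lp_cost T x) = \sum_j \sum_(1 <= t < T.+1) t%:R * xR j t.
  rewrite rmorph_sum; apply: eq_bigr => j _; rewrite rmorph_sum; apply: eq_bigr => t _.
  by rewrite rmorphM /= ratr_nat.
have := @greedy_cost_bound R c cs m T group_list xR B B0 xR_ge0 xR_sum ratio covered m (enum 'I_m) (enum_uniq _).
rewrite -LPE -/U => H2.
rewrite -(ler_pM2l k0) -(ratr_nat R) -(rmorphM (ratr : rat -> R)) /=.
apply: (@le_trans _ _ (greedy_cost c cs m U)%:R); first by rewrite -(ratr_nat R) ler_rat.
apply: le_trans H2 _; rewrite /B ratr_nat le_eqVlt; apply/orP; left; apply/eqP.
by move: (ratr _) (Kd%:R) => l k; ring.
Qed.
End MGLRound.

(** * Encoded inputs and conclusion *)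

Lemma enc_pathE n (p : seq (vertex n)) : enc_path p = eL eN (map val p).
Proof. by rewrite -enc_seq_map. Qed.

Definition ml_instance n (d : distance n) (T : nat) (U : finType) (enc : U -> data)
  (x : 'I_n -> nat -> rat) (z : U -> nat -> rat) : ml_input :=
  (dist_matrix d, (T, (enc_x T x,
     [seq enc_seq (fun Q => Node (enc Q) (enc_rat (z Q t))) [seq Q <- enum U | z Q t != 0]
     | t <- iota 1 T]))).

Lemma enc_ml_instance n (d : distance n) T (U : finType) (enc : U -> data) x z :
  enc_ml_input (ml_instance d T enc x z) = enc_ml d T x (enc_z T enc z).
Proof.
by rewrite /enc_ml_input /eP /= -enc_distanceE -(enc_seq_map _ id).
Qed.

Definition mgl_instance n m (d : distance n) (G : groups n m) (T : nat)
  (x : 'I_m -> nat -> rat) (z : edges n -> nat -> rat) : mgl_input :=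
  (dist_matrix d, ([seq group_list G j | j <- enum 'I_m], (T, (enc_x T x, tree_list T z)))).

Lemma enc_mgl_instance n m (d : distance n) (G : groups n m) T x z :
  enc_mgl_input (mgl_instance d G T x z) = enc_mgl d G T x (enc_z T (@enc_tree n) z).
Proof.
rewrite /enc_mgl_input /eP /= -enc_distanceE /enc_mgl /enc_groups /enc_z.
congr (Node _ (Node _ (Node _ (Node _ _)))).
  rewrite -(enc_seq_map (group_list G) (eL eN)); apply: eq_enc_seq => j.
  by rewrite enc_pathE.
rewrite /tree_list -enc_seq_map; apply: eq_enc_seq => t.
rewrite -enc_seq_map; apply: eq_enc_seq => Q /=.
by rewrite enc_treeE.
Qed.

Definition ml_valid (i : ml_input) : Prop :=
  exists n (d : distance n), is_metric d /\ i.1 = dist_matrix d.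

Lemma ml_valid_inst i : ml_valid i -> exists n c, size i.1 = n.+1 /\ inst n c (scaled i.1).
Proof.
case=> n [d [md ->]]; exists n, (sdist d); split; first exact: size_dist_matrix.
exact: scaled_inst.
Qed.

Lemma ml_programE n (d : distance n) T (U : finType) (enc : U -> data) x z :
  ml_program (ml_instance d T enc x z) =
  ml_walk (iota 0 n.+1) (iota 1 n) (scaled (dist_matrix d)) T.
Proof.
rewrite /ml_program /nonroot /labels /= size_dist_matrix size_map size_iota.
congr ml_walk; rewrite /=; apply/all_filterP/allP => a.
by rewrite mem_iota; case: a.
Qed.

(** The path [p] is the same for all coin flips, so its expected cost is its cost. *)
Lemma rounds_randI (R : realType) n alg a input (sol : seq (vertex n) -> Prop) cost (bound : R) p :
  (forall w, computes alg (Node input (enc_bits w)) (enc_path p) (time_bound a).[data_size input]) ->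
  sol p -> ratr (cost p) <= bound -> rounds_rand alg (time_bound a) input sol cost bound.
Proof.
move=> hc hs hb; rewrite /rounds_rand; exists (fun _ => p); split=> [w|w|] //.
rewrite sumr_const card_tuple card_bool -[X in X / _]mulr_natr natrX mulfK //.
by rewrite expf_neq0.
Qed.

Theorem theorem3p4 (R : realType) :
  [/\ exists (C : R) (alg : program) (q : {poly nat}),
        forall (rho gamma : R), 1 <= rho -> 1 <= gamma ->
        forall (n : nat) (d : distance n) (T : nat),
        is_metric d -> integer_valued d -> ml_horizon d T ->
        forall (x : 'I_n -> nat -> rat) (z : edges n -> nat -> rat),
        lp2_tree_feasible d T rho gamma x z ->
        rounds_rand alg q (enc_ml d T x (enc_z T (@enc_tree n) z))
          (@ml_solution n) (ml_cost d)
          (C * (rho * gamma) * ratr (lp_cost T x)),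
      exists (C : R) (alg : program) (q : {poly nat}),
        forall (rho gamma : R), 1 <= rho -> 1 <= gamma ->
        forall (n m : nat) (d : distance n) (G : groups n m) (T : nat),
        is_metric d -> mgl_horizon d G T ->
        forall (x : 'I_m -> nat -> rat) (z : edges n -> nat -> rat),
        lp'_tree_feasible d G T rho gamma x z ->
        rounds_rand alg q (enc_mgl d G T x (enc_z T (@enc_tree n) z))
          (mgl_solution G) (mgl_cost d G)
          (C * (rho * gamma) * ratr (lp_cost T x)) &
      exists (alg : program) (q : {poly nat}),
        forall (rho gamma : R), 1 <= rho -> 1 <= gamma ->
        forall (n : nat) (d : distance n) (T : nat),
        is_metric d -> integer_valued d -> ml_horizon d T ->
        forall (x : 'I_n -> nat -> rat) (z : route n -> nat -> rat),
        lp2_path_feasible d T rho gamma x z ->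
        rounds_det alg q
          (enc_ml d T x
             (enc_z T (fun P : route n => enc_path (bseqval P)) z))
          (@ml_solution n) (ml_cost d)
          ((359%:R / 100%:R * 2%:R) * (rho * gamma) * ratr (lp_cost T x))].
Proof.
split.
- have [alg [a H]] := PT_program (X := rand_ctx enc_ml_input ml_valid) erefl
    (@PT_ml_program (rand_ctx enc_ml_input ml_valid) fst
      (fun e de => ml_valid_inst de) (PT_rand enc_ml_input ml_valid)).
  (* 7 for walks, doubled because the walk around a tree may be twice as long as the tree;
     [ml_round] is applied with [2 * gamma]. *)
  exists 14%:R, alg, (time_bound a) => rho gamma rho1 g1 n d T md _ _ x z [_ lpf].
  have g2 : 1 <= 2%:R * gamma by lra.
  have [|||p [pW ps pc]] := @ml_round R n d T _ _ _ (fun Q => build (tree_edges Q)) x z rho (2%:R * gamma) md rho1 g2 lpf.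
  + move=> t Q _ _ a' /(tree_walk_sub md); rewrite !mem_iota; lia.
  + move=> t Q tT /andP[_ hl].
    have h1 : (wlen (sdist d) 0 (build (tree_edges Q)))%:R <= 2%:R * ((scale (dist_matrix d))%:R * tree_len d Q) :> rat.
      by apply: le_trans (tree_walk_len md Q); rewrite ler_nat; apply: wlen_closed.
    move: h1; rewrite -(ler_rat R) ratr_nat => h1; apply: le_trans h1 _.
    rewrite 2!(rmorphM (ratr : rat -> R)) /= !ratr_nat.
    have k0 : 0 <= 2%:R * (scale (dist_matrix d))%:R :> R by rewrite mulr_ge0 ?ler0n.
    rewrite mulrA; apply: le_trans (ler_wpM2l k0 hl) _.
    by rewrite le_eqVlt; apply/orP; left; apply/eqP; ring.
  + move=> t Q j tT /andP[tQ _] cov.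
    exact: (tree_walk_nodes md tQ (_ : node j != Defs.root) cov).
  apply: (rounds_randI (p := p)) => //.
    move=> w; have de : ml_valid (ml_instance d T (@enc_tree n) x z) by exists n, d.
    rewrite -enc_ml_instance enc_pathE pW -(ml_programE d T (@enc_tree n) x z).
    exact: (H (ml_instance d T (@enc_tree n) x z, w) _ de erefl).
  by apply: le_trans pc _; rewrite le_eqVlt; apply/orP; left; apply/eqP; ring.
- have [alg [a H]] := PT_program (X := rand_ctx enc_mgl_input (fun _ => True)) erefl
    (PT_mgl_program (PT_rand enc_mgl_input (fun _ => True))).
  exists 8%:R, alg, (time_bound a) => rho gamma rho1 g1 n m d G T md _ x z lpf.
  have [p [pW ps pc]] := mgl_round md rho1 g1 lpf.
  apply: (rounds_randI (p := p)) => // w.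
  rewrite -enc_mgl_instance enc_pathE pW.
  exact: (H (mgl_instance d G T x z, w) _ I erefl).
have [alg [a H]] := PT_program (X := det_ctx enc_ml_input ml_valid) erefl
  (@PT_ml_program (det_ctx enc_ml_input ml_valid) id
    (fun e de => ml_valid_inst de) (PT_det enc_ml_input ml_valid)).
exists alg, (time_bound a) => rho gamma rho1 g1 n d T md _ _ x z [_ lpf].
have [|||p [pW ps pc]] := @ml_round R n d T _ _ _ (fun P => map val (bseqval P)) x z rho gamma md rho1 g1 lpf.
- by move=> t Q _ _ a' /mapP[v _ ->]; rewrite mem_iota ltn_ord.
- move=> t Q tT /andP[_ hl].
  have := wlen_path md (bseqval Q) => E.
  have -> : (wlen (sdist d) 0 (map val (bseqval Q)))%:R = ratr ((scale (dist_matrix d))%:R * path_len d Q) :> R.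
    by rewrite -E ratr_nat.
  rewrite (rmorphM (ratr : rat -> R)) /= ratr_nat mulrC -mulrA [X in _ <= _ * X]mulrC mulrA ler_wpM2r ?ler0n //.
- by move=> t Q j tT _ cov; apply/mapP; exists (node j).
exists p; split=> //.
  have de : ml_valid (ml_instance d T (fun P : route n => enc_path (bseqval P)) x z) by exists n, d.
  rewrite -enc_ml_instance enc_pathE pW.
  rewrite -(ml_programE d T (fun P : route n => enc_path (bseqval P)) x z).
  exact: (H (ml_instance d T (fun P : route n => enc_path (bseqval P)) x z) _ de erefl).
apply: le_trans pc _.
have L0 : 0 <= rho * gamma * ratr (lp_cost T x) :> R.
  have lp0 : 0 <= lp_cost T x.
    apply: sumr_ge0 => j _; rewrite big_nat sumr_ge0 // => t tT.
    by rewrite mulr_ge0 ?ler0n //; case: lpf => h _ _ _ _; apply: h.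
  apply: mulr_ge0; last by rewrite ler0q.
  by apply: mulr_ge0; exact: (le_trans ler01).
(* The walks are the LP paths themselves, so the factor stays 7, below 3.59 times 2, which is
   7.18. *)
by rewrite -[X in X <= _]mulrA -[X in _ <= X]mulrA; apply: ler_wpM2r => //; lra.
Qed.
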